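(* Let $K\neq 2^{[m]}$ be a simplicial complex on $[m]$. For non-negative integers $i$ and $j$, the bigraded Betti number $\beta^{-i,2j}(\operatorname{Bier}(K))$ of the Bier sphere $\operatorname{Bier}(K)$ in bidegree $(-i,2j)$ equals $$\delta_{2i,j}\,|\mathcal F^+_j|+\delta_{2i-2,j}\,|\mathcal F^-_j|+\sum_{\substack{J\subsetneq I\subseteq[m]\\ |I|+|J|=j\\ J\in K}}\widetilde\beta^{\,|I|-i-1}\big(\operatorname{Lk}(J,K|_I)\big)+\sum_{\substack{I\subsetneq J\subseteq[m]\\ |I|+|J|=j\\ \bar I\in\hat K}}\widetilde\beta^{\,|J|-i-1}\big(\operatorname{Lk}(\bar I,\hat K|_{\bar J})\big),$$ where $\delta_{a,b}$ is the Kronecker delta, the sums run over pairs $(I,J)$, and $$\mathcal F^+_k=\{\sigma\subseteq[m]:|\sigma|=k/2,\ \sigma\in K,\ \bar\sigma\in\hat K\},\qquad \mathcal F^-_k=\{\tau\subseteq[m]:|\tau|=k/2,\ \tau\notin K,\ \bar\tau\notin\hat K\}.$$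
   Context: $[m]=\{1,\dots,m\}$, $[\bar m]=\{\bar1,\dots,\bar m\}$ is a disjoint copy, and for $I\subset[m]$, $\bar I=\{\bar i:i\in I\}$. A simplicial complex on a finite set $S$ is a collection of subsets of $S$ closed under taking subsets and containing $\emptyset$; elements of $S$ that are not faces are ghost vertices and are allowed. The Alexander dual of $K$ is $\hat K=\{\bar\sigma\subseteq[\bar m]:[m]\setminus\sigma\notin K\}$, a complex on $[\bar m]$. The Bier sphere is the complex on $[m]\sqcup[\bar m]$ (all $2m$ elements count as vertices, including ghost ones) given by $\operatorname{Bier}(K)=\{\sigma\sqcup\tau:\sigma\in K,\tau\in\hat K,\bar\sigma\cap\tau=\emptyset\}$. Full subcomplex: $\Gamma|_W=\{\sigma\in\Gamma:\sigma\subseteq W\}$. Link of $\sigma\in\Gamma$: $\operatorname{Lk}(\sigma,\Gamma)=\{\tau\in\Gamma:\sigma\cap\tau=\emptyset,\sigma\cup\tau\in\Gamma\}$. $\widetilde\beta^{k}(\Gamma)=\dim_{\mathbb Q}\widetilde H^k(\Gamma;\mathbb Q)$ is the reduced Betti number; $\widetilde\beta^{-1}(\{\emptyset\})=1$, and $\widetilde\beta^k=0$ for $k<-1$. Bigraded Betti numbers: for a simplicial complex $\Gamma$ on a vertex set $V$ with $|V|=n$ (ghost vertices included), let $R=\mathbb Q[v_1,\dots,v_n]$ with $\deg v_s=2$ and let $\mathbb Q(\Gamma)=R/I_\Gamma$ be the Stanley–Reisner ring, where $I_\Gamma$ is generated by the square-free monomials $v_{s_1}\cdots v_{s_r}$ with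 $\{s_1,\dots,s_r\}\notin\Gamma$. Then $\beta^{-i,2j}(\Gamma)=\dim_{\mathbb Q}\operatorname{Tor}_R^{-i,2j}(\mathbb Q(\Gamma),\mathbb Q)$, i.e. the number of generators of internal degree $2j$ in the $i$-th term $F^{-i}$ of a minimal graded free resolution of $\mathbb Q(\Gamma)$ over $R$. *)

(* Defs.v *)
From mathcomp Require Import all_boot all_order all_algebra.
From mathcomp Require Import mpoly.
From Stdlib Require Import ClassicalEpsilon.

Set Implicit Arguments.
Unset Strict Implicit.
Unset Printing Implicit Defensive.

Import GRing.Theory.
Local Open Scope ring_scope.

(* A matrix acts on row vectors, [v |-> v *m A].  For composable A, B with
   [A *m B = 0] this is the dimension of ker B / im A. *)
Definition hdim (p n q : nat) (A : 'M[rat]_(p, n)) (B : 'M[rat]_(n, q)) : nat :=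
  (\rank (kermx B) - \rank A)%N.

Section Complexes.

Variable T : finType.
Implicit Types (G : {set {set T}}) (s W : {set T}).

(* Not every element of T need be a vertex: ghost vertices are allowed. *)
Definition simplicial_complex G : Prop :=
  set0 \in G /\ forall s t : {set T}, s \in G -> t \subset s -> t \in G.

Definition restr G W : {set {set T}} := [set s in G | s \subset W].

Definition link s G : {set {set T}} :=
  [set t : {set T} in G | [disjoint s & t] && (s :|: t \in G)].

(* Faces of cardinality c, i.e. of dimension c - 1; c = 0 is the augmentation
   term of the cochain complex. *)
Definition faces G (c : nat) : {set {set T}} := [set s in G | #|s| == c].

Definition incidence (s t : {set T}) : rat :=
  \sum_(v in t | t :\ v == s)
     (-1) ^+ #|[set u in t | (enum_rank u < enum_rank v)%N]|.

Definition coboundary G (c : nat) :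
    'M[rat]_(#|faces G c|, #|faces G c.+1|) :=
  \matrix_(a, b) incidence (enum_val a) (enum_val b).

Definition cohom_dim G (c : nat) : nat :=
  match c with
  | 0 => hdim (0 : 'M_(0, #|faces G 0|)) (coboundary G 0)
  | c'.+1 => hdim (coboundary G c') (coboundary G c'.+1)
  end.

Definition reduced_betti (k : int) G : nat :=
  match (k + 1)%R with
  | Posz c => cohom_dim G c
  | Negz _ => 0%N
  end.

End Complexes.

(* Graded free resolutions, by modules of finite rank, of the cyclic module
   R / I over R = Q[v_1, ..., v_n], where every v_s has degree 2:

     ... --> F_2 --dif 1--> F_1 --dif 0--> F_0 --aug--> R / I --> 0.

   F_i = R^(rk i) is the module of row vectors, with [gdeg i a] the degree of
   the a-th basis vector.  The map F_0 -> R / I sends the a-th basis vector to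
   the class of the polynomial [aug a 0]. *)
Record graded_free_resolution (n : nat) (I : {mpoly rat[n]} -> Prop) := GFRes {
  rk : nat -> nat;
  gdeg : forall i, 'I_(rk i) -> nat;
  dif : forall i, 'M[{mpoly rat[n]}]_(rk i.+1, rk i);
  aug : 'cV[{mpoly rat[n]}]_(rk 0);
  dif_homog : forall i a b mon, mon \in msupp (dif i a b) ->
    gdeg a = (2 * mdeg mon + gdeg b)%N;
  aug_homog : forall a mon, mon \in msupp (aug a 0) ->
    gdeg a = (2 * mdeg mon)%N;
  aug_surj : forall p, exists w : 'rV_(rk 0), I (p - (w *m aug) 0 0);
  exact_0 : forall w : 'rV_(rk 0),
    I ((w *m aug) 0 0) <-> exists u : 'rV_(rk 1), w = u *m dif 0;
  exact_S : forall i (w : 'rV_(rk i.+1)),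
    w *m dif i = 0 <-> exists u : 'rV_(rk i.+2), w = u *m dif i.+1
}.

Section Tor.

Variables (n : nat) (I : {mpoly rat[n]} -> Prop).
Variable F : graded_free_resolution I.

Definition gens (i e : nat) : {set 'I_(rk F i)} :=
  [set a | gdeg (g := F) a == e].

(* The degree-e strand of F_(i+1) (x)_R Q -> F_i (x)_R Q, where Q is the residue
   field R / (v_1, ..., v_n): only the constant coefficients survive. *)
Definition tor_dif (i e : nat) : 'M[rat]_(#|gens i.+1 e|, #|gens i e|) :=
  \matrix_(a, b) (dif F i (enum_val a) (enum_val b))@_0%MM.

Definition tor_dim (i e : nat) : nat :=
  match i with
  | 0 => hdim (tor_dif 0 e) (0 : 'M_(#|gens 0 e|, 0))
  | i'.+1 => hdim (tor_dif i'.+1 e) (tor_dif i' e)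
  end.

End Tor.

Section StanleyReisner.

Variables (V : finType) (G : {set {set V}}).

Definition sr_monomial (S : {set V}) : {mpoly rat[#|V|]} :=
  \prod_(s in S) 'X_(enum_rank s).

Definition sr_ideal (p : {mpoly rat[#|V|]}) : Prop :=
  exists c : {set V} -> {mpoly rat[#|V|]},
    p = \sum_(S | S \notin G) c S * sr_monomial S.

(* dim_Q Tor_R^{-i,e}(Q(G), Q), with e the internal degree, read off from an
   arbitrarily chosen graded free resolution of Q(G) = R / I_G. *)
Definition bigraded_betti (i e : nat) : nat :=
  epsilon (inhabits 0%N) (fun b : nat =>
    exists F : graded_free_resolution sr_ideal, b = tor_dim F i e).

End StanleyReisner.

Section Bier.

Variables (m : nat) (K : {set {set 'I_m}}).

(* The disjoint copy of [m] is identified with 'I_m in the dual complex; it is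
   the right-hand summand of 'I_m + 'I_m in the Bier sphere. *)
Definition alexander_dual : {set {set 'I_m}} :=
  [set s : {set 'I_m} | ~: s \notin K].

Definition bier : {set {set ('I_m + 'I_m)%type}} :=
  [set (inl @: s) :|: (inr @: t) | s : {set 'I_m} in K, t : {set 'I_m} in alexander_dual
     & [disjoint s & t]].

Definition Fplus (k : nat) : {set {set 'I_m}} :=
  [set s : {set 'I_m} | [&& (2 * #|s| == k)%N, s \in K & s \in alexander_dual]].

Definition Fminus (k : nat) : {set {set 'I_m}} :=
  [set t : {set 'I_m} | [&& (2 * #|t| == k)%N, t \notin K & t \notin alexander_dual]].

End Bier.

Definition kronecker (a b : int) : nat := (a == b).

(* Main.v *)
(* Hochster's formula expresses the bigraded Betti numbers of Bier(K) through the
   reduced Betti numbers of its full subcomplexes; these are then computed one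
   by one.

   Hochster: for any graded free resolution F of R / I, splitting F into short
   exact sequences of syzygies and using that the Koszul complex of a free
   module is acyclic in positive degrees identifies H_i(F (x) Q) with the i-th
   Koszul homology of R / I.  In a multidegree that is not square-free this
   homology vanishes (toggle a variable of exponent at least 2 in the exterior
   part), and in the square-free multidegree W the Koszul complex is, up to
   signs, the cochain complex of the full subcomplex on W.  The Taylor complex
   shows that a resolution exists; the Koszul complex is its special case for
   the variables, so both are exact by the same contraction.

   Full subcomplexes: the one on I |_| bar J consists of the disjoint pairs
   (s, t) with s in K|_I and t in hat K|_J.  If a is in I \ J, outside the
   (acyclic) star of a the condition on t becomes automatic, and toggling bar b
   for b in J \ s cancels everything but the pairs with J contained in s,
   which are the faces of Lk(J, K|_I) outside the star of a, shifted by |J|;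
   if J is not contained in I everything cancels.  The case of I properly
   contained in J is symmetric by Alexander duality, and for I = J the same
   cancellations leave at most one cell. *)
Require Import Defs.
From mathcomp Require Import all_boot all_order all_algebra.
From mathcomp Require Import mpoly ring zify.
From Stdlib Require Import ClassicalEpsilon.

Set Implicit Arguments.
Unset Strict Implicit.
Unset Printing Implicit Defensive.

Import GRing.Theory.
Local Open Scope ring_scope.

(** * Dimensions of subquotients *)

(** The obstacle is that the spaces to be compared have no common finite-dimensional model: Koszul
    chains have polynomial entries, cycles are predicates on them, and connecting maps are defined
    by lifting. Hence the dimension of a subquotient is a relation [qdim] between two predicates and
    a number, and isomorphisms are carried by linear relations, for which a lift only has to exist.
    Removing stars and subcomplexes destroys closure under subsets, so cochains live on convex
    families of sets. Since [bigraded_betti] picks its resolution by [epsilon], the value has to be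
    computed for an arbitrary resolution, possibly not minimal and with several generators in F_0.
    The link between such a resolution and Koszul homology is made in Koszul degree 0, where only
    constant coefficients survive modulo boundaries. *)

Lemma dep_choice (I : Type) (X : I -> Type) (P : forall i, X i -> Prop) :
  (forall i, exists x, P i x) -> exists f : forall i, X i, forall i, P i (f i).
Proof.
move=> h; exists (fun i => proj1_sig (constructive_indefinite_description _ (h i))).
by move=> i; case: constructive_indefinite_description.
Qed.

(** Scalars are rational throughout, but Koszul chains form a module over the polynomial ring and
    cochains one over [rat]; [iota] lets a single notion serve both. *)
Definition subsp (A : pzRingType) (iota : {rmorphism rat -> A})
    (V : lmodType A) (B : V -> Prop) : Prop :=
  [/\ B 0, forall x y, B x -> B y -> B (x + y)
    & forall c x, B x -> B (iota c *: x)].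

(* Z / B has dimension d over the rationals, the elements x being a basis. *)
Definition qdim (A : pzRingType) (iota : {rmorphism rat -> A})
    (V : lmodType A) (Z B : V -> Prop) (d : nat) : Prop :=
  exists x : 'I_d -> V,
    [/\ forall k, Z (x k),
        forall z, Z z -> exists c : 'I_d -> rat,
          B (z - \sum_k iota (c k) *: x k)
      & forall c : 'I_d -> rat, B (\sum_k iota (c k) *: x k) ->
          forall k, c k = 0].

Section Subspaces.
Variables (A : pzRingType) (iota : {rmorphism rat -> A}) (V : lmodType A).
Implicit Types (Z B : V -> Prop).

Lemma subspN B x : subsp iota B -> B x -> B (- x).
Proof. by case=> _ _ sB /(sB (-1)); rewrite rmorphN1 scaleN1r. Qed.

Lemma subspB B x y : subsp iota B -> B x -> B y -> B (x - y).
Proof. by move=> sB Bx By; case: (sB) => _ aB _; apply: aB => //; apply: subspN. Qed.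

Lemma subsp_sum B (I : finType) (c : I -> rat) (x : I -> V) :
  subsp iota B -> (forall i, B (x i)) -> B (\sum_i iota (c i) *: x i).
Proof.
by case=> B0 aB sB Bx; apply: big_ind => // i _; apply/sB/Bx.
Qed.

Lemma qdim_fin (I : finType) Z B (x : I -> V) :
  (forall i, Z (x i)) ->
  (forall z, Z z -> exists c : I -> rat, B (z - \sum_i iota (c i) *: x i)) ->
  (forall c : I -> rat, B (\sum_i iota (c i) *: x i) -> forall i, c i = 0) ->
  qdim iota Z B #|I|.
Proof.
have E (c : I -> rat) : \sum_i iota (c i) *: x i =
    \sum_(k < #|I|) iota (c (enum_val k)) *: x (enum_val k).
  rewrite (reindex (@enum_val I I)); first by [].
  by apply: onW_bij; exact: enum_val_bij.
move=> Zx gen free; exists (fun k => x (enum_val k)); split=> //.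
- by move=> z /gen[c]; rewrite E => Bz; exists (fun k => c (enum_val k)).
- move=> c Bc k; have := free (fun i => c (enum_rank i)).
  rewrite E; under eq_bigr do rewrite enum_valK.
  by move=> /(_ Bc (enum_val k)); rewrite enum_valK.
Qed.

(** Writing x in terms of y and y in terms of x modulo B gives two matrices; by freeness of x their
    product is the identity of size d, and a product through size d' can be that only if d <= d'. *)
Lemma qdim_leq Z B d d' : subsp iota B ->
  qdim iota Z B d -> qdim iota Z B d' -> (d <= d')%N.
Proof.
move=> sB [x [Zx genx freex]] [y [Zy geny freey]].
have [M hM] := dep_choice (fun k => geny _ (Zx k)).
have [N hN] := dep_choice (fun k => genx _ (Zy k)).
pose Mm := \matrix_(k < d, l < d') M k l; pose Nm := \matrix_(k < d', l < d) N k l.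
apply: (@mulmx1_min _ _ _ Mm Nm).
apply/matrixP => k l; apply/eqP; rewrite -subr_eq0; apply/eqP.
pose D := Mm *m Nm - 1%:M; suff /freex/(_ l) : B (\sum_l iota (D k l) *: x l).
  by rewrite /D !mxE.
have -> : \sum_l iota (D k l) *: x l =
    - ((x k - \sum_l iota (M k l) *: y l) +
       \sum_l iota (M k l) *: (y l - \sum_i iota (N l i) *: x i)).
  under [X in - (_ + X)]eq_bigr do rewrite scalerBr.
  rewrite sumrB addrA subrK opprB.
  rewrite /D; under eq_bigr do rewrite !mxE rmorphB scalerBl.
  rewrite sumrB [X in _ - X](bigD1 k) //= eqxx rmorph1 scale1r.
  rewrite [X in _ - (_ + X)]big1 ?addr0; last first.
    by move=> i; rewrite eq_sym => /negPf ->; rewrite rmorph0 scale0r.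
  congr (_ - _); under eq_bigr do rewrite rmorph_sum scaler_suml.
  rewrite exchange_big /=; apply: eq_bigr => i _; rewrite scaler_sumr.
  by apply: eq_bigr => j _; rewrite !mxE rmorphM scalerA.
apply: (subspN sB); case: (sB) => _ aB _; apply: aB => //.
exact: subsp_sum.
Qed.

Lemma qdim_uniq Z B d d' : subsp iota B ->
  qdim iota Z B d -> qdim iota Z B d' -> d = d'.
Proof.
move=> sB h h'; apply/eqP; rewrite eqn_leq.
by rewrite (qdim_leq sB h h') (qdim_leq sB h' h).
Qed.

Lemma qdim0 Z B : (forall z, Z z -> B z) -> qdim iota Z B 0.
Proof.
move=> h; exists (fun k => 0); split.
- by case.
- by move=> z /h Bz; exists (fun _ => 0); rewrite big_ord0 subr0.
- by move=> c _ [].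
Qed.

Lemma qdim_ext Z B Z' B' d : (forall z, Z z <-> Z' z) -> (forall z, B z <-> B' z) ->
  qdim iota Z B d -> qdim iota Z' B' d.
Proof.
move=> eZ eB [x [Zx gen free]]; exists x; split.
- by move=> k; apply/eZ.
- by move=> z /eZ/gen[c Bc]; exists c; apply/eB.
- by move=> c /eB/free.
Qed.

End Subspaces.

Section Transport.
Variables (A A' : pzRingType) (iota : {rmorphism rat -> A})
  (iota' : {rmorphism rat -> A'}) (V : lmodType A) (V' : lmodType A').

(** A relation instead of a map: connecting homomorphisms depend on lifts, and a relation avoids
    choosing these linearly. *)
Definition linrel (L : V -> V' -> Prop) : Prop :=
  [/\ L 0 0, forall x y x' y', L x x' -> L y y' -> L (x + y) (x' + y')
    & forall c x x', L x x' -> L (iota c *: x) (iota' c *: x')].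

(* L induces an isomorphism between Z / B and Z' / B'. *)
Definition subq_iso (L : V -> V' -> Prop) (Z B : V -> Prop) (Z' B' : V' -> Prop) : Prop :=
  [/\ linrel L,
      forall z, Z z -> exists z', Z' z' /\ L z z',
      forall z', Z' z' -> exists z, Z z /\ L z z'
    & forall z z', Z z -> Z' z' -> L z z' -> (B z <-> B' z')].

Lemma linrel_sum L (I : finType) (c : I -> rat) (x : I -> V) (x' : I -> V') :
  linrel L -> (forall i, L (x i) (x' i)) ->
  L (\sum_i iota (c i) *: x i) (\sum_i iota' (c i) *: x' i).
Proof.
case=> L0 La Ls h; apply: (@big_ind2 V V' L 0 +%R 0 +%R L0) => [x1 x2 y1 y2|i _]; [exact: La|exact: Ls].
Qed.

Lemma qdim_transport L Z B Z' B' d :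
  subsp iota Z -> subsp iota' Z' -> subq_iso L Z B Z' B' ->
  qdim iota Z B d -> qdim iota' Z' B' d.
Proof.
move=> sZ sZ' [Ll Z_ex Z'_ex LB] [x [Zx gen free]].
have [x' hx'] := dep_choice (fun k => Z_ex _ (Zx k)).
have Zx' k : Z' (x' k) by case: (hx' k).
have Lx' k : L (x k) (x' k) by case: (hx' k).
have Ls c := linrel_sum c Ll Lx'.
exists x'; split=> //.
- move=> z' Zz'; have [z [Zz Lz]] := Z'_ex _ Zz'.
  have [c Bc] := gen _ Zz; exists c; apply: (proj1 (LB _ _ _ _ _)) Bc.
  + exact: (subspB sZ Zz (subsp_sum c sZ Zx)).
  + exact: (subspB sZ' Zz' (subsp_sum c sZ' Zx')).
  + case: Ll => _ La Lsc; apply: La => //.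
    by have := Lsc (-1) _ _ (Ls c); rewrite !rmorphN1 !scaleN1r.
- move=> c Bc; apply: free; exact: (proj2 (LB _ _ (subsp_sum c sZ Zx) (subsp_sum c sZ' Zx') (Ls c)) Bc).
Qed.

(** Here p and p' project onto one fixed degree. That degree of Z / B is encoded by the preimages of
    Z and B under p; both contain the kernel of p when B contains 0, so the quotient sees only the
    image of p. *)
Lemma subq_iso_graded L Z B Z' B' (p : V -> V) (p' : V' -> V') :
  linrel (fun x y => L (p x) (p' y)) ->
  (forall z, p (p z) = p z) -> (forall z, p' (p' z) = p' z) ->
  (forall z, Z z -> Z (p z)) -> (forall z, Z' z -> Z' (p' z)) ->
  (forall z z', L z z' -> L (p z) (p' z')) ->
  subq_iso L Z B Z' B' ->
  subq_iso (fun z z' => L (p z) (p' z')) (fun z => Z (p z)) (fun z => B (p z))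
    (fun z => Z' (p' z)) (fun z => B' (p' z)).
Proof.
move=> Lp pp pp' Zp Zp' Lpp [Ll Z_ex Z'_ex LB]; split=> //.
- move=> z /Z_ex[z' [Zz' Lz]]; exists z'; split; first exact: Zp'.
  by move/Lpp: Lz; rewrite pp.
- move=> z /Z'_ex[z' [Zz' Lz]]; exists z'; split; first exact: Zp.
  by move/Lpp: Lz; rewrite pp'.
- by move=> z z' Zz Zz' Lz; apply: LB.
Qed.

End Transport.

Lemma qdim_transport_sym (A A' : pzRingType) (iota : {rmorphism rat -> A})
  (iota' : {rmorphism rat -> A'}) (V : lmodType A) (V' : lmodType A')
  (L : V -> V' -> Prop) Z B Z' B' d :
  subsp iota Z -> subsp iota' Z' -> subq_iso iota iota' L Z B Z' B' ->
  qdim iota' Z' B' d -> qdim iota Z B d.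
Proof.
move=> sZ sZ' [[L0 La Ls] h1 h2 h3].
apply: (@qdim_transport _ _ _ _ _ _ (fun x y => L y x)) => //; split=> //.
- by split=> [//|x y x' y'|c x x']; [exact: La|exact: Ls].
- by move=> z z' Zz Zz' Lz; apply: iff_sym; apply: h3.
Qed.

(** The basis is taken from a complement of the row space of A inside the kernel of B; its dimension
    is [hdim A B] because A *m B = 0 puts the former space inside the latter. *)
Lemma hdim_qdim (p n q : nat) (A : 'M[rat]_(p, n)) (B : 'M[rat]_(n, q)) :
  A *m B = 0 ->
  qdim idfun (fun v : 'rV[rat]_n => v *m B = 0) (fun v => exists u, v = u *m A)
    (hdim A B).
Proof.
move=> AB0.
have sAB : (A <= kermx B)%MS by apply/sub_kermxP.
pose C := (kermx B :\: A)%MS.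
have rC : \rank C = hdim A B.
  rewrite /hdim -(mxrank_cap_compl (kermx B) A) (capmx_idPr sAB).
  by rewrite addnC addnK.
rewrite -rC; exists (fun k => row k (row_base C)).
have sumE (c : 'I_(\rank C) -> rat) : \sum_k idfun (c k) *: row k (row_base C) =
   (\row_k c k) *m row_base C.
  by rewrite mulmx_sum_row; apply: eq_bigr => k _; rewrite mxE.
have CK : (C <= kermx B)%MS by rewrite diffmxSl.
split.
- move=> k; apply/sub_kermxP.
  by apply: submx_trans CK; rewrite (submx_trans (row_sub _ _)) // eq_row_base.
- move=> z /sub_kermxP zK.
  have : (z <= A + row_base C)%MS.
    apply: submx_trans zK _.
    rewrite -(addsmx_diff_cap_eq (kermx B) A) addsmx_sub.
    by rewrite (submx_trans _ (addsmxSr _ _)) ?eq_row_base //= (submx_trans _ (addsmxSl _ _)) ?capmxSr.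
  case/sub_addsmxP=> -[u1 u2] /= ->; exists (fun k => u2 0 k).
  rewrite sumE (_ : \row_k _ = u2); last by apply/rowP=> k; rewrite mxE.
  by exists u1; rewrite addrK.
- move=> c [u]; rewrite sumE => E k.
  have : ((\row_k c k) *m row_base C <= A :&: C)%MS.
    rewrite sub_capmx {1}E submxMl /= -(eq_row_base C) submxMl //.
  rewrite capmxC capmx_diff.
  rewrite submx0 => /eqP E0.
  have := row_free_inj (row_base_free C); move=> /(_ _ (\row_k c k) 0).
  by rewrite mul0mx => /(_ E0) /rowP/(_ k); rewrite !mxE.
Qed.

Lemma qdim_sum (A : pzRingType) (iota : {rmorphism rat -> A}) (V : lmodType A)
    (J : finType) (Z B : J -> V -> Prop) (d : J -> nat) :
  (forall j, subsp iota (Z j)) -> (forall j, subsp iota (B j)) ->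
  (forall j, qdim iota (Z j) (B j) (d j)) ->
  qdim iota (fun f : {ffun J -> V} => forall j, Z j (f j))
    (fun f => forall j, B j (f j)) (\sum_j d j).
Proof.
move=> sZ sB h.
pose I := {j : J & 'I_(d j)}.
have -> : (\sum_j d j = #|{: I}|)%N.
  by rewrite card_tagged sumnE big_map big_enum; apply: eq_bigr => j _; rewrite card_ord.
have [x hx] := dep_choice h.
pose X (i : I) := [ffun j => if tag i == j then x (tag i) (tagged i) else 0].
have sumX (c : I -> rat) j : (\sum_i iota (c i) *: X i) j =
    \sum_k iota (c (Tagged (fun j => 'I_(d j)) k)) *: x j k.
  rewrite sum_ffunE.
  transitivity (\sum_(i : I) iota (c i) *: X i j).
    by apply: eq_bigr => i _; rewrite ffunE.
  transitivity (\sum_l \sum_k iota (c (Tagged (fun j => 'I_(d j)) k)) *: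
       (if l == j then x l k else 0)).
    rewrite sig_big_dep; apply: eq_bigr => -[l k] _ /=.
    by rewrite ffunE.
  rewrite (bigD1 j) //= [X in _ + X]big1 ?addr0.
    by rewrite eqxx.
  by move=> l /negPf ->; apply: big1 => k _; rewrite scaler0.
apply: (qdim_fin (x := X)).
- move=> -[l k] j; rewrite ffunE /=; case: eqP => [<-|_]; last by case: (sZ j).
  by case: (hx l).
- move=> f Zf.
  have hc j : exists c : 'I_(d j) -> rat, B j (f j - \sum_k iota (c k) *: x j k).
    by case: (hx j) => _ gen _; exact: gen.
  have [c Bc] := dep_choice hc.
  by exists (fun i => c (tag i) (tagged i)) => j; rewrite !ffunE sumX.
- move=> c Bc [j k]; case: (hx j) => _ _ /(_ (fun k => c (Tagged (fun j => 'I_(d j)) k))).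
  by rewrite -sumX => h'; exact: h' (Bc j) k.
Qed.

(** * Cochains on families of finite sets *)

(** Exchanging the two sums gives S = -S, hence S = 0 over the rationals. Both the coboundary and
    the Taylor differential square to zero for this reason. *)
Lemma antisym_sum (V : lmodType rat) (I : finType) (H : I -> I -> V) :
  (forall u v, H u v = - H v u) -> \sum_u \sum_v H u v = 0.
Proof.
move=> A; set S := LHS; have : S = - S.
  rewrite {1}/S exchange_big -sumrN; apply: eq_bigr => v _; rewrite -sumrN.
  by apply: eq_bigr => u _.
by move/eqP; rewrite -addr_eq0 -mulr2n -scaler_nat scaler_eq0 => /orP[|/eqP].
Qed.

Section Cochains.
Variable T : finType.
Implicit Types (X Y : {set {set T}}) (s t : {set T}) (u v : T)
  (kappa : T -> {set T} -> rat) (c d e : {ffun {set T} -> rat^o}).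

(* kappa v t is the sign of the codimension one pair (t :\ v, t). *)
Definition signs kappa : Prop :=
  (forall v t, v \in t -> kappa v t * kappa v t = 1) /\
  (forall u v t, u \in t -> v \in t -> u != v ->
     kappa u t * kappa v (t :\ u) = - (kappa v t * kappa u (t :\ v))).

Definition ksign v t : rat :=
  (-1) ^+ #|[set u in t | (enum_rank u < enum_rank v)%N]|.

(** Sets of faces left after deleting a subcomplex are of this kind. Convexity is what makes [delta]
    square to zero: if t and t :\ v :\ u are in X, so are both sets in between, and the two terms
    cancel. *)
Definition convex X : Prop := forall r s t, r \in X -> t \in X ->
  r \subset s -> s \subset t -> s \in X.

Definition delta kappa X c t : rat :=
  \sum_(v in t | t :\ v \in X) kappa v t * c (t :\ v).

(* Cochains on an arbitrary family X of sets, graded by cardinality; the values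
   outside X are irrelevant and are not required to vanish. *)
Definition cocyc kappa X (k : nat) c : Prop :=
  forall t, t \in X -> #|t| = k.+1 -> delta kappa X c t = 0.

Definition cobd kappa X (k : nat) c : Prop :=
  exists e, forall t, t \in X -> #|t| = k -> c t = delta kappa X e t.

Definition hcoh kappa X (k n : nat) : Prop :=
  qdim idfun (cocyc kappa X k) (cobd kappa X k) n.

Definition acyc kappa X : Prop :=
  forall k c, cocyc kappa X k c -> cobd kappa X k c.

Lemma ksignP : signs ksign.
Proof.
split=> [v t _|]; first by rewrite -expr2 sqrr_sign.
have key u v t : u \in t -> v \in t -> (enum_rank u < enum_rank v)%N ->
    ksign u t * ksign v (t :\ u) = - (ksign v t * ksign u (t :\ v)).
  move=> ut vt uv; rewrite /ksign.
  have -> : [set w in t :\ v | (enum_rank w < enum_rank u)%N] =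
            [set w in t | (enum_rank w < enum_rank u)%N].
    apply/setP => w; rewrite !inE; case: eqP => // -> /=.
    by rewrite ltnNge (ltnW uv) andbF.
  have -> : [set w in t :\ u | (enum_rank w < enum_rank v)%N] =
            [set w in t | (enum_rank w < enum_rank v)%N] :\ u.
    by apply/setP => w; rewrite !inE andbA.
  rewrite [in RHS](cardsD1 u [set w in t | (enum_rank w < enum_rank v)%N]) inE ut uv.
  by rewrite exprS !mulN1r mulNr opprK mulrC.
move=> u v t ut vt; rewrite -(inj_eq enum_rank_inj) neq_ltn => /orP[|] uv.
  exact: key.
by rewrite (key v u) // opprK.
Qed.

Lemma delta_lin kappa X a c d t :
  delta kappa X (a *: c + d) t = a * delta kappa X c t + delta kappa X d t.
Proof.
rewrite /delta mulr_sumr -big_split; apply: eq_bigr => v _ /=.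
by rewrite !ffunE mulrDr mulrCA.
Qed.

Lemma deltaD kappa X c d t : delta kappa X (c + d) t = delta kappa X c t + delta kappa X d t.
Proof. by rewrite -[c]scale1r delta_lin mul1r scale1r. Qed.

Lemma deltaZ kappa X a c t : delta kappa X (a *: c) t = a * delta kappa X c t.
Proof.
by rewrite /delta mulr_sumr; apply: eq_bigr => v _; rewrite !ffunE mulrCA.
Qed.

Lemma delta0 kappa X t : delta kappa X 0 t = 0.
Proof. by rewrite -[0](scale0r 0) deltaZ mul0r. Qed.

Lemma deltaB kappa X c d t : delta kappa X (c - d) t = delta kappa X c t - delta kappa X d t.
Proof. by rewrite deltaD -scaleN1r deltaZ mulN1r. Qed.

Lemma delta_card0 kappa X c t : #|t| = 0%N -> delta kappa X c t = 0.
Proof. by move/cards0_eq ->; rewrite /delta big1 // => v; rewrite inE. Qed.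

Lemma eq_delta kappa X Y c d t :
  (forall v, v \in t -> (t :\ v \in X) = (t :\ v \in Y)) ->
  (forall v, v \in t -> t :\ v \in X -> c (t :\ v) = d (t :\ v)) ->
  delta kappa X c t = delta kappa Y d t.
Proof.
move=> h1 h2; apply: eq_big => [v|v /andP[vt tX]]; last by rewrite h2.
by case vt: (v \in t) => //=; rewrite h1.
Qed.

Lemma card_setD1 t v k : v \in t -> #|t| = k.+1 -> #|t :\ v| = k.
Proof. by move=> vt; rewrite (cardsD1 v) vt => -[]. Qed.

Lemma delta_delta kappa X c t : signs kappa -> convex X -> t \in X ->
  delta kappa X [ffun s => delta kappa X c s] t = 0.
Proof.
move=> [_ anti] cX tX.
pose G (v u : T) : rat :=
  if [&& u != v, u \in t, v \in t & t :\ v :\ u \in X] then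
    kappa v t * (kappa u (t :\ v) * c (t :\ v :\ u)) else 0.
have E : delta kappa X [ffun s => delta kappa X c s] t = \sum_v \sum_u G v u.
  rewrite /delta big_mkcond; apply: eq_bigr => v _.
  case: ifP => [/andP[vt tvX]|nv].
    rewrite ffunE mulr_sumr big_mkcond; apply: eq_bigr => u _.
    by rewrite /G !inE vt /= andbA.
  rewrite big1 // => u _; rewrite /G; case: ifP => // /and4P[uv ut vt X2].
  move: nv; rewrite vt /= => /negP[].
  by apply: (cX _ _ _ X2 tX); rewrite subD1set.
have A v u : G v u = - G u v.
  have tE : t :\ v :\ u = t :\ u :\ v by apply/setP => w; rewrite !inE andbCA.
  rewrite /G -tE [v == u]eq_sym (andbCA (v \in t)).
  case: and4P => [[uv ut vt _]|_]; last by rewrite oppr0.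
  by rewrite !mulrA anti // 1?eq_sym // mulNr.
by rewrite E; apply: (@antisym_sum rat^o).
Qed.

Lemma subsp_cocyc kappa X k : subsp idfun (cocyc kappa X k).
Proof.
split=> [t|c d hc hd t tX tk|a c hc t tX tk]; first by rewrite delta0.
  by rewrite deltaD hc // hd // addr0.
by rewrite deltaZ hc // mulr0.
Qed.

Lemma subsp_cobd kappa X k : subsp idfun (cobd kappa X k).
Proof.
split.
- by exists 0 => t; rewrite delta0 ffunE.
- move=> c d [e he] [f hf]; exists (e + f) => t tX tk.
  by rewrite ffunE deltaD he // hf.
- by move=> a c [e he]; exists (a *: e) => t tX tk; rewrite ffunE deltaZ he.
Qed.

Lemma acyc_hcoh kappa X k : acyc kappa X -> hcoh kappa X k 0.
Proof. by move=> h; apply: qdim0 => z /h. Qed.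

Lemma hcoh_uniq kappa X (k n m : nat) : hcoh kappa X k n -> hcoh kappa X k m -> n = m.
Proof. exact/qdim_uniq/subsp_cobd. Qed.

End Cochains.

Section CochainLemmas.
Variable T : finType.
Implicit Types (X Y Z : {set {set T}}) (s t : {set T}) (u v : T)
  (kappa : T -> {set T} -> rat) (c d e : {ffun {set T} -> rat^o}).

(** X is a cone with apex b, and [e] is the contracting homotopy applied to c. For t containing b
    only the term of b survives in the coboundary of [e]; for t avoiding b the claim is the cocycle
    condition at [b |: t], rearranged by the sign rule. *)
Lemma toggle_acyc kappa X b : signs kappa ->
  (forall t, b \notin t -> (t \in X) = (b |: t \in X)) -> acyc kappa X.
Proof.
move=> [sq anti] tog k c hc.
pose e : {ffun {set T} -> rat^o} :=
  [ffun s : {set T} => if b \in s then 0 else kappa b (b |: s) * c (b |: s)].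
exists e => t tX tk; case bt: (b \in t).
  have tbX : t :\ b \in X by rewrite tog ?setD11 // setD1K.
  rewrite /delta (bigD1 b) ?bt //= ffunE setD11 setD1K // mulrA sq // mul1r.
  rewrite big1 ?addr0 // => v /andP[_ vb].
  by rewrite ffunE !inE eq_sym vb bt mulr0.
have nbt : b \notin t by rewrite bt.
have bbt : b \in b |: t by rewrite setU11.
have tbX : b |: t \in X by rewrite -tog.
have := hc _ tbX; rewrite cardsU1 nbt tk => /(_ erefl).
rewrite /delta (bigD1 b) /=; last by rewrite setU11 setU1K.
rewrite setU1K // => /eqP; rewrite addr_eq0 => /eqP E.
have {}E : c t = - (kappa b (b |: t) * \sum_(i in b |: t | ((b |: t) :\ i \in X) && (i != b))
      kappa i (b |: t) * c ((b |: t) :\ i)).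
  rewrite -[LHS]mul1r -(sq _ _ bbt) -mulrA E mulrN.
  by congr (- (_ * _)); apply: eq_bigl => i; rewrite andbA.
have Et v : v != b -> (b |: t) :\ v = b |: (t :\ v).
  move=> vb; apply/setP => w; rewrite !inE.
  by case: (eqVneq w b) => // ->; rewrite eq_sym vb.
rewrite E mulr_sumr -sumrN; apply: eq_big => [v|v /and3P[vbt vX vb]].
  rewrite !inE; have [->|vb] := eqVneq v b; first by rewrite bt andbF.
  rewrite /= andbT; case vt: (v \in t) => //=.
  by rewrite Et // [in RHS]tog // inE (negPf nbt) andbF.
have vt : v \in t by move: vbt; rewrite !inE (negPf vb).
rewrite ffunE !inE (negPf nbt) andbF Et // !mulrA -mulNr; congr (_ * _).
have := anti v b (b |: t) vbt bbt vb; rewrite setU1K // Et // => A.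
rewrite -[kappa v t]mul1r -(sq _ _ bbt) -[kappa b (b |: t) * kappa b _ * kappa v t]mulrA.
rewrite -[kappa b (b |: t) * kappa v t]opprK -A mulrN mulNr -!mulrA.
by rewrite sq ?setU11 // mulr1.
Qed.

Lemma hcoh_nocell kappa X k : (forall t, t \in X -> #|t| != k) -> hcoh kappa X k 0.
Proof. by move=> h; apply: qdim0 => z _; exists 0 => t /h /eqP. Qed.

Lemma hcoh_cell kappa s k : hcoh kappa [set s] k (#|s| == k).
Proof.
case: eqP => [<-|ne]; last by apply: hcoh_nocell => t /set1P ->; apply/eqP.
have d0 c : delta kappa [set s] c s = 0.
  rewrite /delta big1 // => v /andP[vs /set1P /setP /(_ v)].
  by rewrite setD11 vs.
exists (fun=> [ffun=> 1]); split=> [_ t /set1P ->|z _|c [e he] k0].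
- by rewrite d0.
- exists (fun=> z s) => /=; exists 0 => t /set1P -> _.
  by rewrite big_ord1 !ffunE d0 /= [_ *: _]mulr1 subrr.
- have := he s (set11 s) erefl; rewrite d0 big_ord1 !ffunE /= [_ *: _]mulr1.
  by rewrite (ord1 k0).
Qed.

(** Extension by zero. A cochain may take any values outside its family, so these have to be erased
    before it is read on a larger family. *)
Definition extz Z d : {ffun {set T} -> rat^o} :=
  [ffun s => if s \in Z then d s else 0].

Lemma subfE c d s : (c - d) s = c s - d s.
Proof. by rewrite !ffunE. Qed.

Lemma extzE Z d s : extz Z d s = if s \in Z then d s else 0.
Proof. by rewrite ffunE. Qed.

Lemma extzD Z c d : extz Z (c + d) = extz Z c + extz Z d.
Proof. by apply/ffunP => s; rewrite !ffunE; case: ifP; rewrite ?addr0. Qed.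

Lemma extz0 Z : extz Z 0 = 0.
Proof. by apply/ffunP => s; rewrite !ffunE; case: ifP. Qed.

Lemma extzZ Z a c : extz Z (a *: c) = a *: extz Z c.
Proof. by apply/ffunP => s; rewrite !ffunE; case: ifP; rewrite ?scaler0. Qed.

(** * The long exact sequence of a convex family Y and a part X closed under subsets in Y *)

Section LongExact.
Variables (kappa : T -> {set T} -> rat) (Y X : {set {set T}}).
Hypotheses (hk : signs kappa) (cY : convex Y) (sXY : X \subset Y).
Hypothesis dX : forall s t, t \in X -> s \in Y -> s \subset t -> s \in X.
Notation Z := (Y :\: X).

Let XY t : t \in X -> t \in Y. Proof. exact: (subsetP sXY). Qed.
Let dX1 t v : t \in X -> (t :\ v \in Y) = (t :\ v \in X).
Proof.
move=> tX; apply/idP/idP => [h|/XY //]; exact: (dX tX h (subD1set _ _)).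
Qed.

Lemma delta_sub c t : t \in X -> delta kappa X c t = delta kappa Y c t.
Proof. by move=> tX; apply: eq_delta => // v vt; rewrite dX1. Qed.

Lemma delta_extz_sub d t : t \in X -> delta kappa Y (extz Z d) t = 0.
Proof.
move=> tX; rewrite /delta big1 // => v /andP[_]; rewrite dX1 // ffunE inE => ->.
by rewrite /= mulr0.
Qed.

Lemma delta_extz d t : delta kappa Y (extz Z d) t = delta kappa Z d t.
Proof.
rewrite /delta (bigID (fun v => t :\ v \in X)) /= big1 ?add0r.
  apply: eq_big => [v|v /andP[/andP[vt vY] vX]].
    by rewrite !inE -andbA (andbC (_ \in Y)).
  by rewrite ffunE !inE vY vX.
by move=> v /andP[_ vX]; rewrite ffunE inE vX mulr0.
Qed.

Lemma delta_extzX c t : t \in X -> delta kappa Y (extz X c) t = delta kappa X c t.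
Proof.
move=> tX; apply: eq_delta => v vt; first by rewrite dX1.
by rewrite dX1 // ffunE => ->.
Qed.

Lemma delta_eqon c d t : (forall s, s \in Y -> #|s|.+1 = #|t| -> c s = d s) ->
  delta kappa Y c t = delta kappa Y d t.
Proof.
move=> h; apply: eq_delta => // v vt vY; apply: h => //.
by rewrite [RHS](cardsD1 v) vt.
Qed.

Let inZ t : t \in Y -> (t \in Z) = (t \notin X). Proof. by move=> tY; rewrite inE tY andbT. Qed.

Let delta2 e t : t \in Y -> delta kappa Y [ffun s => delta kappa Y e s] t = 0.
Proof. exact: delta_delta. Qed.

(** Cochains on Y :\: X are relative cochains, and the relation says that c is cohomologous in Y to
    the extension of d by zero. Since X is acyclic, a cocycle c has a primitive on X; subtracting
    the coboundary in Y of that primitive, extended by zero, makes c vanish on X. *)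
Lemma hcoh_quot_iso k : acyc kappa X ->
  subq_iso idfun idfun
    (fun c d => exists e, forall s, s \in Y -> #|s| = k ->
       c s = delta kappa Y e s + extz Z d s)
    (cocyc kappa Y k) (cobd kappa Y k) (cocyc kappa Z k) (cobd kappa Z k).
Proof.
move=> aX; split.
- split.
  + by exists 0 => s _ _; rewrite delta0 extz0 !ffunE addr0.
  + move=> c d c' d' [e he] [f hf]; exists (e + f) => s sY sk.
    by rewrite deltaD extzD [LHS]ffunE he // hf // addrACA; congr (_ + _); rewrite [RHS]ffunE.
  + move=> a c c' [e he]; exists (a *: e) => s sY sk.
    by rewrite deltaZ extzZ [LHS]ffunE he // [_ *: _]mulrDr; congr (_ + _); rewrite [RHS]ffunE.
- move=> c hc.
  have [t tX tk|e he] := aX k c; first by rewrite delta_sub // hc // XY.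
  pose d : {ffun {set T} -> rat^o} := c - [ffun s => delta kappa Y (extz X e) s].
  exists d; split; last first.
    exists (extz X e) => s sY sk; rewrite extzE inZ //.
    case: ifPn => [sX|]; first by rewrite !ffunE addrC subrK.
    by rewrite negbK => sX; rewrite addr0 he // delta_extzX.
  move=> t tZ tk; have tY : t \in Y by move: tZ; rewrite inE => /andP[].
  rewrite -delta_extz -(@delta_eqon d).
    by rewrite deltaB hc // delta2 // subr0.
  move=> s sY sk; rewrite extzE inZ //; case: ifPn => //; rewrite negbK => sX.
  rewrite !ffunE delta_extzX // he ?subrr //.
  by apply/eqP; rewrite -eqSS sk tk.
- move=> d hd; exists (extz Z d); split; last first.
    by exists 0 => s _ _; rewrite delta0 add0r.
  move=> t tY tk; case: (boolP (t \in X)) => tX; first exact: delta_extz_sub.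
  by rewrite delta_extz hd // inZ.
- move=> c d hc hd [e he]; split.
  + move=> [f hf].
    have hd' s : s \in Y -> #|s| = k -> extz Z d s = delta kappa Y (f - e) s.
      by move=> sY sk; rewrite deltaB -hf // he // addrC addKr.
    (* The difference f - e lives in degree k - 1, where acyclicity of X is to be applied. For k = 0
       that degree does not exist, and coboundaries vanish on the empty set anyway. *)
    case: k hc hd he hf hd' => [|k] hc hd he hf hd'.
      exists 0 => t tZ tk; have tY : t \in Y by move: tZ; rewrite inE => /andP[].
      by have := hd' t tY tk; rewrite extzE tZ => ->; rewrite !delta_card0.
    have [t tX tk|g hg] := aX k (f - e).
      by rewrite delta_sub // -hd' ?XY // extzE inZ ?XY // tX.
    exists (f - e - [ffun s => delta kappa Y (extz X g) s]) => t tZ tk.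
    have tY : t \in Y by move: tZ; rewrite inE => /andP[].
    rewrite -delta_extz -(@delta_eqon (f - e - [ffun s => delta kappa Y (extz X g) s])).
      by rewrite deltaB delta2 // subr0 -hd' // extzE tZ.
    move=> s sY sk; rewrite extzE inZ //; case: ifPn => //; rewrite negbK => sX.
    rewrite subfE [X in _ - X]ffunE delta_extzX // hg ?subrr //.
    by apply/eqP; rewrite -eqSS sk tk.
  + move=> [f hf]; exists (e + extz Z f) => s sY sk.
    rewrite he // deltaD; congr (_ + _); rewrite extzE inZ //.
    case: ifPn => sX; first by rewrite hf // ?inZ // delta_extz.
    by rewrite delta_extz_sub //; rewrite negbK in sX.
Qed.

Lemma hcoh_quot k n : acyc kappa X -> hcoh kappa Y k n <-> hcoh kappa Z k n.
Proof.
move=> aX; split; [apply: qdim_transport (hcoh_quot_iso k aX)|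
                   apply: qdim_transport_sym (hcoh_quot_iso k aX)];
  exact: subsp_cocyc.
Qed.

(** The connecting map as a relation: some cochain [e] on Y agrees with c on X and has as coboundary
    the extension of d by zero. Acyclicity of Y makes it bijective in cohomology and raises the
    degree by one. *)
Lemma hcoh_conn_iso k : acyc kappa Y ->
  subq_iso idfun idfun
    (fun c d => exists e,
       (forall s, s \in X -> #|s| = k -> e s = c s) /\
       (forall s, s \in Y -> #|s| = k.+1 -> delta kappa Y e s = extz Z d s))
    (cocyc kappa X k) (cobd kappa X k) (cocyc kappa Z k.+1) (cobd kappa Z k.+1).
Proof.
move=> aY; split.
- split.
  + by exists 0; split=> [s _ _|s _ _]; rewrite ?delta0 ?extz0 ffunE.
  + move=> c d c' d' [e [he he']] [f [hf hf']]; exists (e + f).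
    split=> s sY sk; first by rewrite !ffunE he // hf.
    by rewrite deltaD extzD [RHS]ffunE he' // hf'.
  + move=> a c c' [e [he he']]; exists (a *: e); split=> s sY sk.
      by rewrite !ffunE he.
    by rewrite deltaZ extzZ [RHS]ffunE he'.
- move=> c hc; pose d : {ffun {set T} -> rat^o} := [ffun s => delta kappa Y (extz X c) s].
  have dE s : s \in Y -> #|s| = k.+1 -> d s = extz Z d s.
    move=> sY sk; rewrite extzE inZ //; case: ifPn => //; rewrite negbK => sX.
    by rewrite ffunE delta_extzX // hc.
  exists d; split; last first.
    exists (extz X c); split=> [s sX _|s sY sk]; first by rewrite extzE sX.
    by rewrite -dE // ffunE.
  move=> t tZ tk; have tY : t \in Y by move: tZ; rewrite inE => /andP[].
  rewrite -delta_extz -(@delta_eqon d) ?delta2 // => s sY sk; apply: dE => //.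
  by apply/eqP; rewrite -eqSS sk tk.
- move=> d hd; have [t tY tk|e he] := aY k.+1 (extz Z d).
    case: (boolP (t \in X)) => tX; first exact: delta_extz_sub.
    by rewrite delta_extz hd // inZ.
  exists (extz X e); split; last first.
    exists e; split=> s sX sk; first by rewrite extzE sX.
    by rewrite -he.
  move=> t tX tk; rewrite -delta_extzX //.
  have -> : delta kappa Y (extz X (extz X e)) t = delta kappa Y e t.
    by apply: eq_delta => // v vt; rewrite dX1 // => h; rewrite !extzE h.
  by rewrite -he ?XY // extzE inZ ?XY // tX.
- move=> c d hc hd [e [he he']]; split.
  + move=> [g hg]; exists (e - [ffun s => delta kappa Y (extz X g) s]) => t tZ tk.
    have tY : t \in Y by move: tZ; rewrite inE => /andP[].
    rewrite -delta_extz.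
    rewrite -(@delta_eqon (e - [ffun s => delta kappa Y (extz X g) s])).
      by rewrite deltaB delta2 // subr0 he' // extzE tZ.
    move=> s sY; rewrite tk => -[sk]; rewrite extzE inZ //; case: ifPn => //.
    rewrite negbK => sX; rewrite subfE [X in _ - X]ffunE delta_extzX //.
    by rewrite he // hg // subrr.
  + move=> [g hg]; have [t tY tk|h hh] := aY k (e - extz Z g).
      rewrite deltaB he' // delta_extz extzE inZ //.
      case: ifPn => tX; first by rewrite hg ?inZ // subrr.
      rewrite -delta_extz delta_extz_sub ?subr0 //.
      by rewrite negbK in tX.
    exists h => t tX tk; have tY := XY tX.
    by rewrite delta_sub // -hh // subfE extzE inZ // tX subr0 he.
Qed.

Lemma hcoh_conn k n : acyc kappa Y -> hcoh kappa X k n <-> hcoh kappa Z k.+1 n.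
Proof.
move=> aX; split; [apply: qdim_transport (hcoh_conn_iso k aX)|
                   apply: qdim_transport_sym (hcoh_conn_iso k aX)];
  exact: subsp_cocyc.
Qed.

End LongExact.

Lemma convex_sub X (P : pred {set T}) : convex X ->
  (forall r s t : {set T}, r \subset s -> s \subset t -> P r -> P t -> P s) ->
  convex [set s in X | P s].
Proof.
move=> cX hP r s t; rewrite !inE => /andP[rX Pr] /andP[tX Pt] rs st.
by rewrite (cX r s t) //= (hP r s t).
Qed.

(* Faces not containing v are matched by toggling its partner p v; only the
   faces containing all the ds survive. *)
Lemma hcoh_peel kappa Y (p : T -> T) (ds : seq T) k n : signs kappa -> convex Y ->
  (forall v, v \in ds -> p v \notin ds) ->
  (forall v s, v \in ds -> v \notin s -> p v \notin s ->
     (s \in Y) = (p v |: s \in Y)) ->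
  hcoh kappa Y k n <-> hcoh kappa [set s in Y | all (mem s) ds] k n.
Proof.
move=> hk; elim: ds Y => [|d ds IH] Y cY pds tog.
  by rewrite (_ : [set s in Y | _] = Y) //; apply/setP => s; rewrite inE andbT.
pose X := [set s in Y | d \notin s].
have pd : p d != d by have := pds d (mem_head _ _); rewrite inE negb_or => /andP[].
apply: iff_trans (_ : hcoh kappa (Y :\: X) k n <-> _).
  apply: hcoh_quot => //.
  - by apply/subsetP => s; rewrite inE => /andP[].
  - move=> s t; rewrite !inE => /andP[_ dt] -> st /=.
    by apply: contra dt; apply: (subsetP st).
  - apply: (@toggle_acyc _ _ (p d)) => // t nt; rewrite !inE eq_sym (negPf pd) /=.
    case: (boolP (d \in t)) => dt; first by rewrite !andbF.
    by rewrite (tog d) ?mem_head.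
have -> : Y :\: X = [set s in Y | d \in s].
  by apply/setP => s; rewrite !inE; case: (s \in Y); rewrite ?andbF //= andbT negbK.
rewrite (_ : [set s in Y | all _ _] = [set s in [set s in Y | d \in s] | all (mem s) ds]);
  last by apply/setP => s; rewrite !inE /= andbA.
apply: IH.
- by apply: convex_sub => // r s t rs _ dr _; apply: (subsetP rs).
- by move=> e eds; have := pds e; rewrite !inE eds orbT => /(_ isT) /norP[].
- move=> e s eds es pes; rewrite !inE (tog e) ?inE ?eds ?orbT //.
  have := pds e; rewrite !inE eds orbT => /(_ isT) /norP[+ _].
  by rewrite eq_sym => /negPf ->.
Qed.

Section ChangeSigns.
Variables (X : {set {set T}}) (kappa kappa' : T -> {set T} -> rat).
Hypotheses (hk : signs kappa) (hk' : signs kappa').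

(** The quotient [rho] of two sign systems is a multiplicative cocycle on the cube of all subsets,
    which is what [rC] says, and is therefore a coboundary. Its primitive is built by induction on
    cardinality, passing from each set to the set without one picked element; [rC] shows that the
    formula then holds for every other element too. *)
Lemma signs_cobd : exists eps : {set T} -> rat,
  forall s, eps s * eps s = 1 /\
   forall v, v \in s -> kappa v s * kappa' v s = eps s * eps (s :\ v).
Proof.
pose rho v s := kappa v s * kappa' v s.
have rr v s : v \in s -> rho v s * rho v s = 1.
  by move=> vs; rewrite /rho mulrACA (proj1 hk) // (proj1 hk') // mulr1.
have rC u v s : u \in s -> v \in s -> u != v ->
    rho u s * rho v (s :\ u) = rho v s * rho u (s :\ v).
  move=> us vs uv; rewrite /rho mulrACA (proj2 hk) // (proj2 hk') //.
  by rewrite mulrNN mulrACA.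
suff H k : exists eps : {set T} -> rat, forall s, (#|s| <= k)%N ->
    eps s * eps s = 1 /\ forall v, v \in s -> rho v s = eps s * eps (s :\ v).
  by have [eps h] := H #|T|; exists eps => s; apply/h/max_card.
elim: k => [|k [eps h]].
  exists (fun=> 1) => s; rewrite leqn0 => /eqP/cards0_eq ->; rewrite mulr1.
  by split=> // v; rewrite inE.
exists (fun s => if (#|s| <= k)%N then eps s else
  if [pick v in s] is Some v then eps (s :\ v) * rho v s else 1) => s sk.
case: (leqP #|s| k) => sk'.
  have [h1 h2] := h _ sk'; split=> // v vs; rewrite h2 //.
  rewrite ifT //; apply: leq_trans sk'; exact/subset_leq_card/subD1set.
have Es : #|s| = k.+1 by apply/eqP; rewrite eqn_leq sk.
have cD v : v \in s -> #|s :\ v| = k by move=> vs; apply: card_setD1.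
case: pickP => [u us|s0]; last first.
  by rewrite (_ : s = set0) ?cards0 // in Es; apply/setP => v; rewrite s0 inE.
have [q1 q2] := h (s :\ u) (eq_leq (cD _ us)).
split; first by rewrite mulrACA q1 rr // mulr1.
move=> v vs; rewrite cD // leqnn.
have [->|vu] := eqVneq v u; first by rewrite mulrAC q1 mul1r.
have vsu : v \in s :\ u by rewrite !inE vu.
have usv : u \in s :\ v by rewrite !inE eq_sym vu.
have [r1 r2] := h (s :\ v) (eq_leq (cD _ vs)).
have WW : eps (s :\ u :\ v) * eps (s :\ u :\ v) = 1.
  have le : (#|s :\ u :\ v| <= k)%N.
    by rewrite -(cD _ us); apply/subset_leq_card/subD1set.
  by case: (h _ le).
have := rC u v s us vs; rewrite eq_sym vu => /(_ isT).
rewrite q2 // r2 // (_ : s :\ v :\ u = s :\ u :\ v); last first.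
  by apply/setP => w; rewrite !inE andbCA.
set a := rho u s; set b := rho v s; set x := eps (s :\ u); set y := eps (s :\ v).
set w := eps _ => E.
rewrite -[LHS]mulr1 -[1]r1 -[LHS]mulr1 -[1]WW.
have -> : b * (y * y) * (w * w) = b * (y * w) * (y * w) by ring.
rewrite -E; transitivity (x * a * y * (w * w)); first by ring.
by rewrite WW mulr1.
Qed.

Lemma hcoh_signs k n : hcoh kappa X k n -> hcoh kappa' X k n.
Proof.
have [eps he] := signs_cobd.
have e1 s : eps s * eps s = 1 by case: (he s).
have kE v s : v \in s -> kappa' v s = eps s * eps (s :\ v) * kappa v s.
  by case: (he s) => _ h vs; rewrite -h // mulrAC (proj1 hk) // mul1r.
pose m (x : {set T} -> rat) c : {ffun {set T} -> rat^o} := [ffun s => x s * c s].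
have dE c c' t : (forall s, s \in X -> #|s|.+1 = #|t| -> c' s = eps s * c s) ->
    delta kappa' X c' t = eps t * delta kappa X c t.
  move=> h; rewrite /delta mulr_sumr; apply: eq_bigr => v /andP[vt vX].
  rewrite kE // h //; last by rewrite [RHS](cardsD1 v) vt.
  by rewrite -!mulrA; congr (_ * _); rewrite mulrCA [eps _ * (eps _ * _)]mulrA e1 mul1r.
apply: (@qdim_transport _ _ _ _ _ _ (fun c c' => forall s, s \in X -> #|s| = k -> c' s = eps s * c s));
  try exact: subsp_cocyc.
split.
- split=> [s|c d c' d' h h' s sX sk|a c c' h s sX sk]; rewrite !ffunE ?mulr0 //.
    by rewrite h // h' // mulrDr.
  by rewrite h // [LHS]mulrCA.
- move=> c hc; exists (m eps c); split=> [t tX tk|s _ _]; last by rewrite ffunE.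
  by rewrite (dE c) ?hc ?mulr0 // => s sX sk; rewrite ffunE.
- move=> c' hc; exists (m eps c'); split=> [t tX tk|s _ _]; last first.
    by rewrite ffunE mulrA e1 mul1r.
  have := hc t tX tk; rewrite (dE (m eps c')) ?hc; last first.
    by move=> s sX sk; rewrite ffunE mulrA e1 mul1r.
  by move/(congr1 ( *%R (eps t))); rewrite mulrA e1 mul1r mulr0.
- move=> c c' hc hc' h; split=> -[e hee].
  + exists (m eps e) => t tX tk; rewrite (dE e) ?h // ?hee // => s sX sk.
    by rewrite ffunE.
  + exists (m eps e) => t tX tk; have := hee t tX tk; rewrite h //.
    rewrite (dE (m eps e)); last by move=> s sX sk; rewrite ffunE mulrA e1 mul1r.
    by move/(congr1 ( *%R (eps t))); rewrite !mulrA e1 !mul1r.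
Qed.

End ChangeSigns.

End CochainLemmas.

(** * Transport along an injection followed by the union with a fixed set *)

Section Shift.
Variables (T T' : finType) (f : T -> T') (B : {set T'}).
Hypotheses (f_inj : injective f) (fB : forall v, f v \notin B).
Variables (kappa : T -> {set T} -> rat) (kappa' : T' -> {set T'} -> rat).
Hypotheses (hk : signs kappa) (hk' : signs kappa').
Variable X : {set {set T}}.

Let phi (s : {set T}) := B :|: f @: s.

Let fphi v s : (f v \in phi s) = (v \in s).
Proof. by rewrite !inE (negPf (fB v)) mem_imset. Qed.

Let phi_inj : injective phi.
Proof. by move=> s t E; apply/setP => v; rewrite -!fphi E. Qed.

Let phiD1 s v : phi (s :\ v) = phi s :\ f v.
Proof.
apply/setP => w; rewrite !inE; case: (eqVneq w (f v)) => [->|wv] /=.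
  by rewrite (negPf (fB v)) mem_imset // setD11.
congr (_ || _); apply/imsetP/imsetP => -[u us Eu]; exists u => //.
  by move: us; rewrite inE => /andP[].
by rewrite !inE us andbT; apply: contraNneq wv => <-; rewrite Eu.
Qed.

Let card_phi s : #|phi s| = (#|B| + #|s|)%N.
Proof.
rewrite cardsU (_ : B :&: f @: s = set0) ?cards0 ?subn0 ?card_imset //.
apply/setP => w; rewrite !inE; apply/negP => /andP[wB /imsetP[v _ E]].
by move: wB; rewrite E (negPf (fB v)).
Qed.

(** All members of the image contain B, so removing an element of B leaves the family and only the
    elements of [f @: t] contribute to the coboundary. The signs pulled back along [phi] form
    another sign system [kappa''], which [hcoh_signs] exchanges for [kappa]. *)
Lemma hcoh_shift k n : hcoh kappa X k n <-> hcoh kappa' (phi @: X) (#|B| + k) n.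
Proof.
pose kappa'' v s := kappa' (f v) (phi s).
have hk'' : signs kappa''.
  split=> [v s vs|u v s us vs uv]; first by rewrite /kappa'' (proj1 hk') ?fphi.
  by rewrite /kappa'' !phiD1 (proj2 hk') ?fphi // (inj_eq f_inj).
have dE (c : {ffun {set T} -> rat^o}) (c' : {ffun {set T'} -> rat^o})
    (t : {set T}) :
    (forall s, s \in X -> #|s|.+1 = #|t| -> c s = c' (phi s)) ->
    delta kappa' (phi @: X) c' (phi t) = delta kappa'' X c t.
  move=> h; rewrite /delta.
  rewrite (eq_bigl (fun v => (v \in f @: t) && (phi t :\ v \in phi @: X))).
    rewrite big_imset_cond /=; last by move=> u v _ _; apply: f_inj.
    apply: eq_big => [v|v /andP[vt vX]]; rewrite -phiD1; first by rewrite mem_imset.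
    rewrite h //; last by rewrite [RHS](cardsD1 v) vt.
    by move: vX; rewrite -phiD1 mem_imset.
  move=> w; rewrite inE; case: (boolP (w \in B)) => //= wB.
  have -> : (w \in f @: t) = false.
    by apply/imsetP => -[v _ E]; move: wB; rewrite E (negPf (fB v)).
  apply/imsetP => -[s _ /setP/(_ w)]; by rewrite !inE eqxx wB.
apply: iff_trans (_ : hcoh kappa'' X k n <-> _).
  by split; apply: hcoh_signs.
pose L (c : {ffun {set T} -> rat^o}) (c' : {ffun {set T'} -> rat^o}) :=
  forall s, s \in X -> #|s| = k -> c s = c' (phi s).
pose inv (c : {ffun {set T} -> rat^o}) : {ffun {set T'} -> rat^o} :=
  [ffun s' => \sum_(s | phi s == s') c s].
have invE c s : inv c (phi s) = c s.
  rewrite ffunE (bigD1 s) //= big1 ?addr0 // => t /andP[/eqP/phi_inj ->].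
  by rewrite eqxx.
have iso : subq_iso idfun idfun L (cocyc kappa'' X k) (cobd kappa'' X k)
   (cocyc kappa' (phi @: X) (#|B| + k)) (cobd kappa' (phi @: X) (#|B| + k)).
  split.
  - split=> [s|c d c' d' h h' s sX sk|a c c' h s sX sk]; rewrite !ffunE //.
      by rewrite h // h'.
    by rewrite h.
  - move=> c hc; exists (inv c); split=> [_ /imsetP[t tX ->]|s sX sk]; last by rewrite invE.
    rewrite card_phi -addnS => /addnI tk.
    by rewrite (dE c) ?hc // => s; rewrite invE.
  - move=> c' hc; exists [ffun s => c' (phi s)].
    split=> [t tX tk|s sX sk]; last by rewrite ffunE.
    rewrite -(dE _ c') ?hc ?imset_f ?card_phi ?tk ?addnS // => s _ _.
    by rewrite ffunE.
  - move=> c c' hc hc' h; split=> -[e he].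
    + exists (inv e) => _ /imsetP[t tX ->]; rewrite card_phi => /addnI tk.
      by rewrite -h // (dE e) ?he // => s; rewrite invE.
    + exists [ffun s => e (phi s)] => t tX tk.
      rewrite h // he ?imset_f ?card_phi ?tk //.
      by rewrite (dE [ffun s => e (phi s)]) // => s; rewrite ffunE.
by split; [apply: qdim_transport iso|apply: qdim_transport_sym iso];
  exact: subsp_cocyc.
Qed.

End Shift.

(** * Cohomology by matrices agrees with cohomology of families *)

Section CohomDim.
Variables (T : finType) (G : {set {set T}}).
Hypothesis cG : convex G.

Definition face_row (k : nat) (c : {ffun {set T} -> rat^o}) : 'rV[rat]_#|faces G k| :=
  \row_a c (enum_val a).

Lemma in_faces k s : (s \in faces G k) = (s \in G) && (#|s| == k).
Proof. by rewrite inE. Qed.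

Lemma face_row_onto k (r : 'rV_#|faces G k|) : exists c, face_row k c = r.
Proof.
exists [ffun s => \sum_(a | enum_val a == s) r 0 a].
apply/rowP => a; rewrite mxE ffunE (bigD1 a) //= big1 ?addr0 // => b /andP[/eqP].
by move/enum_val_inj => ->; rewrite eqxx.
Qed.

Lemma face_row_eqP k (c d : {ffun {set T} -> rat^o}) :
  (forall t, t \in G -> #|t| = k -> c t = d t) <-> face_row k c = face_row k d.
Proof.
split=> [h|/rowP h t tG tk].
  apply/rowP => a; rewrite !mxE; have := enum_valP a.
  by rewrite in_faces => /andP[aG /eqP ak]; apply: h.
have tF : t \in faces G k by rewrite in_faces tG tk eqxx.
by have := h (enum_rank_in tF t); rewrite !mxE enum_rankK_in.
Qed.

Lemma face_row_delta k (c : {ffun {set T} -> rat^o}) :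
  face_row k.+1 [ffun t => delta (@ksign T) G c t] = face_row k c *m coboundary G k.
Proof.
apply/rowP => b; rewrite !mxE ffunE; set t := enum_val b.
have := enum_valP b; rewrite in_faces -/t => /andP[tG /eqP tk].
transitivity (\sum_(a < #|faces G k|) \sum_(v in t | t :\ v == enum_val a)
    ksign v t * c (t :\ v)); last first.
  apply: eq_bigr => a _; rewrite !mxE /incidence mulr_sumr -/t.
  by apply: eq_bigr => v /andP[_ /eqP ->]; rewrite mulrC.
rewrite (exchange_big_dep (fun v => v \in t)) /=; last by move=> a v _ /andP[].
rewrite /delta big_mkcondr /=; apply: eq_bigr => v vt; case: ifP => [vG|vG].
  have vF : t :\ v \in faces G k by rewrite in_faces vG (card_setD1 vt tk) eqxx.
  rewrite (big_pred1 (enum_rank_in vF (t :\ v))) // => a /=.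
  rewrite vt /=; apply/eqP/eqP => [E|->]; last by rewrite enum_rankK_in.
  by apply: enum_val_inj; rewrite enum_rankK_in.
rewrite big1 // => a /andP[_ /eqP E]; have := enum_valP a.
by rewrite in_faces -E vG.
Qed.

Lemma coboundaryK k : coboundary G k *m coboundary G k.+1 = 0.
Proof.
apply/row_matrixP => a; rewrite row0 row_mul rowE.
have [c <-] := face_row_onto (delta_mx 0 a).
rewrite -!face_row_delta -[0](_ : face_row _ 0 = _); last by apply/rowP => b; rewrite !mxE ffunE.
apply/face_row_eqP => t tG _; rewrite !ffunE.
exact: (delta_delta _ (ksignP _)).
Qed.

Lemma cohom_dimP k : hcoh (@ksign T) G k (cohom_dim G k).
Proof.
pose L k (r : 'rV[rat]_#|faces G k|) (c : {ffun {set T} -> rat^o}) := face_row k c = r.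
have linL : linrel idfun idfun (L k).
  split=> [|r s c d <- <-|a r c <-]; apply/rowP => b; rewrite !mxE ?ffunE //.
have cocP (c : {ffun {set T} -> rat^o}) :
    face_row k c *m coboundary G k = 0 <-> cocyc (@ksign T) G k c.
  rewrite -face_row_delta (_ : 0 = face_row k.+1 0); last first.
    by apply/rowP => b; rewrite !mxE ffunE.
  split=> [/face_row_eqP h t tG tk|h]; last apply/face_row_eqP => t tG tk.
    by have := h t tG tk; rewrite !ffunE.
  by rewrite !ffunE h.
have main (p : nat) (A : 'M_(p, #|faces G k|)) : A *m coboundary G k = 0 ->
   (forall c, (exists u, face_row k c = u *m A) <-> cobd (@ksign T) G k c) ->
   hcoh (@ksign T) G k (hdim A (coboundary G k)).
  move=> /hdim_qdim q hA; apply: qdim_transport q => //; last (split; first exact: linL).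
  - by split=> [|x y hx hy|a x hx]; rewrite ?mul0mx ?mulmxDl ?hx ?hy ?addr0 // -scalemxAl hx scaler0.
  - exact: subsp_cocyc.
  - move=> r hr; have [c hc] := face_row_onto r; exists c; split=> //.
    by apply/cocP; rewrite hc.
  - by move=> c /cocP hc; exists (face_row k c).
  - by move=> r c _ _ <-.
case: k L linL cocP main => [|k] L linL cocP main.
  apply: main => [|c]; first by rewrite mul0mx.
  split=> [[u]|[e he]].
    rewrite mulmx0 (_ : 0 = face_row 0 0); last by apply/rowP => b; rewrite !mxE ffunE.
    by move=> /face_row_eqP h; exists 0 => t tG t0; rewrite delta0 h // ffunE.
  exists 0; rewrite mulmx0 (_ : 0 = face_row 0 0); last by apply/rowP => b; rewrite !mxE ffunE.
  by apply/face_row_eqP => t tG t0; rewrite he // delta_card0 // ffunE.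
apply: main => [|c]; first exact: coboundaryK.
split=> [[u]|[e he]].
  have [e <-] := face_row_onto u; rewrite -face_row_delta => /face_row_eqP h.
  by exists e => t tG tk; rewrite h // ffunE.
exists (face_row k e); rewrite -face_row_delta; apply/face_row_eqP => t tG tk.
by rewrite he // ffunE.
Qed.

Lemma cohom_dim_eq k n : hcoh (@ksign T) G k n -> cohom_dim G k = n.
Proof. by move=> h; apply: hcoh_uniq h; apply: cohom_dimP. Qed.

End CohomDim.

Lemma simplicial_convex (T : finType) (G : {set {set T}}) :
  simplicial_complex G -> convex G.
Proof. by move=> [_ h] r s t _ tG _ st; apply: h tG st. Qed.

(** * Full subcomplexes of Bier spheres *)

Lemma hcoh0_acyc (T : finType) kappa (X : {set {set T}}) :
  (forall k, hcoh kappa X k 0) -> acyc kappa X.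
Proof.
move=> h k c hc; have [x [_ gen _]] := h k.
by have [d] := gen c hc; rewrite big_ord0 subr0.
Qed.

Lemma disjoint_setU1 (T : finType) (x : T) (A B : {set T}) :
  [disjoint x |: A & B] = (x \notin B) && [disjoint A & B].
Proof. by rewrite !disjoints_subset subUset sub1set inE. Qed.

Lemma setD_sub (U : finType) (A : {set U}) (P : pred U) :
  A :\: [set s in A | ~~ P s] = [set s in A | P s].
Proof.
by apply/setP => s; rewrite !inE; case: (s \in A); rewrite ?andbF //= andbT negbK.
Qed.

Section Star.
Variables (T : finType) (kappa : T -> {set T} -> rat) (Y : {set {set T}}).
Hypotheses (hk : signs kappa)
  (dY : forall s t : {set T}, s \in Y -> t \subset s -> t \in Y).

Lemma down_convex : convex Y.
Proof. by move=> r s t _ tY _ st; apply: dY tY st. Qed.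

(* The star of v is acyclic. *)
Lemma hcoh_delstar v k n :
  hcoh kappa Y k n <-> hcoh kappa [set s in Y | v |: s \notin Y] k n.
Proof.
rewrite (_ : [set s in Y | _] = Y :\: [set s in Y | v |: s \in Y]); last first.
  by apply/setP => s; rewrite !inE; case: (s \in Y); rewrite ?andbF //= andbT.
apply: hcoh_quot => //.
- exact: down_convex.
- by apply/subsetP => s; rewrite inE => /andP[].
- move=> s t; rewrite !inE => /andP[_ vt] -> st /=.
  by apply: dY vt _; apply: setUS.
- apply: (@toggle_acyc _ _ _ v) => // t nt; rewrite !inE setUA setUid andbb.
  by rewrite andb_idl // => /dY; apply; apply: subsetUr.
Qed.

End Star.

Section BierFamilies.
Variable m : nat.
Notation T := ('I_m + 'I_m)%type.
Implicit Types (K : {set {set 'I_m}}) (s t W : {set T}) (I J S : {set 'I_m}).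

Definition lft s : {set 'I_m} := inl @^-1: s.
Definition rgt s : {set 'I_m} := inr @^-1: s.

Lemma lftU1l v s : lft (inl v |: s) = v |: lft s.
Proof. by apply/setP => x; rewrite !inE. Qed.
Lemma lftU1r v s : lft (inr v |: s) = lft s.
Proof. by apply/setP => x; rewrite !inE. Qed.
Lemma rgtU1l v s : rgt (inl v |: s) = rgt s.
Proof. by apply/setP => x; rewrite !inE. Qed.
Lemma rgtU1r v s : rgt (inr v |: s) = v |: rgt s.
Proof. by apply/setP => x; rewrite !inE. Qed.

Definition lrE := (lftU1l, lftU1r, rgtU1l, rgtU1r).

Lemma in_lft v s : (v \in lft s) = (inl v \in s). Proof. by rewrite inE. Qed.
Lemma in_rgt v s : (v \in rgt s) = (inr v \in s). Proof. by rewrite inE. Qed.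

Lemma lr_inj s t : lft s = lft t -> rgt s = rgt t -> s = t.
Proof.
by move=> /setP hl /setP hr; apply/setP => -[v|v]; [have := hl v|have := hr v]; rewrite !inE.
Qed.

Lemma lft_join I J : lft ((inl @: I) :|: (inr @: J)) = I.
Proof.
apply/setP => v; rewrite !inE mem_imset; last by move=> x y [].
by rewrite orb_idr // => /imsetP[].
Qed.

Lemma rgt_join I J : rgt ((inl @: I) :|: (inr @: J)) = J.
Proof.
apply/setP => v; rewrite !inE [X in _ || X]mem_imset; last by move=> x y [].
by rewrite orb_idl // => /imsetP[].
Qed.

Lemma joinK s : (inl @: lft s) :|: (inr @: rgt s) = s.
Proof. by apply: lr_inj; rewrite ?lft_join ?rgt_join. Qed.

Lemma card_lr s : #|s| = (#|lft s| + #|rgt s|)%N.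
Proof.
rewrite -{1}(joinK s) cardsU (_ : _ :&: _ = set0) ?cards0 ?subn0.
  by rewrite !card_imset // => x y [].
by apply/setP => -[v|v]; rewrite !inE; apply/negP => /andP[/imsetP[x _ Ex] /imsetP[y _ Ey]].
Qed.

Lemma lftS s t : s \subset t -> lft s \subset lft t.
Proof. exact: preimsetS. Qed.
Lemma rgtS s t : s \subset t -> rgt s \subset rgt t.
Proof. exact: preimsetS. Qed.

(** Membership of the right part in the Alexander dual is unfolded, so that every face condition
    refers to K. *)
Definition bfam K I J : {set {set T}} :=
  [set s | [&& lft s \in K, ~: rgt s \notin K, [disjoint lft s & rgt s],
     lft s \subset I & rgt s \subset J]].

Lemma in_bier K s :
  (s \in bier K) = [&& lft s \in K, ~: rgt s \notin K & [disjoint lft s & rgt s]].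
Proof.
apply/imset2P/and3P => [[a b aK]|[hl hr hd]].
  by rewrite !inE => /andP[bK d] ->; rewrite lft_join rgt_join aK bK d.
by exists (lft s) (rgt s); rewrite ?inE ?hr ?joinK //.
Qed.

Lemma restr_bier K W : restr (bier K) W = bfam K (lft W) (rgt W).
Proof.
have sWE s : (s \subset W) = (lft s \subset lft W) && (rgt s \subset rgt W).
  apply/idP/andP => [h|[hl hr]]; first by rewrite lftS ?rgtS.
  apply/subsetP => -[v|v]; rewrite -?in_lft -?in_rgt => hv.
    exact: (subsetP hl).
  exact: (subsetP hr).
by apply/setP => s; rewrite !inE in_bier sWE -!andbA.
Qed.

Section Cases.
Variable K : {set {set 'I_m}}.
Hypothesis hK : simplicial_complex K.
Variable kappa : T -> {set T} -> rat.
Hypothesis hk : signs kappa.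

Let dK I J : I \in K -> J \subset I -> J \in K.
Proof. by case: hK => _ h; apply: h. Qed.

Lemma bfam_down I J s t : s \in bfam K I J -> t \subset s -> t \in bfam K I J.
Proof.
rewrite !inE => /and5P[h1 h2 h3 h4 h5] ts.
have l := lftS ts; have r := rgtS ts.
rewrite (dK h1 l) (subset_trans l h4) (subset_trans r h5) (disjointWl l) ?(disjointWr r) //.
rewrite /= !andbT; apply: contra h2 => h2; apply: dK h2 _; by rewrite setCS.
Qed.

(* For a in I \ J: the faces of the (I, J) subcomplex outside the star of a. *)
Definition bfam_off a I J : {set {set T}} :=
  [set s | [&& lft s \in K, a |: lft s \notin K, [disjoint lft s & rgt s],
     lft s \subset I & rgt s \subset J]].

(** Outside the star of a the dual condition is automatic: a is not in [rgt s], which lies in J, so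
    [a |: lft s] is contained in [~: rgt s]; if the latter were a face, so would be the former. *)
Lemma hcoh_bfam_off a I J k n : a \in I -> a \notin J ->
  hcoh kappa (bfam K I J) k n <-> hcoh kappa (bfam_off a I J) k n.
Proof.
move=> aI aJ; apply: iff_trans (hcoh_delstar hk (@bfam_down I J) (inl a) k n) _.
rewrite (_ : [set s in _ | _] = bfam_off a I J) //; apply/setP => s.
rewrite [LHS]inE [RHS]inE [inl a |: s \in _]inE [s \in _]inE !lrE.
have [/= sK|//] := boolP (lft s \in K).
have [dis|] := boolP [disjoint lft s & rgt s]; last by rewrite !andbF.
have [sI|] := boolP (lft s \subset I); last by rewrite !andbF.
have [sJ|] := boolP (rgt s \subset J); last by rewrite !andbF.
have ar : a \notin rgt s by apply: contra aJ; apply: (subsetP sJ).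
rewrite subUset sub1set aI disjoint_setU1 ar dis sI !andbT /=.
have [a1|a1] := boolP (a |: lft s \in K); first by rewrite andbN.
rewrite andbT; apply: contra a1 => h; apply: dK h _.
by rewrite subUset sub1set inE ar /= -disjoints_subset.
Qed.

Lemma bfam_off_convex a I J : convex (bfam_off a I J).
Proof.
move=> r s t; rewrite !inE => /and5P[_ h _ _ _] /and5P[h1 _ h3 h4 h5] rs st.
have l := lftS st; have r' := rgtS st.
rewrite (dK h1 l) (subset_trans l h4) (subset_trans r' h5) (disjointWl l) ?(disjointWr r') //.
rewrite /= !andbT; apply: contra h => h; apply: dK h _; apply: setUS; exact: lftS.
Qed.

(** With the dual condition gone, an element b of J outside I can be toggled freely on the right:
    [lft t] lies in I and cannot contain it. *)
Lemma bfam_incomparable I J k : ~~ (I \subset J) -> ~~ (J \subset I) ->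
  hcoh kappa (bfam K I J) k 0.
Proof.
move=> /subsetPn[a aI aJ] /subsetPn[b bJ bI]; apply/(hcoh_bfam_off _ _ aI aJ).
apply: acyc_hcoh; apply: (@toggle_acyc _ _ _ (inr b)) => // t _; rewrite !inE !lrE.
have [tI|] := boolP (lft t \subset I); last by rewrite !andbF.
rewrite subUset sub1set bJ [in RHS]disjoint_sym disjoint_setU1 [in LHS]disjoint_sym.
by have -> : b \notin lft t by apply: contra bI; apply: (subsetP tI).
Qed.

(** Used both as the partner map of the two peelings and as the isomorphism with the Bier sphere of
    the dual. *)
Definition swap_lr (x : T) : T := match x with inl v => inr v | inr v => inl v end.

Lemma all_inl J s : all (mem s) [seq inl v | v <- enum J] = (J \subset lft s).
Proof.
rewrite all_map; apply/allP/subsetP => h v; first by move=> vJ; rewrite in_lft; apply: h; rewrite mem_enum.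
by rewrite mem_enum => /h; rewrite in_lft.
Qed.

Lemma all_inr J s : all (mem s) [seq inr v | v <- enum J] = (J \subset rgt s).
Proof.
rewrite all_map; apply/allP/subsetP => h v; first by move=> vJ; rewrite in_rgt; apply: h; rewrite mem_enum.
by rewrite mem_enum => /h; rewrite in_rgt.
Qed.

Lemma hcoh_peel_inl Y J k n : convex Y ->
  (forall v s, v \in J -> v \notin lft s -> v \notin rgt s ->
     (s \in Y) = (inr v |: s \in Y)) ->
  hcoh kappa Y k n <-> hcoh kappa [set s in Y | J \subset lft s] k n.
Proof.
move=> cY tog.
rewrite (_ : [set s in Y | _] = [set s in Y | all (mem s) [seq inl v | v <- enum J]]).
  apply: (hcoh_peel (p := swap_lr)) => // [_ /mapP[v _ ->]|_ s /mapP[v + ->] /=].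
    by apply/mapP => -[].
  by rewrite mem_enum -in_lft -in_rgt; apply: tog.
by apply/setP => s; rewrite !inE all_inl.
Qed.

Lemma hcoh_peel_inr Y J k n : convex Y ->
  (forall v s, v \in J -> v \notin lft s -> v \notin rgt s ->
     (s \in Y) = (inl v |: s \in Y)) ->
  hcoh kappa Y k n <-> hcoh kappa [set s in Y | J \subset rgt s] k n.
Proof.
move=> cY tog.
rewrite (_ : [set s in Y | _] = [set s in Y | all (mem s) [seq inr v | v <- enum J]]).
  apply: (hcoh_peel (p := swap_lr)) => // [_ /mapP[v _ ->]|_ s /mapP[v + ->] /=].
    by apply/mapP => -[].
  by rewrite mem_enum -in_lft -in_rgt => *; apply: tog.
by apply/setP => s; rewrite !inE all_inr.
Qed.

Lemma hcoh_empty k : hcoh kappa set0 k 0.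
Proof. by apply: hcoh_nocell => t; rewrite inE. Qed.

Lemma link_restr_down (I J s t : {set 'I_m}) :
  s \in link J (restr K I) -> t \subset s -> t \in link J (restr K I).
Proof.
rewrite !inE => /andP[/andP[sK sI] /and3P[ds JsK JsI]] ts.
rewrite (dK sK ts) (subset_trans ts sI) (disjointWr ts) //=.
by rewrite (dK JsK) ?setUS //= (subset_trans _ JsI) // setUS.
Qed.

Section LinkCase.
Variables (a : 'I_m) (I J : {set 'I_m}).
Hypotheses (sJI : J \subset I) (aI : a \in I) (aJ : a \notin J).

(** Faces of the link avoid J, so they go to the left copy. Sending J itself to the right copy makes
    f injective on all of ['I_m] with image disjoint from [inl @: J], as [hcoh_shift] requires. *)
Let f (v : 'I_m) : T := if v \in J then inr v else inl v.
Let phi (r : {set 'I_m}) : {set T} := (inl @: J) :|: f @: r.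

Let f_inj : injective f.
Proof. by move=> u v; rewrite /f; do 2 case: ifP => _; case. Qed.

Let fJ v : f v \notin inl @: J.
Proof.
rewrite /f; case: (boolP (v \in J)) => [_|nv]; first by apply/imsetP => -[].
by rewrite mem_imset // => x y [].
Qed.

Let lft_phi (r : {set 'I_m}) : [disjoint J & r] -> lft (phi r) = J :|: r.
Proof.
move=> dJr; apply/setP => v; rewrite !inE mem_imset; last by move=> x y [].
case: (boolP (v \in J)) => //= vJ.
apply/imsetP/idP => [[u ur]|vr]; last by exists v => //; rewrite /f (negPf vJ).
by rewrite /f; case: ifP => // _ [->].
Qed.

Let rgt_phi (r : {set 'I_m}) : [disjoint J & r] -> rgt (phi r) = set0.
Proof.
move=> dJr; apply/setP => v; rewrite !inE; apply/norP; split; first by apply/imsetP => -[].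
apply/imsetP => -[u ur]; rewrite /f; case: ifP => // uJ _.
by have := disjointFr dJr uJ; rewrite ur.
Qed.

(** The chain of inclusions of [rgt s] in J and of J in [lft s], with disjointness, leaves [rgt s]
    empty; so s amounts to [lft s :\: J], a face of the link. Because a is not in J, lying outside
    the star of a means the same for s and for this face. *)
Lemma bfam_off_link : J \in K ->
  [set s in bfam_off a I J | J \subset lft s] =
  phi @: [set r in link J (restr K I) | a |: r \notin link J (restr K I)].
Proof.
move=> JK.
have inL (r : {set 'I_m}) : (r \in link J (restr K I)) =
    [&& r \subset I, [disjoint J & r] & J :|: r \in K].
  rewrite !inE; case: (boolP (r \subset I)) => rI; rewrite ?andbF //= andbT.
  rewrite subUset sJI rI andbT /=; case: (boolP (_ :|: _ \in K)) => JrK; rewrite ?andbF //.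
  by rewrite (dK JrK (subsetUr _ _)).
apply/setP => s; apply/idP/imsetP => [|[r]].
  rewrite !inE => /andP[/and5P[sK asK ds lI rJ] Jl].
  have r0 : rgt s = set0.
    apply/eqP; rewrite -subset0; apply/subsetP => v vr.
    have vl : v \in lft s by apply: (subsetP Jl); apply: (subsetP rJ).
    by have := disjointFr ds vl; rewrite vr.
  have dJ : [disjoint J & lft s :\: J] by rewrite disjoints_subset setDE setCI setCK subsetUr.
  have E : J :|: lft s :\: J = lft s.
    by apply/setP => v; rewrite !inE; case: (boolP (v \in J)) => //= vJ; rewrite -in_lft (subsetP Jl).
  exists (lft s :\: J); last by apply: lr_inj; rewrite ?lft_phi ?rgt_phi // E.
  rewrite inE !inL dJ E sK (subset_trans (subsetDl _ _) lI) /=.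
  by rewrite setUCA E (negPf asK) !andbF.
move=> /setIdP[]; rewrite (inL r) (inL (a |: r)) => /and3P[rI dJr JrK] nar ->.
rewrite inE lft_phi // subsetUl andbT inE lft_phi // rgt_phi // JrK sub0set subUset sJI rI.
rewrite -setI_eq0 setI0 eqxx !andbT /=; apply: contra nar => h.
rewrite subUset sub1set aI rI /= setUCA h andbT.
by rewrite disjoint_sym disjoint_setU1 aJ disjoint_sym.
Qed.

Lemma hcoh_bfam_peel k n :
  hcoh kappa (bfam K I J) k n <->
  hcoh kappa [set s in bfam_off a I J | J \subset lft s] k n.
Proof.
apply: iff_trans (hcoh_bfam_off _ _ aI aJ) _; apply: hcoh_peel_inl.
  exact: bfam_off_convex.
move=> v s vJ vl vr; rewrite !inE !lrE [in RHS]disjoint_sym disjoint_setU1 vl.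
by rewrite [in RHS]disjoint_sym subUset sub1set vJ.
Qed.

Lemma bfam_link_notin k : J \notin K -> hcoh kappa (bfam K I J) k 0.
Proof.
move=> JK; apply/hcoh_bfam_peel; rewrite (_ : [set s in _ | _] = set0).
  exact: hcoh_empty.
apply/setP => s; rewrite !inE; apply/negP => /andP[/and5P[sK _ _ _ _] Jl].
by move: JK; rewrite (dK sK Jl).
Qed.

(** Needed for the homological indices i > |I|, where the Betti number of the link is zero by
    convention while the degree |I| + |J| - i on the Bier side may still be non-negative. *)
Lemma bfam_link_small k : J \in K -> (k < #|J|)%N -> hcoh kappa (bfam K I J) k 0.
Proof.
move=> JK kJ; apply/hcoh_bfam_peel; rewrite bfam_off_link //.
apply: hcoh_nocell => _ /imsetP[r _ ->]; rewrite gtn_eqF //; apply: leq_trans kJ _.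
rewrite -(card_imset (mem J) (inl_inj : injective (@inl 'I_m 'I_m))).
exact/subset_leq_card/subsetUl.
Qed.

(** [hcoh_delstar] enters a second time, now backwards: it puts the star of a back into the link. *)
Lemma bfam_link k n : J \in K ->
  hcoh kappa (bfam K I J) (#|J| + k) n <->
  hcoh (@ksign 'I_m) (link J (restr K I)) k n.
Proof.
move=> JK; apply: iff_trans (hcoh_bfam_peel _ _) _; rewrite bfam_off_link //.
apply: iff_trans (iff_sym (hcoh_delstar (ksignP _) (Y := link J (restr K I)) _ a k n)).
  have := hcoh_shift f_inj fJ (ksignP _) hk
     [set r in link J (restr K I) | a |: r \notin link J (restr K I)] k n.
  rewrite card_imset; last by move=> x y [].
  exact: iff_sym.
exact: link_restr_down.
Qed.

End LinkCase.

Section Diagonal.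
Variable S : {set 'I_m}.

(** For I = J there is no vertex whose star could be removed to make the dual condition automatic;
    the diagonal family is instead compared with this larger complex, in which that condition is
    dropped. *)
Definition bfam0 : {set {set T}} :=
  [set s | [&& lft s \in K, [disjoint lft s & rgt s], lft s \subset S & rgt s \subset S]].

Lemma bfam0_down s t : s \in bfam0 -> t \subset s -> t \in bfam0.
Proof.
rewrite !inE => /and4P[h1 h3 h4 h5] ts.
have l := lftS ts; have r := rgtS ts.
by rewrite (dK h1 l) (subset_trans l h4) (subset_trans r h5) (disjointWl l) ?(disjointWr r).
Qed.

Lemma bfam_bfam0 : bfam K S S = [set s in bfam0 | ~: rgt s \notin K].
Proof.
by apply/setP => s; rewrite !inE; case: (lft s \in K) => //=; rewrite andbC.
Qed.

Lemma hcoh_bfam0 k n : hcoh kappa bfam0 k n <->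
  hcoh kappa [set s in bfam0 | S \subset lft s] k n.
Proof.
apply: hcoh_peel_inl; first exact/down_convex/bfam0_down.
move=> v s vS vl vr; rewrite !inE !lrE [in RHS]disjoint_sym disjoint_setU1 vl.
by rewrite [in RHS]disjoint_sym subUset sub1set vS.
Qed.

Lemma bfam0_acyc : S \notin K -> acyc kappa bfam0.
Proof.
move=> SK; apply: hcoh0_acyc => k; apply/hcoh_bfam0; rewrite (_ : [set s in _ | _] = set0).
  exact: hcoh_empty.
apply/setP => s; rewrite !inE; apply/negP => /andP[/and4P[sK _ _ _] Sl].
by move: SK; rewrite (dK sK Sl).
Qed.

(** As [~: rgt s] contains [~: S], which is not a face, the dual condition always holds. Peeling off
    the elements of S on the left then leaves the single cell [inl @: S]. *)
Lemma bfam_diag_full k : S \in K -> ~: S \notin K -> hcoh kappa (bfam K S S) k (#|S| == k).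
Proof.
move=> SK SK'; rewrite (_ : bfam K S S = bfam0); last first.
  rewrite bfam_bfam0; apply/setP => s; rewrite !inE andb_idr // => /and4P[_ _ _ rS].
  by apply: contra SK' => h; apply: dK h _; rewrite setCS.
apply/hcoh_bfam0; rewrite (_ : [set s in _ | _] = [set inl @: S]).
  rewrite -(card_imset (mem S) (inl_inj : injective (@inl 'I_m 'I_m))); exact: hcoh_cell.
have E : inl @: S = (inl @: S) :|: (inr @: (set0 : {set 'I_m})) :> {set T} by rewrite imset0 setU0.
apply/setP => s; rewrite E !inE; apply/idP/eqP => [/andP[/and4P[_ d lS rS] Sl]|->].
  apply: lr_inj; rewrite ?lft_join ?rgt_join; first by apply/eqP; rewrite eqEsubset lS.
  apply/eqP; rewrite -subset0; apply/subsetP => v vr.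
  have vl : v \in lft s by apply: (subsetP Sl); apply: (subsetP rS).
  by have := disjointFr d vl; rewrite vr.
by rewrite lft_join rgt_join SK sub0set subxx -setI_eq0 setI0 eqxx.
Qed.

Lemma bfam_diag_none k : S \notin K -> ~: S \notin K -> hcoh kappa (bfam K S S) k 0.
Proof.
move=> SK SK'; rewrite (_ : bfam K S S = bfam0); last first.
  rewrite bfam_bfam0; apply/setP => s; rewrite !inE andb_idr // => /and4P[_ _ _ rS].
  by apply: contra SK' => h; apply: dK h _; rewrite setCS.
exact/acyc_hcoh/bfam0_acyc.
Qed.

(** Now the condition [lft s \in K] is automatic, so peeling can be done on the right; a surviving
    cell would have [rgt s = S], against the dual condition. *)
Lemma bfam_diag_both k : S \in K -> ~: S \in K -> hcoh kappa (bfam K S S) k 0.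
Proof.
move=> SK SK'; apply/(@hcoh_peel_inr _ S).
- exact/down_convex/bfam_down.
- move=> v s vS vl vr; rewrite !inE !lrE disjoint_setU1 vr subUset sub1set vS /=.
  have [lS|] := boolP (lft s \subset S); last by rewrite !andbF.
  have vlS : v |: lft s \subset S by rewrite subUset sub1set vS.
  by rewrite (dK SK lS) (dK SK vlS).
rewrite (_ : [set s in _ | _] = set0); first exact: hcoh_empty.
apply/setP => s; rewrite !inE; apply/negP => /andP[/and5P[_ h _ _ rS] Sr].
have E : rgt s = S by apply/eqP; rewrite eqEsubset rS.
by move: h; rewrite E SK'.
Qed.

(** The ambient complex [bfam0] is acyclic, so the connecting map shifts the question to its faces
    with [~: rgt s \in K]. For these [lft s \in K] is automatic, and peeling on the right leaves the
    single cell [inr @: S]. The connecting map accounts for [k.+1]. *)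
Lemma bfam_diag_dual k : S \notin K -> ~: S \in K -> hcoh kappa (bfam K S S) k (#|S| == k.+1).
Proof.
move=> SK SK'; apply/(@hcoh_conn _ kappa bfam0).
- exact: hk.
- exact/down_convex/bfam0_down.
- by apply/subsetP => s; rewrite bfam_bfam0 inE => /andP[].
- move=> s t; rewrite bfam_bfam0 => /setIdP[_ ht] h0 st; apply/setIdP.
  by split=> //; apply: contra ht => h; apply: dK h _; rewrite setCS rgtS.
- exact: bfam0_acyc.
rewrite bfam_bfam0 setD_sub.
apply/(@hcoh_peel_inr _ S).
- apply: convex_sub; first exact/down_convex/bfam0_down.
  move=> r s t rs _ h _; apply: dK h _; rewrite setCS; exact: rgtS.
- move=> v s vS vl vr; rewrite !inE !lrE disjoint_setU1 vr subUset sub1set vS /=.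
  have [d|] := boolP [disjoint lft s & rgt s]; last by rewrite !andbF.
  have [h|] := boolP (~: rgt s \in K); last by rewrite !andbF.
  have vl' : v |: lft s \subset ~: rgt s.
    by rewrite subUset sub1set inE vr -disjoints_subset.
  by rewrite (dK h vl') (dK h (subset_trans (subsetUr _ _) vl')).
rewrite (_ : [set s in _ | _] = [set inr @: S]).
  rewrite -(card_imset (mem S) (inr_inj : injective (@inr 'I_m 'I_m))); exact: hcoh_cell.
have E : inr @: S = (inl @: (set0 : {set 'I_m})) :|: (inr @: S) :> {set T} by rewrite imset0 set0U.
apply/setP => s; rewrite E !inE; apply/idP/eqP => [/andP[/andP[/and4P[_ d lS rS] _] Sr]|->].
  apply: lr_inj; rewrite ?lft_join ?rgt_join; last by apply/eqP; rewrite eqEsubset rS.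
  apply/eqP; rewrite -subset0; apply/subsetP => v vl.
  have vr : v \in rgt s by apply: (subsetP Sr); apply: (subsetP lS).
  by have := disjointFr d vl; rewrite vr.
by rewrite lft_join rgt_join SK' sub0set subxx (proj1 hK) -setI_eq0 set0I eqxx.
Qed.

End Diagonal.

End Cases.

(** Exchanging the two copies exchanges the two face conditions, because taking complements twice
    returns K. It is an instance of [hcoh_shift] with an empty fixed set. *)
Lemma hcoh_swap K I J kappa kappa' k n : signs kappa -> signs kappa' ->
  hcoh kappa (bfam K I J) k n <-> hcoh kappa' (bfam (alexander_dual K) J I) k n.
Proof.
move=> hk hk'.
have swK : involutive swap_lr by case.
have swE (s : {set T}) : set0 :|: swap_lr @: s = swap_lr @^-1: s.
  rewrite set0U; apply/setP => x; rewrite inE; apply/imsetP/idP => [[y ys ->]|h].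
    by rewrite swK.
  by exists (swap_lr x).
have := @hcoh_shift T T swap_lr set0 (inv_inj swK) (fun v => negbT (in_set0 _)) kappa kappa' hk hk' (bfam K I J) k n.
rewrite cards0 add0n.
suff -> : [set set0 :|: swap_lr @: s | s : {set T} in bfam K I J] = bfam (alexander_dual K) J I by [].
have lE (s : {set T}) : lft (swap_lr @^-1: s) = rgt s by apply/setP => v; rewrite !inE.
have rE (s : {set T}) : rgt (swap_lr @^-1: s) = lft s by apply/setP => v; rewrite !inE.
have inE' (s : {set T}) : (s \in bfam (alexander_dual K) J I) = (swap_lr @^-1: s \in bfam K I J).
  rewrite [LHS]inE [RHS]inE lE rE !inE setCK negbK disjoint_sym.
  case: (lft s \subset J); rewrite ?andbF //; case: (rgt s \subset I); rewrite ?andbF //=.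
  by rewrite andbCA.
apply/setP => s; rewrite inE'; apply/imsetP/idP => [[t tb ->]|h].
  rewrite swE (_ : swap_lr @^-1: (swap_lr @^-1: t) = t) //.
  by apply/setP => x; rewrite !inE swK.
exists (swap_lr @^-1: s) => //; rewrite swE.
by apply/setP => x; rewrite !inE swK.
Qed.

(** The empty set belongs to the dual because the whole vertex set is not a face; this is where K
    differing from the full simplex enters. *)
Lemma alexander_dual_complex K : simplicial_complex K -> K <> powerset [set: 'I_m] ->
  simplicial_complex (alexander_dual K).
Proof.
move=> [K0 dK] hp; split=> [|s t]; rewrite !inE.
  rewrite setC0; apply/negP => h; apply: hp; apply/setP => s; rewrite !inE subsetT.
  exact: dK h (subsetT s).
by move=> h ts; apply: contra h => h; apply: dK h _; rewrite setCS.
Qed.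

End BierFamilies.

(** * Taylor complexes *)

Section Chains.
Variables (A : finType) (kappa : A -> {set A} -> rat) (X : {set {set A}}) (b : A).
Hypothesis hk : signs kappa.
Hypothesis tog : forall s : {set A}, b \notin s -> (s \in X) = (b |: s \in X).

(* The chain complex of X is the cochain complex of the complements. *)
Lemma chain_contract k (z : {set A} -> rat) :
  (forall S : {set A}, S \in X -> #|S|.+1 = k ->
     \sum_(s | (s \notin S) && (s |: S \in X)) kappa s (s |: S) * z (s |: S) = 0) ->
  exists y : {set A} -> rat, forall S : {set A}, S \in X -> #|S| = k ->
     z S = \sum_(s | (s \notin S) && (s |: S \in X)) kappa s (s |: S) * y (s |: S).
Proof.
move=> hz.
(* Complementation turns cardinality k into #|A| - k, a truncated difference; for k > #|A| there is
   no set of cardinality k and any witness will do. *)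
have [kA|Ak] := leqP k #|A|; last first.
  by exists z => S _ Sk; move: Ak; rewrite -Sk ltnNge max_card.
pose kappa' v (t : {set A}) := kappa v (v |: ~: t).
pose X' := [set t | ~: t \in X].
have CD (t : {set A}) v : ~: (t :\ v) = v |: ~: t.
  by apply/setP => w; rewrite !inE negb_and negbK.
have hk' : signs kappa'.
  split=> [v t vt|u v t ut vt uv]; first by rewrite (proj1 hk) // setU11.
  rewrite /kappa' !CD; set P := u |: (v |: ~: t).
  have vuP : v |: (u |: ~: t) = P by rewrite /P setUCA.
  have uP : u \in P by rewrite setU11.
  have vP : v \in P by rewrite -vuP setU11.
  have Pv : P :\ v = u |: ~: t by rewrite -vuP setU1K // !inE eq_sym (negPf uv) vt.
  have Pu : P :\ u = v |: ~: t by rewrite /P setU1K // !inE (negPf uv) ut.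
  rewrite vuP -Pv -Pu mulrC [X in _ = - X]mulrC.
  by rewrite (proj2 hk) // eq_sym.
have dE (c : {ffun {set A} -> rat^o}) (S : {set A}) : delta kappa' X' c (~: S) =
    \sum_(s | (s \notin S) && (s |: S \in X)) kappa s (s |: S) * c (~: (s |: S)).
  have E s : (~: S :\ s \in X') = (s |: S \in X) by rewrite inE CD setCK.
  rewrite /delta; apply: eq_big => [s|s _]; first by rewrite E inE.
  by rewrite /kappa' setCK; congr (_ * c _); apply/setP => w; rewrite !inE negb_or.
have cC (S : {set A}) : (#|~: S| = #|A| - #|S|)%N by rewrite cardsCs setCK.
have tog' (t : {set A}) : b \notin t -> (t \in X') = (b |: t \in X').
  move=> bt; rewrite !inE [in RHS]tog ?inE ?eqxx //.
  by congr (_ \in X); apply/setP => w; rewrite !inE negb_or; case: eqVneq => //= ->.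
have [t|e he] := @toggle_acyc _ kappa' X' b hk' tog' (#|A| - k)%N [ffun t : {set A} => z (~: t)].
  rewrite -[t]setCK inE setCK => tX; rewrite cC => tk.
  rewrite dE -[RHS](hz _ tX).
    by apply: eq_bigr => s _; rewrite ffunE setCK.
  by move: tk (max_card (mem (~: t))) kA; lia.
exists (fun S => e (~: S)) => S SX Sk.
have := he (~: S); rewrite inE setCK cC Sk dE ffunE setCK; exact.
Qed.

End Chains.

Section Monomials.
Variable V : finType.
Notation n := #|V|.
Notation R := {mpoly rat[n]}.
Implicit Types (U W : {set V}) (u w : 'X_{1..n}) (p q : R).

Definition mset U : 'X_{1..n} := [multinom (enum_val i \in U : nat) | i < n].
Definition suppm u : {set V} := [set v | u (enum_rank v) != 0%N].

Lemma msetE U v : mset U (enum_rank v) = (v \in U).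
Proof. by rewrite mnmE enum_rankK. Qed.

Lemma mnmVP u w : (forall v : V, u (enum_rank v) = w (enum_rank v)) -> u = w.
Proof. by move=> h; apply/mnmP => i; rewrite -(enum_valK i). Qed.

Lemma lemVP u w : reflect (forall v : V, (u (enum_rank v) <= w (enum_rank v))%N) (u <= w)%MM.
Proof.
by apply: (iffP mnm_lepP) => h i //; rewrite -(enum_valK i).
Qed.

Lemma suppm_mset U : suppm (mset U) = U.
Proof. by apply/setP => v; rewrite inE msetE; case: (v \in U). Qed.

Lemma mset_le U u : (mset U <= u)%MM = (U \subset suppm u).
Proof.
apply/lemVP/subsetP => h v => [vU|].
  by have := h v; rewrite msetE vU inE lt0n.
by rewrite msetE; case: (boolP (v \in U)) => // /h; rewrite inE lt0n.
Qed.

Lemma mdeg_mset U : mdeg (mset U) = #|U|.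
Proof.
rewrite mdegE -sum1_card [RHS]big_mkcond /= (reindex (@enum_rank V)) /=; last first.
  by apply: onW_bij; exact: enum_rank_bij.
by apply: eq_bigr => v _; rewrite msetE; case: (v \in U).
Qed.

Lemma msetU U W : [disjoint U & W] -> mset (U :|: W) = (mset U + mset W)%MM.
Proof.
move=> d; apply: mnmVP => v; rewrite mnmDE !msetE inE.
by case: (boolP (v \in U)) => // vU; rewrite (disjointFr d vU).
Qed.

Lemma sr_monomialE U : sr_monomial U = 'X_[mset U].
Proof.
rewrite /sr_monomial -(big_morph _ (@mpolyXD _ _) (@mpolyX0 _ _)).
congr 'X_[_]; apply: mnmVP => v; rewrite mnm_sumE msetE.
rewrite (eq_bigr (fun s => (s == v) : nat)); last first.
  by move=> s _; rewrite mnm1E (inj_eq enum_rank_inj).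
case: (boolP (v \in U)) => vU; last first.
  by rewrite big1 // => s sU; case: eqP => // sv; move: vU; rewrite -sv sU.
by rewrite (bigD1 v) //= eqxx big1 // => s /andP[_ /negPf ->].
Qed.

Lemma mcoeffXM u w p : ('X_[u] * p)@_w = if (u <= w)%MM then p@_(w - u) else 0.
Proof.
case: ifP => [uw|nuw].
  by rewrite mulrC -{1}(submK uw) addmC mcoeffMX.
rewrite mcoeffM big1 // => -[k l] /= /eqP E; rewrite mcoeffX.
case: eqP => [Ek|]; last by rewrite mul0r.
by have := lem_addr (k : 'X_{1..n}) l; rewrite -E -Ek nuw.
Qed.

End Monomials.

(** * The Taylor differential and its exactness, multidegree by multidegree *)

Section Taylor.
Variables (V A : finType) (f : A -> {set V}).
Notation n := #|V|.
Notation R := {mpoly rat[n]}.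
Implicit Types (S : {set A}) (u w : 'X_{1..n}) (z : {set A} -> R).

Definition tsupp S : {set V} := \bigcup_(s in S) f s.

(** The monomial is the least common multiple of the generators in [s |: S] divided by that of the
    generators in S. *)
Definition tcoef s S : R := ksign s (s |: S) *: 'X_[mset (f s :\: tsupp S)].

(* The differential of the Taylor complex of the square-free monomials with
   supports f; for f s = [set s] this is the Koszul complex. *)
Definition tdel z S : R := \sum_(s | s \notin S) tcoef s S * z (s |: S).

Lemma tsuppU1 s S : tsupp (s |: S) = f s :|: tsupp S.
Proof. by rewrite /tsupp bigcup_setU big_set1. Qed.

(** The basis vector of S has multidegree [mset (tsupp S)], so the part of z in multidegree w is its
    coefficient at w minus that. On these rational numbers the differential becomes the simplicial
    one of the family of all S with [tsupp S \subset suppm w]. *)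
Lemma tdel_coef z S w : tsupp S \subset suppm w ->
  (tdel z S)@_(w - mset (tsupp S)) =
  \sum_(s | (s \notin S) && (tsupp (s |: S) \subset suppm w))
    ksign s (s |: S) * (z (s |: S))@_(w - mset (tsupp (s |: S))).
Proof.
move=> Sw; rewrite /tdel raddf_sum big_mkcondr; apply: eq_bigr => s sS.
rewrite -scalerAl /= mcoeffZ mcoeffXM tsuppU1 subUset Sw andbT.
have -> : (mset (f s :\: tsupp S) <= w - mset (tsupp S))%MM = (f s \subset suppm w).
  apply/lemVP/subsetP => h v.
    move=> vs; have := h v; rewrite mnmBE !msetE inE vs andbT.
    case: (boolP (v \in tsupp S)) => [vS _|_]; first exact: (subsetP Sw).
    by rewrite subn0 inE lt0n.
  rewrite mnmBE !msetE inE; case: (boolP (v \in tsupp S)) => //= _.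
  by rewrite subn0; case: (boolP (v \in f s)) => // /h; rewrite inE lt0n.
case: ifP => _; last by rewrite mulr0.
congr (_ * _@_ _); apply: mnmVP => v; rewrite !mnmBE !msetE !inE -subnDA.
by case: (v \in tsupp S); case: (v \in f s).
Qed.

Lemma tdel_tdel z S : tdel (tdel z) S = 0.
Proof.
pose H s r := if [&& s != r, s \notin S & r \notin S]
  then tcoef s S * (tcoef r (s |: S) * z (r |: (s |: S))) else 0.
transitivity (\sum_s \sum_r H s r).
  rewrite /tdel big_mkcond; apply: eq_bigr => s _; rewrite /H; case: ifPn => sS; last first.
    by rewrite big1 // => r _; rewrite andbF.
  rewrite mulr_sumr big_mkcond; apply: eq_bigr => r _.
  by rewrite !inE negb_or eq_sym.
apply: antisym_sum => s r; rewrite /H [r == s]eq_sym [X in _ = - (if _ && X then _ else _)]andbC.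
case: and3P => [[sr sS rS]|_]; last by rewrite oppr0.
rewrite !mulrA setUCA -mulNr; congr (_ * _).
rewrite /tcoef -!scalerAl -!scalerAr !scalerA -!mpolyXD.
rewrite -!msetU; last first.
- by rewrite disjoint_sym disjoints_subset setCD tsuppU1; apply/subsetP => v; rewrite !inE negb_or => /andP[/andP[-> _] _].
- by rewrite disjoint_sym disjoints_subset setCD tsuppU1; apply/subsetP => v; rewrite !inE negb_or => /andP[/andP[-> _] _].
rewrite (_ : f s :\: _ :|: _ = f r :\: tsupp S :|: f s :\: tsupp (r |: S)); last first.
  by apply/setP => v; rewrite !tsuppU1 !inE; do 3 case: (v \in _).
rewrite -scaleNr; congr (_ *: _).
have rP : r \in s |: (r |: S) by rewrite !inE eqxx orbT.
have rs : r != s by rewrite eq_sym.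
have := proj2 (ksignP A) r s _ rP (setU11 s (r |: S)) rs.
have -> : (s |: (r |: S)) :\ s = r |: S by rewrite setU1K // !inE negb_or sr.
have -> : (s |: (r |: S)) :\ r = s |: S by rewrite setUCA setU1K // !inE negb_or eq_sym sr.
rewrite setUCA => E; by rewrite mulrC E mulrC.
Qed.

(** Solutions found in each multidegree w separately are glued into polynomials. To keep the sums
    finite, multidegrees of total degree at least [D] are cut off, where z has no coefficients. The
    predicate P selects the monomials that matter: all of them for exactness, those with support in
    G for working modulo the ideal. *)
Lemma tdel_lift k z (P : 'X_{1..n} -> Prop) :
  (forall w, exists y : {set A} -> rat, forall S, tsupp S \subset suppm w -> #|S| = k ->
     P (w - mset (tsupp S))%MM -> (z S)@_(w - mset (tsupp S)) =
       \sum_(s | (s \notin S) && (tsupp (s |: S) \subset suppm w)) ksign s (s |: S) * y (s |: S)) ->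
  exists y, forall S u, #|S| = k -> P u -> (z S)@_u = (tdel y S)@_u.
Proof.
move=> /dep_choice[y hy].
pose D := \max_(S : {set A}) (msize (z S) + mdeg (mset (tsupp S)))%N.
pose E S u := if (mdeg (u + mset (tsupp S))%MM < D)%N then y (u + mset (tsupp S))%MM S else 0.
pose Y S : R := \sum_(u : 'X_{1..n < D}) E S u *: 'X_[u].
have YE S u : (Y S)@_u = E S u.
  have [uD|Du] := ltnP (mdeg u) D; first exact: mcoeff_mpoly.
  rewrite /Y raddf_sum big1 /=; last first.
    move=> v _; rewrite mcoeffZ mcoeffX; case: eqP => [vu|_]; last by rewrite mulr0.
    by have := bmdeg v; rewrite vu ltnNge Du.
  by rewrite /E mdegD ltnNge (leq_trans Du (leq_addr _ _)).
exists Y => S u Sk Pu.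
set w := (u + mset (tsupp S))%MM.
have uw : u = (w - mset (tsupp S))%MM by rewrite /w addmK.
have Sw : tsupp S \subset suppm w by rewrite -mset_le /w lem_addl.
rewrite [in RHS]uw tdel_coef //.
have YwE s : tsupp (s |: S) \subset suppm w ->
    (Y (s |: S))@_(w - mset (tsupp (s |: S))) = if (mdeg w < D)%N then y w (s |: S) else 0.
  by move=> h; rewrite YE /E submK // mset_le.
under eq_bigr => s /andP[_ hs] do rewrite YwE //.
case: ltnP => [wD|Dw]; first by have := hy w S; rewrite -uw; apply.
rewrite big1; last by move=> s _; rewrite mulr0.
apply: memN_msupp_eq0; apply: msize_mdeg_ge.
rewrite -(leq_add2r (mdeg (mset (tsupp S)))) -mdegD; apply: leq_trans Dw.
exact: (leq_bigmax S).
Qed.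

(** If some generator b divides the monomial of multidegree w, toggling b contracts that
    multidegree. If none does, only the empty set is left, hence k = 0, and the second hypothesis
    says that [z set0] has no such monomial. *)
Lemma taylor_exact k z :
  (forall S, #|S|.+1 = k -> tdel z S = 0) ->
  (k = 0%N -> forall u, (forall s, ~~ (f s \subset suppm u)) -> (z set0)@_u = 0) ->
  exists y, forall S, #|S| = k -> z S = tdel y S.
Proof.
move=> hz h0.
suff [y hy] : exists y, forall S u, #|S| = k -> True -> (z S)@_u = (tdel y S)@_u.
  by exists y => S Sk; apply/mpolyP => u; apply: hy.
apply: tdel_lift => w.
case: (pickP (fun s => f s \subset suppm w)) => [b bw|nob].
  have tog S : b \notin S ->
      (S \in [set S | tsupp S \subset suppm w]) = (b |: S \in [set S | tsupp S \subset suppm w]).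
    by move=> _; rewrite !inE tsuppU1 subUset bw.
  have [S|y hy] := chain_contract (ksignP A) tog (k := k)
      (z := fun S => (z S)@_(w - mset (tsupp S))).
    rewrite inE => Sw Sk; have := congr1 (mcoeff (w - mset (tsupp S))) (hz S Sk).
    rewrite mcoeff0 tdel_coef // => E; rewrite -[RHS]E.
    by apply: eq_bigl => s; rewrite inE.
  exists y => S Sw Sk _; rewrite hy ?inE //.
  by apply: eq_bigl => s; rewrite inE.
exists (fun=> 0) => S SX Sk _; rewrite big1; last by move=> s _; rewrite mulr0.
have S0 : S = set0.
  apply/setP => s; rewrite in_set0; apply/negP => sS; move: SX => /bigcupsP/(_ s sS).
  by rewrite nob.
rewrite S0 h0 //; first by rewrite -Sk S0 cards0.
move=> s; rewrite -[_ \subset _]negbK negbK; apply/negP => h.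
have := nob s; rewrite (_ : _ \subset _) //; apply: subset_trans h _.
by apply/subsetP => v; rewrite !inE mnmBE; apply: contraNneq => ->.
Qed.

End Taylor.

Section StanleyReisnerIdeal.
Variables (V : finType) (G : {set {set V}}).
Hypothesis hG : simplicial_complex G.
Notation n := #|V|.
Notation R := {mpoly rat[n]}.

Definition nonface_set (S : {S : {set V} | S \notin G}) : {set V} := val S.

(** A monomial ideal is determined coefficientwise. The multipliers of the generators are produced
    by exactness of the Taylor complex in degree 0. *)
Lemma sr_idealP (p : R) : sr_ideal G p <-> forall u, suppm u \in G -> p@_u = 0.
Proof.
split=> [[c ->] u uG|h].
  rewrite raddf_sum big1 //= => S SG; rewrite sr_monomialE mulrC mcoeffXM mset_le.
  case: ifP => // Su; case: hG => _ dG.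
  by move: SG; rewrite (dG _ _ uG Su).
have [//|_ u hu|y hy] := @taylor_exact _ _ nonface_set 0 (fun=> p).
  apply: h; apply/negPn/negP => uG.
  by have := hu (exist (fun S => S \notin G) _ uG); rewrite /nonface_set /= subxx.
have /= -> := hy set0 (cards0 _).
pose c (S : {set V}) : R := if insub S is Some s then ksign s (s |: set0) *: y (s |: set0) else 0.
exists c; rewrite (big_sub (fun S => S \notin G) (fun S => c S * sr_monomial S)) /tdel /=.
apply: eq_big => [s|s _]; first by rewrite inE.
rewrite /c valK sr_monomialE /tcoef /tsupp big_set0 setD0 -scalerAl -scalerAl mulrC.
by [].
Qed.

Lemma sr_ideal0 : sr_ideal G (0 : R).
Proof. by apply/sr_idealP => u _; rewrite mcoeff0. Qed.

Lemma sr_idealD (p q : R) : sr_ideal G p -> sr_ideal G q -> sr_ideal G (p + q).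
Proof.
by rewrite !sr_idealP => hp hq u uG; rewrite mcoeffD hp // hq // addr0.
Qed.

Lemma sr_idealM (p q : R) : sr_ideal G q -> sr_ideal G (p * q).
Proof.
move=> [c ->]; exists (fun S => p * c S); rewrite mulr_sumr.
by apply: eq_bigr => S _; rewrite mulrA.
Qed.

Section TaylorResolution.
Notation A := {S : {set V} | S \notin G}.
Notation f := nonface_set.

Definition tcells (i : nat) : {set {set A}} := [set S : {set A} | #|S| == i].

Definition tdif i : 'M[R]_(#|tcells i.+1|, #|tcells i|) :=
  \matrix_(a, b) \sum_(s | (s \notin (enum_val b : {set A})) && (s |: enum_val b == enum_val a))
     tcoef f s (enum_val b).

Definition trow (i : nat) (z : {set A} -> R) : 'rV[R]_#|tcells i| :=
  \row_a z (enum_val a).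

Lemma trow_onto i (r : 'rV_#|tcells i|) : exists z, trow i z = r.
Proof.
exists (fun S => \sum_(a | enum_val a == S) r 0 a).
apply/rowP => a; rewrite mxE (bigD1 a) //= big1 ?addr0 // => b /andP[/eqP].
by move/enum_val_inj => ->; rewrite eqxx.
Qed.

Lemma trow_eqP i (y z : {set A} -> R) :
  (forall S : {set A}, #|S| = i -> y S = z S) <-> trow i y = trow i z.
Proof.
split=> [h|/rowP h S Si].
  by apply/rowP => a; rewrite !mxE; have := enum_valP a; rewrite inE => /eqP; apply: h.
have SC : S \in tcells i by rewrite inE Si.
by have := h (enum_rank_in SC S); rewrite !mxE enum_rankK_in.
Qed.

Lemma trow_tdel i z : trow i (tdel f z) = trow i.+1 z *m tdif i.
Proof.
apply/rowP => b; rewrite !mxE; set S := enum_val b.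
have := enum_valP b; rewrite inE -/S => /eqP Si.
under [RHS]eq_bigr do rewrite !mxE mulr_sumr.
rewrite (exchange_big_dep (fun s => s \notin S)) /=; last by move=> a s _ /andP[].
apply: eq_bigr => s sS.
have SC : s |: S \in tcells i.+1 by rewrite inE cardsU1 sS Si.
rewrite (big_pred1 (enum_rank_in SC (s |: S))) => [|a].
  by rewrite enum_rankK_in // [RHS]mulrC.
rewrite sS /=; apply/eqP/eqP => [E|->]; last by rewrite enum_rankK_in.
by apply: enum_val_inj; rewrite enum_rankK_in.
Qed.

Definition tgdeg i (a : 'I_#|tcells i|) : nat := (2 * #|tsupp f (enum_val a)|)%N.

Lemma card_tcell i (a : 'I_#|tcells i|) : #|enum_val a : {set A}| = i.
Proof. by have := enum_valP a; rewrite inE => /eqP. Qed.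

Lemma tdif_homog i (a : 'I_#|tcells i.+1|) (b : 'I_#|tcells i|) mon :
  mon \in msupp (tdif i a b) -> tgdeg a = (2 * mdeg mon + tgdeg b)%N.
Proof.
rewrite mcoeff_msupp mxE raddf_sum /= => nz.
have [s /andP[sb /eqP Es] ms] : exists2 s : A,
    (s \notin (enum_val b : {set A})) && (s |: enum_val b == enum_val a) &
    mon = mset (f s :\: tsupp f (enum_val b)).
  case: (pickP (fun s => [&& s \notin (enum_val b : {set A}), s |: enum_val b == enum_val a &
     (mon == mset (f s :\: tsupp f (enum_val b)))])) => [s /and3P[h1 h2 /eqP h3]|none].
    by exists s => //; rewrite h1.
  move: nz; rewrite big1 ?eqxx // => s hs; rewrite /tcoef mcoeffZ mcoeffX.
  by have := none s; rewrite andbA hs eq_sym /= => ->; rewrite mulr0.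
rewrite /tgdeg -Es tsuppU1 ms mdeg_mset -mulnDr; congr (2 * _)%N.
rewrite -cardsUI (_ : _ :&: _ = set0) ?cards0 ?addn0.
  by apply: eq_card => v; rewrite !inE; do 2 case: (v \in _).
by apply/setP => v; rewrite !inE; do 2 case: (v \in _).
Qed.

Definition taug : 'cV[R]_#|tcells 0| := const_mx 1.

Lemma taug_homog (a : 'I_#|tcells 0|) mon : mon \in msupp (taug a 0) ->
  tgdeg a = (2 * mdeg mon)%N.
Proof.
rewrite mxE msupp1 inE => /eqP ->; rewrite mdeg0 /tgdeg.
by rewrite (cards0_eq (card_tcell a)) /tsupp big_set0 cards0.
Qed.

Lemma trow_aug z : (trow 0 z *m taug) 0 0 = z set0.
Proof.
have S0 : set0 \in tcells 0 by rewrite inE cards0.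
rewrite mxE (bigD1 (enum_rank_in S0 set0)) //= big1 ?addr0; last first.
  move=> a /eqP[]; apply: enum_val_inj; rewrite enum_rankK_in //.
  exact/cards0_eq/card_tcell.
by rewrite !mxE enum_rankK_in // mulr1.
Qed.

Lemma taug_surj (p : R) : exists w : 'rV_#|tcells 0|, sr_ideal G (p - (w *m taug) 0 0).
Proof. by exists (trow 0 (fun=> p)); rewrite trow_aug subrr; apply: sr_ideal0. Qed.

Lemma taylor_exact_0 (w : 'rV_#|tcells 0|) :
  sr_ideal G ((w *m taug) 0 0) <-> exists u : 'rV_#|tcells 1|, w = u *m tdif 0.
Proof.
have [z <-] := trow_onto w; rewrite trow_aug; split=> [/sr_idealP h|[u]].
  have [//|_ u hu|y hy] := @taylor_exact _ _ f 0 z.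
    apply: h; apply/negPn/negP => uG.
    by have := hu (exist (fun S => S \notin G) _ uG); rewrite /f /= subxx.
  by exists (trow 1 y); rewrite -trow_tdel; apply/trow_eqP.
have [y <-] := trow_onto u; rewrite -trow_tdel => /trow_eqP -> ; last by rewrite cards0.
apply/sr_idealP => v vG; rewrite raddf_sum big1 // => s _.
rewrite -scalerAl /= mcoeffZ mcoeffXM /tsupp big_set0 setD0 mset_le.
case: ifP => [sv|_]; last by rewrite mulr0.
by case: hG => _ dG; have := valP s; rewrite (dG _ _ vG sv).
Qed.

Lemma taylor_exact_S i (w : 'rV_#|tcells i.+1|) :
  w *m tdif i = 0 <-> exists u : 'rV_#|tcells i.+2|, w = u *m tdif i.+1.
Proof.
have z0 k : trow k (fun=> 0) = 0 by apply/rowP => a; rewrite !mxE.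
have [z <-] := trow_onto w; split=> [|[u]].
  rewrite -trow_tdel -z0 => /trow_eqP h.
  have [S [Si]||y hy] := @taylor_exact _ _ f i.+1 z; [exact: h|by []|].
  by exists (trow i.+2 y); rewrite -trow_tdel; apply/trow_eqP.
have [y <-] := trow_onto u; rewrite -trow_tdel => ->; rewrite -trow_tdel -z0.
by apply/trow_eqP => S _; apply: tdel_tdel.
Qed.

(** Built on all nonfaces, in accordance with [sr_ideal], and so in general far from minimal; it
    only has to exist. *)
Definition taylor_resolution : graded_free_resolution (sr_ideal G) :=
  @GFRes _ _ (fun i => #|tcells i|) tgdeg tdif taug tdif_homog taug_homog
    taug_surj taylor_exact_0 taylor_exact_S.

End TaylorResolution.
End StanleyReisnerIdeal.

(** * Koszul homology and Tor *)

Section Projections.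
Variable n : nat.
Notation R := {mpoly rat[n]}.
Implicit Types (p q : R) (u : 'X_{1..n}).

(* The part of p sitting in internal degree e when multiplied by a generator of
   degree c. *)
Definition mproj (c e : nat) p : R :=
  \sum_(u <- msupp p | (2 * mdeg u + c)%N == e) p@_u *: 'X_[u].

Lemma mcoeff_mproj c e p u :
  (mproj c e p)@_u = if (2 * mdeg u + c)%N == e then p@_u else 0.
Proof.
rewrite /mproj raddf_sum /=.
case: (boolP (u \in msupp p)) => up; last first.
  rewrite memN_msupp_eq0 // if_same big_seq_cond big1 // => v /andP[vp _].
  by rewrite mcoeffZ mcoeffX; case: eqP => [E|]; [move: up; rewrite -E vp|rewrite mulr0].
rewrite big_mkcond (bigD1_seq u) //= big1 ?addr0; last first.
  by move=> v /negPf vu; case: ifP => // _; rewrite mcoeffZ mcoeffX vu mulr0.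
by case: ifP => _; rewrite ?mcoeff0 ?mcoeffZ ?mcoeffX ?eqxx ?mulr1.
Qed.

Lemma mproj_id c e p : mproj c e (mproj c e p) = mproj c e p.
Proof. by apply/mpolyP => u; rewrite !mcoeff_mproj; case: ifP => // ->. Qed.

Lemma mprojD c e p q : mproj c e (p + q) = mproj c e p + mproj c e q.
Proof.
by apply/mpolyP => u; rewrite mcoeffD !mcoeff_mproj mcoeffD; case: (_ == e); rewrite ?addr0.
Qed.

Lemma mprojB c e p q : mproj c e (p - q) = mproj c e p - mproj c e q.
Proof.
by apply/mpolyP => u; rewrite mcoeffB !mcoeff_mproj mcoeffB; case: (_ == e); rewrite ?subr0.
Qed.

Lemma mproj0 c e : mproj c e 0 = 0.
Proof. by apply/mpolyP => u; rewrite mcoeff_mproj mcoeff0 if_same. Qed.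

Lemma mproj_sum c e (I : Type) (r : seq I) (P : pred I) (F : I -> R) :
  mproj c e (\sum_(i <- r | P i) F i) = \sum_(i <- r | P i) mproj c e (F i).
Proof. exact: (big_morph _ (mprojD c e) (mproj0 c e)). Qed.

Lemma mproj_mul c c' e p q :
  (forall u, u \in msupp q -> c' = (2 * mdeg u + c)%N) ->
  mproj c e (p * q) = mproj c' e p * q.
Proof.
move=> hq; apply/mpolyP => u; rewrite mcoeff_mproj !mcoeffM.
case: ifP => he; last first.
  rewrite big1 // => -[k l] /= /eqP E; rewrite mcoeff_mproj.
  case: (boolP ((l : 'X_{1..n}) \in msupp q)) => lq; last by rewrite [q@_l]memN_msupp_eq0 ?mulr0.
  by rewrite (hq _ lq) addnA -mulnDr -mdegD -E he mul0r.
apply: eq_bigr => -[k l] /= /eqP E; rewrite mcoeff_mproj.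
case: (boolP ((l : 'X_{1..n}) \in msupp q)) => lq; last by rewrite [q@_l]memN_msupp_eq0 ?mulr0.
by rewrite (hq _ lq) addnA -mulnDr -mdegD -E he.
Qed.

Lemma mproj_scale c e (a : rat) p : mproj c e (a%:MP * p) = a%:MP * mproj c e p.
Proof.
rewrite [a%:MP * p]mulrC [a%:MP * mproj c e p]mulrC; apply: mproj_mul => u.
by rewrite msuppC; case: ifP => // _; rewrite inE => /eqP ->; rewrite mdeg0.
Qed.

Definition rproj r (gd : 'I_r -> nat) (c e : nat) (w : 'rV[R]_r) : 'rV[R]_r :=
  \row_b mproj (c + gd b) e (w 0 b).

Section Row.
Variables (r : nat) (gd : 'I_r -> nat).
Implicit Type w : 'rV[R]_r.

Lemma rproj_id c e w : rproj gd c e (rproj gd c e w) = rproj gd c e w.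
Proof. by apply/rowP => b; rewrite !mxE mproj_id. Qed.

Lemma rprojD c e w v : rproj gd c e (w + v) = rproj gd c e w + rproj gd c e v.
Proof. by apply/rowP => b; rewrite !mxE mprojD. Qed.

Lemma rprojB c e w v : rproj gd c e (w - v) = rproj gd c e w - rproj gd c e v.
Proof. by apply/rowP => b; rewrite !mxE mprojB. Qed.

Lemma rproj0 c e : rproj gd c e 0 = 0.
Proof. by apply/rowP => b; rewrite !mxE mproj0. Qed.

Lemma rproj_sum c e (I : Type) (s : seq I) (P : pred I) (F : I -> 'rV[R]_r) :
  rproj gd c e (\sum_(i <- s | P i) F i) = \sum_(i <- s | P i) rproj gd c e (F i).
Proof. exact: (big_morph _ (rprojD c e) (rproj0 c e)). Qed.

Lemma rproj_scale c e (a : rat) w : rproj gd c e (a%:MP *: w) = a%:MP *: rproj gd c e w.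
Proof. by apply/rowP => b; rewrite !mxE mproj_scale. Qed.

Lemma rproj_mulX c c' e p w :
  (forall u, u \in msupp p -> c' = (2 * mdeg u + c)%N) ->
  rproj gd c e (p *: w) = p *: rproj gd c' e w.
Proof.
move=> hp; apply/rowP => b; rewrite !mxE [p * w 0 b]mulrC [p * mproj _ _ _]mulrC; apply: mproj_mul.
by move=> u /hp ->; rewrite addnA.
Qed.

Lemma rproj_mulmx r' (gd' : 'I_r' -> nat) (M : 'M[R]_(r, r')) c e w :
  (forall a b u, u \in msupp (M a b) -> gd a = (2 * mdeg u + gd' b)%N) ->
  rproj gd' c e (w *m M) = rproj gd c e w *m M.
Proof.
move=> hM; apply/rowP => b; rewrite !mxE mproj_sum; apply: eq_bigr => a _.
rewrite mxE; apply: mproj_mul => u /hM ->; by rewrite addnCA.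
Qed.

End Row.
End Projections.

Section Koszul.
Variable V : finType.
Notation n := #|V|.
Notation R := {mpoly rat[n]}.
Implicit Types (S : {set V}).

Definition kos (v : V) : {set V} := [set v].

Lemma tsupp_kos S : tsupp kos S = S.
Proof. by apply/setP => v; apply/bigcupP/idP => [[w wS /set1P ->]|vS] //; exists v; rewrite ?inE. Qed.

Definition kdel r (z : {set V} -> 'rV[R]_r) S : 'rV[R]_r :=
  \sum_(v | v \notin S) tcoef kos v S *: z (v |: S).

Lemma kdel_entry r (z : {set V} -> 'rV[R]_r) S b :
  kdel z S 0 b = tdel kos (fun S => z S 0 b) S.
Proof. by rewrite summxE; apply: eq_bigr => v _; rewrite mxE. Qed.

Lemma kdelD r (y z : {set V} -> 'rV[R]_r) S : kdel (fun S => y S + z S) S = kdel y S + kdel z S.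
Proof. by rewrite /kdel -big_split; apply: eq_bigr => v _; rewrite scalerDr. Qed.

Lemma kdelB r (y z : {set V} -> 'rV[R]_r) S : kdel (fun S => y S - z S) S = kdel y S - kdel z S.
Proof. by rewrite /kdel -sumrB; apply: eq_bigr => v _; rewrite scalerBr. Qed.

Lemma kdelZ r (a : R) (z : {set V} -> 'rV[R]_r) S : kdel (fun S => a *: z S) S = a *: kdel z S.
Proof. by rewrite /kdel scaler_sumr; apply: eq_bigr => v _; rewrite !scalerA mulrC. Qed.

Lemma kdel0 r S : kdel (fun=> 0 : 'rV[R]_r) S = 0.
Proof. by rewrite /kdel big1 // => v _; rewrite scaler0. Qed.

Lemma eq_kdel r (y z : {set V} -> 'rV[R]_r) S :
  (forall S' : {set V}, #|S'| = #|S|.+1 -> y S' = z S') -> kdel y S = kdel z S.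
Proof. by move=> h; apply: eq_bigr => v vS; rewrite h // cardsU1 vS. Qed.

Lemma kdelK r (z : {set V} -> 'rV[R]_r) S : kdel (kdel z) S = 0.
Proof.
apply/rowP => b; rewrite kdel_entry [RHS]mxE -[RHS](tdel_tdel kos (fun S => z S 0 b) S).
by apply: eq_bigr => v _; rewrite kdel_entry.
Qed.

Lemma kdel_mulmx r r' (M : 'M[R]_(r, r')) (z : {set V} -> 'rV[R]_r) S :
  kdel (fun S => z S *m M) S = kdel z S *m M.
Proof. by rewrite /kdel mulmx_suml; apply: eq_bigr => v _; rewrite scalemxAl. Qed.

Lemma kdel_const r (z : {set V} -> 'rV[R]_r) b : (kdel z set0 0 b)@_0 = 0.
Proof.
rewrite kdel_entry /tdel raddf_sum big1 // => v _.
rewrite /= rmorphM /= /tcoef mcoeffZ mcoeffX /tsupp big_set0 setD0.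
case: eqP => [/(congr1 (@suppm V))|_]; last by rewrite mulr0 mul0r.
by rewrite suppm_mset => /setP/(_ v); rewrite !inE eqxx mnm0E.
Qed.

(** In positive degrees the Koszul complex of R^r is exact; in degree 0 its homology is Q^r, seen
    through constant coefficients, which explains the second hypothesis. *)
Lemma kdel_exact r k (z : {set V} -> 'rV[R]_r) :
  (forall S : {set V}, #|S|.+1 = k -> kdel z S = 0) ->
  (k = 0%N -> forall b, (z set0 0 b)@_0 = 0) ->
  exists y : {set V} -> 'rV[R]_r, forall S : {set V}, #|S| = k -> z S = kdel y S.
Proof.
move=> hz h0.
have /dep_choice[y hy] b : exists y, forall S : {set V}, #|S| = k -> z S 0 b = tdel kos y S.
  apply: taylor_exact => [S Sk|k0 u hu].
    by have /rowP/(_ b) := hz S Sk; rewrite kdel_entry mxE.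
  rewrite (_ : u = 0%MM) ?h0 //; apply: mnmVP => v; rewrite mnm0E.
  by have := hu v; rewrite sub1set inE negbK => /eqP.
exists (fun S => \row_b y b S) => S Sk; apply/rowP => b; rewrite hy // kdel_entry.
by apply: eq_bigr => v _; rewrite mxE.
Qed.

Notation chains r := {ffun {set V} -> 'rV[R]_r}.

Definition kproj r (gd : 'I_r -> nat) e (z : chains r) : chains r :=
  [ffun S : {set V} => rproj gd (2 * #|S|) e (z S)].

Lemma rproj_kdel r (gd : 'I_r -> nat) e (z : chains r) S :
  rproj gd (2 * #|S|) e (kdel z S) = kdel (kproj gd e z) S.
Proof.
rewrite rproj_sum; apply: eq_bigr => v vS; rewrite ffunE; apply: rproj_mulX => u.
rewrite cardsU1 vS /tcoef => /msuppZ_le; rewrite msuppX inE => /eqP ->.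
rewrite mdeg_mset tsupp_kos /kos (_ : [set v] :\: S = [set v]) ?cards1 ?mulnDr //.
by apply/setP => w; rewrite !inE; case: eqP => [->|]; rewrite ?vS ?andbF.
Qed.

Lemma kprojD r (gd : 'I_r -> nat) e (y z : chains r) : kproj gd e (y + z) = kproj gd e y + kproj gd e z.
Proof. by apply/ffunP => S; rewrite !ffunE rprojD. Qed.

Lemma kprojZ r (gd : 'I_r -> nat) e a (z : chains r) : kproj gd e (a%:MP *: z) = a%:MP *: kproj gd e z.
Proof. by apply/ffunP => S; rewrite !ffunE rproj_scale. Qed.

Lemma kproj_id r (gd : 'I_r -> nat) e (z : chains r) : kproj gd e (kproj gd e z) = kproj gd e z.
Proof. by apply/ffunP => S; rewrite !ffunE rproj_id. Qed.

Lemma kproj0 r (gd : 'I_r -> nat) e : kproj gd e 0 = 0.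
Proof. by apply/ffunP => S; rewrite !ffunE rproj0. Qed.

(* Cycles and boundaries, in Koszul degree q, of the Koszul complex with
   coefficients in R^r / N. *)
Definition kcyc r (N : 'rV[R]_r -> Prop) (q : nat) (z : chains r) : Prop :=
  forall S : {set V}, #|S|.+1 = q -> N (kdel z S).

Definition kbd r (N : 'rV[R]_r -> Prop) (q : nat) (z : chains r) : Prop :=
  exists y : chains r, forall S : {set V}, #|S| = q -> N (z S - kdel y S).

(* Replaces [kcyc N' q] when N' is the kernel of M; the two agree for q > 0. *)
Definition kstep r r' (M : 'M[R]_(r', r)) (q : nat) (z : chains r') : Prop :=
  exists y : chains r, forall S : {set V}, #|S| = q -> z S *m M = kdel y S.

Definition mC : {rmorphism rat -> R} := @mpolyC n rat.

Definition rsub r (N : 'rV[R]_r -> Prop) : Prop :=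
  [/\ N 0, forall x y, N x -> N y -> N (x + y) & forall a x, N x -> N (a *: x)].

Lemma rsubB r (N : 'rV[R]_r -> Prop) x y : rsub N -> N x -> N y -> N (x - y).
Proof. by move=> [_ ND NZ] Nx Ny; rewrite -[- y]scaleN1r; apply: ND => //; apply: NZ. Qed.

Lemma rsub_sum r (N : 'rV[R]_r -> Prop) (I : finType) (P : pred I) (F : I -> 'rV[R]_r) :
  rsub N -> (forall i, P i -> N (F i)) -> N (\sum_(i | P i) F i).
Proof. by move=> [N0 ND _] h; elim/big_ind: _. Qed.

Lemma subsp_kcyc r (N : 'rV[R]_r -> Prop) (gd : 'I_r -> nat) q e : rsub N ->
  subsp mC (fun z => kcyc N q (kproj gd e z)).
Proof.
move=> [N0 ND NZ]; split=> [|y z hy hz S Sq|a z hz S Sq].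
- by move=> S Sq; rewrite kproj0 (eq_kdel (z := fun=> 0)) ?kdel0 // => S' _; rewrite ffunE.
- rewrite kprojD (eq_kdel (z := fun S => kproj gd e y S + kproj gd e z S)).
    by rewrite kdelD; apply: ND; [apply: hy|apply: hz].
  by move=> S' _; rewrite ffunE.
- rewrite /= kprojZ (eq_kdel (z := fun S => a%:MP *: kproj gd e z S)).
    by rewrite kdelZ; apply/NZ/hz.
  by move=> S' _; rewrite ffunE.
Qed.

Lemma subsp_kbd r (N : 'rV[R]_r -> Prop) (gd : 'I_r -> nat) q e : rsub N ->
  subsp mC (fun z => kbd N q (kproj gd e z)).
Proof.
move=> [N0 ND NZ]; split=> [|y z [y' hy] [z' hz]|a z [z' hz]].
- exists 0 => S Sq; rewrite kproj0 (eq_kdel (z := fun=> 0)); last by move=> S' _; rewrite ffunE.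
  by rewrite kdel0 ffunE subrr.
- exists (y' + z') => S Sq.
  rewrite kprojD (eq_kdel (z := fun S => y' S + z' S)); last by move=> S' _; rewrite ffunE.
  by rewrite kdelD ffunE opprD addrACA; apply: ND; [apply: hy|apply: hz].
- exists (a%:MP *: z') => S Sq; rewrite /= kprojZ.
  rewrite (eq_kdel (z := fun S => a%:MP *: z' S)); last by move=> S' _; rewrite ffunE.
  by rewrite kdelZ ffunE -scalerBr; apply/NZ/hz.
Qed.

Section Step.
Variables (r r' : nat) (M : 'M[R]_(r', r)) (N : 'rV[R]_r -> Prop).
Variables (gd : 'I_r -> nat) (gd' : 'I_r' -> nat).
Hypothesis hN : forall w, N w <-> exists u, w = u *m M.
Hypothesis hM : forall a b u, u \in msupp (M a b) -> gd' a = (2 * mdeg u + gd b)%N.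
Notation N' := (fun u : 'rV[R]_r' => u *m M = 0).

Lemma rsub_im : rsub N.
Proof.
split=> [|x y /hN[u ->] /hN[v ->]|a x /hN[u ->]]; apply/hN.
- by exists 0; rewrite mul0mx.
- by exists (u + v); rewrite mulmxDl.
- by exists (a *: u); rewrite scalemxAl.
Qed.

Lemma kproj_mulmx e (z : chains r') S :
  rproj gd (2 * #|S|) e (z S *m M) = kproj gd' e z S *m M.
Proof. by rewrite ffunE; apply: rproj_mulmx. Qed.

Lemma subsp_kstep q e : subsp mC (fun z => kstep M q (kproj gd' e z)).
Proof.
split=> [|y z [y' hy] [z' hz]|a z [z' hz]].
- exists 0 => S Sq; rewrite kproj0 ffunE mul0mx (eq_kdel (z := fun=> 0)) ?kdel0 //.
  by move=> S' _; rewrite ffunE.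
- exists (y' + z') => S Sq; rewrite kprojD ffunE mulmxDl hy // hz // -kdelD.
  by apply: eq_kdel => S' _; rewrite ffunE.
- exists (a%:MP *: z') => S Sq; rewrite /= kprojZ ffunE -scalemxAl hz // -kdelZ.
  by apply: eq_kdel => S' _; rewrite ffunE.
Qed.

(* The connecting map of 0 -> R^r' / N' -> R^r -> R^r / N -> 0. *)
Definition step_rel (q : nat) (z : chains r) (z' : chains r') : Prop :=
  forall S : {set V}, #|S| = q -> kdel z S = z' S *m M.

(** M identifies R^r' / N' with N, and R^r has no Koszul homology in degree q + 1. Hence the
    homology of R^r / N in degree q + 1 is the kernel of the map from the degree q homology of R^r'
    / N' to that of R^r, and [kstep] describes this kernel. For q = 0 it is a proper condition on
    constant coefficients, namely the one that Tor imposes. *)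
Lemma step_iso q :
  subq_iso mC mC (step_rel q) (kcyc N q.+1) (kbd N q.+1) (kstep M q) (kbd N' q).
Proof.
split.
- split.
  + move=> S _; rewrite ffunE mul0mx (eq_kdel (z := fun=> 0)) ?kdel0 // => S' _.
    by rewrite ffunE.
  + move=> x y x' y' hx hy S Sq; rewrite ffunE mulmxDl -hx // -hy // -kdelD.
    by apply: eq_kdel => S' _; rewrite ffunE.
  + move=> c x x' hx S Sq; rewrite /= ffunE -scalemxAl -hx // -kdelZ.
    by apply: eq_kdel => S' _; rewrite ffunE.
- move=> z hz.
  have /dep_choice[u hu] (S : {set V}) : exists u, #|S| = q -> kdel z S = u *m M.
    have [Sq|nq] := eqVneq #|S| q; last by exists 0 => E; rewrite E eqxx in nq.
    have /hN[u ->] : N (kdel z S) by apply: hz; rewrite Sq.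
    by exists u.
  have L : step_rel q z [ffun S => u S] by move=> S Sq; rewrite ffunE hu.
  by exists [ffun S => u S]; split=> //; exists z => S Sq; rewrite L.
- move=> z' [z hz]; exists z; split=> [S [Sq]|S Sq]; last by rewrite hz.
  by apply/hN; exists (z' S); rewrite hz.
- move=> z z' hz hz' L; split=> -[y hy].
  + have /dep_choice[u hu] (S : {set V}) : exists u, #|S| = q.+1 -> z S - kdel y S = u *m M.
      have [Sq|nq] := eqVneq #|S| q.+1; last by exists 0 => E; rewrite E eqxx in nq.
      by have /hN[u ->] := hy S Sq; exists u.
    exists [ffun S => u S] => S Sq.
    rewrite mulmxBl -L // -kdel_mulmx -kdelB.
    rewrite (eq_kdel (z := kdel y)) ?kdelK // => S'; rewrite Sq => Sq'.
    by rewrite ffunE -hu // opprB addrC subrK.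
  (* Corrected by the image of y, z becomes a true cycle of the free module in positive degree, so
     it is a boundary there. *)
  + pose t (S : {set V}) := z S - y S *m M.
    have [S [Sq]||x hx] := @kdel_exact r q.+1 t.
    * by rewrite kdelB kdel_mulmx L // -mulmxBl hy.
    * by [].
    exists [ffun S => x S] => S Sq; apply/hN; exists (y S).
    rewrite (eq_kdel (z := x)); last by move=> S' _; rewrite ffunE.
    by rewrite -hx // /t opprB addrC subrK.
Qed.

Lemma kstep_kcyc q (z : chains r') : (0 < q)%N -> kstep M q z <-> kcyc N' q z.
Proof.
move=> q0; split=> [[y hy] S Sq|hz].
  rewrite -kdel_mulmx (eq_kdel (z := kdel y)) ?kdelK // => S' Sq'.
  by apply: hy; rewrite Sq' Sq.
have [S Sq||y hy] := @kdel_exact r q (fun S => z S *m M).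
- by rewrite kdel_mulmx hz.
- by move=> q1; rewrite q1 in q0.
by exists [ffun S => y S] => S Sq; rewrite hy //; apply: eq_kdel => S' _; rewrite ffunE.
Qed.

Lemma step_graded q e d :
  qdim mC (fun z => kstep M q (kproj gd' e z)) (fun z => kbd N' q (kproj gd' e z)) d ->
  qdim mC (fun z => kcyc N q.+1 (kproj gd e z)) (fun z => kbd N q.+1 (kproj gd e z)) d.
Proof.
have [[L0 LD LZ] _ _ _] := step_iso q.
apply: qdim_transport_sym (subq_iso_graded (p := kproj gd e) (p' := kproj gd' e) _ _ _ _ _ _ (step_iso q)).
- exact/subsp_kcyc/rsub_im.
- exact: subsp_kstep.
- split=> [|x y x' y' hx hy|c x x' hx]; rewrite ?kproj0 ?kprojD ?kprojZ //; [exact: LD|exact: LZ].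
- exact: kproj_id.
- exact: kproj_id.
- move=> z hz S Sq; rewrite -rproj_kdel; have /hN[u ->] := hz S Sq.
  by apply/hN; exists (rproj gd' (2 * #|S|) e u); apply: rproj_mulmx.
- move=> z' [z hz]; exists (kproj gd e z) => S Sq.
  by rewrite -kproj_mulmx hz // rproj_kdel.
- by move=> z z' L S Sq; rewrite -rproj_kdel L // kproj_mulmx.
Qed.

End Step.

End Koszul.

(** * Tor of an arbitrary resolution as Koszul homology *)

Section TorDim.
Variables (V : finType) (I : {mpoly rat[#|V|]} -> Prop) (F : graded_free_resolution I).
Notation n := #|V|.
Notation R := {mpoly rat[n]}.
Notation chains r := {ffun {set V} -> 'rV[R]_r}.
Notation gd := (@gdeg _ _ F _).

(* The quotient of R^(rk F p) by kerF p is the p-th syzygy module of R / I. *)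
Definition kerF (p : nat) : 'rV[R]_(rk F p) -> Prop :=
  match p with
  | 0 => fun w => I ((w *m aug F) 0 0)
  | p'.+1 => fun w => w *m dif F p' = 0
  end.

Lemma kerF_im p w : kerF w <-> exists u, w = u *m dif F p.
Proof. by case: p w => [|p] w; [exact: exact_0|exact: exact_S]. Qed.

Lemma dif_dif p : dif F p.+1 *m dif F p = 0.
Proof.
apply/row_matrixP => a; rewrite row0 row_mul; apply/exact_S.
by exists (delta_mx 0 a); rewrite rowE.
Qed.

Lemma dif_hom p a b u : u \in msupp (dif F p a b) -> gd a = (2 * mdeg u + gd b)%N.
Proof. exact: dif_homog. Qed.

(** This is the internal degree e part of the q-th Koszul homology of the p-th syzygy module. *)
Definition syz_dim (q p e d : nat) : Prop :=
  qdim (mC V) (fun z => kcyc (@kerF p) q (kproj gd e z))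
    (fun z => kbd (@kerF p) q (kproj gd e z)) d.

Lemma syz_shift q p e d : (0 < q)%N -> syz_dim q p.+1 e d -> syz_dim q.+1 p e d.
Proof.
move=> q0 h; apply: (step_graded (@kerF_im p) (@dif_hom p)).
by apply: qdim_ext h => z //; apply: iff_sym; apply: kstep_kcyc.
Qed.

Lemma syz_shifts k p e d : syz_dim k.+1 p e d -> syz_dim (k + p).+1 0 e d.
Proof.
elim: p k => [|p IH] k; first by rewrite addn0.
by move=> h; rewrite addnS -addSn; apply: IH; apply: syz_shift.
Qed.

(** The image of w in the degree e part of F_p tensored with the residue field. *)
Definition crow p e (w : 'rV[R]_(rk F p)) : 'rV[rat]_#|gens F p e| :=
  \row_a (w 0 (enum_val a))@_0%MM.

Lemma crow_lin p e (a : rat) (w v : 'rV[R]_(rk F p)) :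
  crow e (a%:MP *: w + v) = a *: crow e w + crow e v.
Proof. by apply/rowP => b; rewrite !mxE mcoeffD mcoeffCM. Qed.

Lemma crow0 p e : crow e (0 : 'rV[R]_(rk F p)) = 0.
Proof. by apply/rowP => b; rewrite !mxE mcoeff0. Qed.

Lemma crowB p e (w v : 'rV[R]_(rk F p)) : crow e (w - v) = crow e w - crow e v.
Proof. by apply/rowP => b; rewrite !mxE mcoeffB. Qed.

Lemma crow_onto p e (c : 'rV_#|gens F p e|) : exists w, crow e w = c.
Proof.
exists (\row_a \sum_(k | enum_val k == a) (c 0 k)%:MP).
apply/rowP => b; rewrite !mxE (bigD1 b) //= big1 ?addr0; last first.
  by move=> k /andP[/eqP/enum_val_inj ->]; rewrite eqxx.
by rewrite mcoeffC eqxx mulr1.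
Qed.

Lemma crow_mul p e (w : 'rV[R]_(rk F p.+1)) :
  crow e (w *m dif F p) = crow e w *m tor_dif F p e.
Proof.
apply/rowP => b; rewrite !mxE raddf_sum /=.
have := enum_valP b; rewrite inE => /eqP gb.
rewrite (bigID (fun a => a \in gens F p.+1 e)) /= [X in _ + X]big1 ?addr0; last first.
  move=> a; rewrite inE => ga; rewrite rmorphM /=.
  rewrite [(dif F p a _)@_0]memN_msupp_eq0 ?mulr0 //.
  apply: contra ga => /dif_hom; rewrite mdeg0 muln0 add0n gb => ->; exact: eqxx.
rewrite big_enum_val /=; apply: eq_bigr => a _.
by rewrite !mxE rmorphM.
Qed.

Lemma rproj_const p e (w : 'rV[R]_(rk F p)) b :
  (rproj gd 0 e w 0 b)@_0%MM = if gd b == e then (w 0 b)@_0%MM else 0.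
Proof. by rewrite mxE mcoeff_mproj mdeg0 muln0. Qed.

Lemma crow_rproj p e (w : 'rV[R]_(rk F p)) : crow e (rproj gd 0 e w) = crow e w.
Proof.
by apply/rowP => b; rewrite [LHS]mxE rproj_const [RHS]mxE; have := enum_valP b; rewrite inE => ->.
Qed.

Lemma crow_eq0 p e (w : 'rV[R]_(rk F p)) :
  crow e w = 0 <-> forall b, (rproj gd 0 e w 0 b)@_0%MM = 0.
Proof.
split=> [/rowP h b|h]; last first.
  by apply/rowP => b; have := h (enum_val b); rewrite -crow_rproj !mxE.
rewrite rproj_const; case: eqP => // gb.
have bg : b \in gens F p e by rewrite inE gb.
by have := h (enum_rank_in bg b); rewrite !mxE enum_rankK_in.
Qed.

Lemma kproj_set0 p e (z : chains (rk F p)) : kproj gd e z set0 = rproj gd 0 e (z set0).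
Proof. by rewrite ffunE cards0. Qed.

Lemma const0_kdel r (w : 'rV[R]_r) : (forall b, (w 0 b)@_0%MM = 0) ->
  exists y : chains r, w = kdel y set0.
Proof.
move=> h; have [//||y hy] := @kdel_exact V r 0 (fun=> w); first by move=> _.
by exists [ffun S => y S]; rewrite (hy set0) ?cards0 //; apply: eq_kdel => S _; rewrite ffunE.
Qed.

(** Modulo Koszul boundaries a chain in degree 0 retains only its constant coefficients, and
    dividing by [kerF p], the image of the next differential, turns them into the cokernel of
    [tor_dif]. The cycle condition is left open as Z and [Zc]: it is void for p = 0 at the start of
    the resolution and is [kstep] otherwise. *)
Lemma tor_base p e d (Z : chains (rk F p) -> Prop) (Zc : 'rV_#|gens F p e| -> Prop) :
  subsp (mC V) Z -> subsp idfun Zc -> (forall z, Z z <-> Zc (crow e (z set0))) ->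
  qdim idfun Zc (fun c => exists u, c = u *m tor_dif F p e) d ->
  qdim (mC V) Z (fun z => kbd (@kerF p) 0 (kproj gd e z)) d.
Proof.
move=> sZ sZc ZZ; apply: (qdim_transport (L := fun (c : 'rV[rat]_#|gens F p e|) (z : chains (rk F p)) => crow e (z set0) = c)) => //.
split.
- split=> [|c c' z z' <- <-|a c z <-]; first by rewrite ffunE crow0.
    by rewrite ffunE -[z set0]scale1r -(rmorph1 (mC V)) crow_lin scale1r rmorph1 scale1r.
  by rewrite ffunE -[_ *: z set0]addr0 crow_lin crow0 addr0.
- move=> c hc; have [w hw] := crow_onto c; exists [ffun=> w]; rewrite ffunE; split=> //.
  by apply/ZZ; rewrite ffunE hw.
- by move=> z /ZZ hz; exists (crow e (z set0)).
- move=> c z hc hz cz; split=> [[u hu]|[y hy]].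
  + have [w hw] := crow_onto u.
    pose t := kproj gd e z set0 - rproj gd 0 e (w *m dif F p).
    have [b|y hy] := @const0_kdel _ t.
      have E : t = rproj gd 0 e (z set0 - w *m dif F p).
        by rewrite /t kproj_set0 rprojB.
      rewrite E; apply: (proj1 (crow_eq0 _ _)).
      by rewrite crowB crow_mul hw cz hu subrr.
    exists y => S /cards0_eq ->; rewrite -hy /t opprB addrC subrK.
    apply/kerF_im; exists (rproj gd 0 e w); apply: rproj_mulmx; exact: dif_hom.
  + have /kerF_im[u hu] := hy set0 (cards0 _).
    exists (crow e u); rewrite -crow_mul -hu crowB kproj_set0 crow_rproj cz.
    rewrite (_ : crow e (kdel y set0) = 0) ?subr0 //.
    by apply/rowP => b; rewrite !mxE kdel_const.
Qed.

Lemma tor_dim_syz0 e : syz_dim 0 0 e (tor_dim F 0 e).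
Proof.
have triv (z : chains (rk F 0)) : kcyc (@kerF 0) 0 z by move=> S.
apply: (@tor_base 0 e _ _ (fun c => c *m (0 : 'M_(_, 0)) = 0)).
- split=> [|x y _ _|a x _]; exact: triv.
- by split=> *; rewrite mulmx0.
- move=> z; split=> _; [exact: mulmx0|exact: triv].
- by apply: hdim_qdim; rewrite mulmx0.
Qed.

(** By [tor_base], Tor in degree p + 1 is the [kstep] kernel in Koszul degree 0 over the syzygy p +
    1; the connecting map makes it the first Koszul homology of syzygy p, and p more shifts lead to
    degree p + 1 over syzygy 0. *)
Lemma tor_dim_syz p e : syz_dim p.+1 0 e (tor_dim F p.+1 e).
Proof.
rewrite -[p]add0n; apply: syz_shifts.
apply: (step_graded (@kerF_im p) (@dif_hom p)).
apply: (@tor_base p.+1 e _ _ (fun c => c *m tor_dif F p e = 0)).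
- exact: subsp_kstep.
- split=> [|x y hx hy|a x hx]; rewrite ?mul0mx ?mulmxDl ?hx ?hy ?addr0 //.
  by rewrite -scalemxAl hx scaler0.
- move=> z; rewrite -crow_mul crow_eq0.
  have E : kproj gd e z set0 *m dif F p = rproj gd 0 e (z set0 *m dif F p).
    by rewrite kproj_set0; apply/esym/rproj_mulmx; exact: dif_hom.
  split=> [[y hy] b|/const0_kdel[y hy]].
    by rewrite -E hy ?cards0 // kdel_const.
  by exists y => S /cards0_eq ->; rewrite E.
- apply: hdim_qdim; apply/row_matrixP => a; rewrite row0 row_mul rowE.
  have [w <-] := crow_onto (delta_mx 0 a).
  by rewrite -!crow_mul -mulmxA dif_dif mulmx0 crow0.
Qed.

Lemma tor_dim_syz_all i e : syz_dim i 0 e (tor_dim F i e).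
Proof. by case: i => [|i]; [exact: tor_dim_syz0|exact: tor_dim_syz]. Qed.

Section Augmentation.
Hypotheses (ID : forall x y, I x -> I y -> I (x + y)) (I0 : I 0)
  (IM : forall a x, I x -> I (a * x)) (Ip : forall c e x, I x -> I (mproj c e x)).

Definition inI (w : 'rV[R]_1) : Prop := I (w 0 0).
Notation gd0 := (fun _ : 'I_1 => 0%N).

Lemma rsub_inI : rsub inI.
Proof.
by split=> [|x y|a x]; rewrite /inI !mxE //; [apply: ID|apply: IM].
Qed.

Lemma rsub_kerF0 : rsub (@kerF 0).
Proof.
split; rewrite /kerF.
- by rewrite mul0mx mxE.
- by move=> x y hx hy; rewrite mulmxDl mxE; apply: ID.
- by move=> a x hx; rewrite -scalemxAl mxE; apply: IM.
Qed.

Definition aug_rel (q : nat) (z : chains (rk F 0)) (z' : chains 1) : Prop :=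
  forall S : {set V}, #|S| = q -> inI (z' S - z S *m aug F).

Let kdelI (y : {set V} -> 'rV[R]_1) (S : {set V}) :
  (forall S' : {set V}, #|S'| = #|S|.+1 -> inI (y S')) -> inI (kdel y S).
Proof.
move=> h; apply: (rsub_sum rsub_inI) => v vS; case: rsub_inI => _ _; apply.
by apply: h; rewrite cardsU1 vS.
Qed.

(** F_0 may have several generators, so syzygy 0 is R^(rk 0) / [kerF 0], isomorphic to R / I through
    [aug]. Lifts exist by surjectivity of [aug] and are determined only modulo the kernel, whence
    the relation. *)
Lemma aug_iso q :
  subq_iso (mC V) (mC V) (aug_rel q) (kcyc (@kerF 0) q) (kbd (@kerF 0) q)
    (kcyc inI q) (kbd inI q).
Proof.
have IB := rsubB rsub_inI; have [J0 JD JZ] := rsub_inI.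
split.
- split=> [S Sq|x y x' y' hx hy S Sq|c x x' hx S Sq].
  + by rewrite !ffunE mul0mx subr0.
  + by rewrite !ffunE mulmxDl opprD addrACA; apply: JD; [apply: hx|apply: hy].
  + by rewrite /= !ffunE -scalemxAl -scalerBr; apply/JZ/hx.
- move=> z hz; exists [ffun S => z S *m aug F]; split=> [S Sq|S Sq].
    rewrite (eq_kdel (z := fun S => z S *m aug F)); last by move=> S' _; rewrite ffunE.
    by rewrite kdel_mulmx; apply: hz.
  by rewrite ffunE subrr.
- move=> z' hz'.
  have /dep_choice[u hu] (S : {set V}) := aug_surj F (z' S 0 0).
  have L (S : {set V}) : inI (z' S - u S *m aug F) by have := hu S; rewrite /inI !mxE.
  exists [ffun S => u S]; split=> [S Sq|S Sq]; last by rewrite ffunE; apply: L.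
  change (inI (kdel [ffun S => u S] S *m aug F)).
  rewrite (eq_kdel (z := u)); last by move=> S' _; rewrite ffunE.
  rewrite -kdel_mulmx -[kdel _ _](subKr (kdel z' S)); apply: IB; first exact: hz'.
  by rewrite -kdelB; apply: kdelI => S' _; apply: L.
- move=> z z' hz hz' L; split=> -[y hy].
  + exists [ffun S => y S *m aug F] => S Sq.
    rewrite (eq_kdel (z := fun S => y S *m aug F)); last by move=> S' _; rewrite ffunE.
    rewrite kdel_mulmx -[z' S](subrK (z S *m aug F)) -addrA -mulmxBl.
    by apply: JD; [apply: L|apply: hy].
  + have /dep_choice[u hu] (S : {set V}) := aug_surj F (y S 0 0).
    have Lu (S : {set V}) : inI (y S - u S *m aug F) by have := hu S; rewrite /inI !mxE.
    exists [ffun S => u S] => S Sq.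
    change (inI ((z S - kdel [ffun S => u S] S) *m aug F)).
    rewrite (eq_kdel (z := u)); last by move=> S' _; rewrite ffunE.
    rewrite mulmxBl -kdel_mulmx.
    rewrite (_ : _ - _ = (z' S - kdel y S) - (z' S - z S *m aug F)
        + kdel (fun S => y S - u S *m aug F) S).
      apply: JD; first by apply: IB; [apply: hy|apply: L].
      by apply: kdelI => S' _; apply: Lu.
    have gen (a b c d : 'rV[R]_1) : c - d = (a - b) - (a - c) + (b - d).
      by rewrite opprB [a - b + _]addrC [c - a + _]addrA subrK addrA subrK.
    by rewrite kdelB; apply: gen.
Qed.


Lemma aug_graded q e d :
  qdim (mC V) (fun z => kcyc (@kerF 0) q (kproj gd e z)) (fun z => kbd (@kerF 0) q (kproj gd e z)) d ->
  qdim (mC V) (fun z => kcyc inI q (kproj gd0 e z)) (fun z => kbd inI q (kproj gd0 e z)) d.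
Proof.
have IpR c (w : 'rV[R]_1) : inI w -> inI (rproj gd0 c e w).
  rewrite /inI mxE addn0 => h; exact: Ip.
have hom a b u : u \in msupp (aug F a b) -> gd a = (2 * mdeg u + gd0 b)%N.
  by rewrite [b]ord1 addn0; apply: aug_homog.
have [[L0 LD LZ] _ _ _] := aug_iso q.
have augE (z : chains (rk F 0)) (S : {set V}) :
    rproj gd0 (2 * #|S|) e (z S *m aug F) = kproj gd e z S *m aug F.
  by rewrite ffunE; apply: rproj_mulmx.
apply: qdim_transport (subq_iso_graded (p := kproj gd e) (p' := kproj gd0 e) _ _ _ _ _ _ (aug_iso q)).
- exact/subsp_kcyc/rsub_kerF0.
- exact/subsp_kcyc/rsub_inI.
- split=> [|x y x' y' hx hy|c x x' hx].
  + by rewrite !kproj0; exact: L0.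
  + by rewrite !kprojD; exact: LD hx hy.
  + by rewrite !kprojZ; exact: LZ hx.
- exact: kproj_id.
- exact: kproj_id.
- move=> z hz S Sq; rewrite -rproj_kdel.
  have := IpR (2 * #|S|)%N _ (hz S Sq).
  by rewrite (rproj_mulmx _ _ _ hom).
- by move=> z' hz S Sq; rewrite -rproj_kdel; apply/IpR/hz.
- move=> z z' L S Sq; rewrite -augE [kproj gd0 e z' S]ffunE -rprojB; exact/IpR/L.
Qed.

End Augmentation.
End TorDim.

(** * Hochster's formula *)

Lemma reduced_bettiE (T : finType) (G : {set {set T}}) (N i : nat) :
  reduced_betti (N%:Z - i%:Z - 1) G = if (i <= N)%N then cohom_dim G (N - i) else 0%N.
Proof.
rewrite /reduced_betti subrK; case: leqP => [iN|Ni]; first by rewrite subzn.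
by case E: (_ - _) => [k|//]; move: E Ni; lia.
Qed.

Section Hochster.
Variables (V : finType) (G : {set {set V}}).
Hypothesis hG : simplicial_complex G.
Notation n := #|V|.
Notation R := {mpoly rat[n]}.
Notation chains := {ffun {set V} -> 'rV[R]_1}.
Notation cochains := {ffun {set V} -> rat^o}.
Implicit Types (S T W : {set V}) (u w : 'X_{1..n}).

(* The Koszul sign of adding v to W :\: T, as a sign of removing v from T. *)
Definition wsign W v T : rat := ksign v W * ksign v T.

Lemma wsignP W : signs (wsign W).
Proof.
have [sq anti] := ksignP V.
have sq1 v : ksign v W * ksign v W = 1 by rewrite -expr2 sqrr_sign.
split=> [v T vT|u v T uT vT uv]; first by rewrite /wsign mulrACA sq1 sq // mulr1.
by rewrite /wsign mulrACA anti // mulrN [in RHS]mulrACA [ksign v W * ksign u W]mulrC.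
Qed.

(** The elements of [v |: (W :\: T)] below v number those of W minus those of T, and for the sign
    the difference has the same parity as the sum. *)
Lemma wsignE W v T : T \subset W -> v \in T -> ksign v (v |: (W :\: T)) = wsign W v T.
Proof.
move=> TW vT; rewrite /wsign /ksign -exprD.
have -> : [set u in v |: W :\: T | (enum_rank u < enum_rank v)%N] =
          [set u in W | (enum_rank u < enum_rank v)%N] :\: [set u in T | (enum_rank u < enum_rank v)%N].
  apply/setP => u; rewrite !inE; have [->|uv] /= := eqVneq u v; first by rewrite ltnn !andbF.
  by case: (u \in T); case: (u \in W); case: (_ < _)%N.
rewrite cardsD (setIidPr _); last first.
  by apply/subsetP => u; rewrite !inE => /andP[/(subsetP TW) -> ->].
rewrite -[RHS]signr_odd -[LHS]signr_odd; congr (_ ^+ _).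
rewrite oddB ?oddD // subset_leq_card //.
by apply/subsetP => u; rewrite !inE => /andP[/(subsetP TW) -> ->].
Qed.

Lemma mset_sub W S : (mset W - mset S)%MM = mset (W :\: S).
Proof.
by apply: mnmVP => v; rewrite mnmBE !msetE inE; case: (v \in W); case: (v \in S).
Qed.

(** The square-free multidegree W of a Koszul chain: on the exterior generator of [W :\: T] the
    complementary monomial T remains. *)
Definition kcoef (z : {set V} -> 'rV[R]_1) W T : rat := (z (W :\: T) 0 0)@_(mset T).

Lemma kdel_coef (z : {set V} -> 'rV[R]_1) S w : S \subset suppm w ->
  (kdel z S 0 0)@_(w - mset S) =
  \sum_(v | (v \notin S) && (v |: S \subset suppm w))
     ksign v (v |: S) * (z (v |: S) 0 0)@_(w - mset (v |: S)).
Proof.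
move=> Sw; rewrite kdel_entry.
have := @tdel_coef V V (@kos V) (fun S => z S 0 0) S w.
rewrite tsupp_kos => /(_ Sw) ->.
by apply: eq_big => [v|v _]; rewrite tsupp_kos.
Qed.

Lemma kdel_delta (z : {set V} -> 'rV[R]_1) (c : cochains) W T : T \in G -> T \subset W ->
  (forall T1, T1 \in G -> T1 \subset W -> #|T1|.+1 = #|T| -> c T1 = kcoef z W T1) ->
  (kdel z (W :\: T) 0 0)@_(mset T) = delta (wsign W) (restr G W) c T.
Proof.
move=> TG TW h; have [_ dG] := hG.
have WT : W :\: (W :\: T) = T by rewrite setDDr setDv set0U (setIidPr TW).
have -> : mset T = (mset W - mset (W :\: T))%MM by rewrite mset_sub WT.
rewrite kdel_coef ?suppm_mset ?subsetDl //.
have key v : v \in T -> W :\: (T :\ v) = v |: (W :\: T).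
  move=> vT; apply/setP => u; rewrite !inE; have [->|uv] := eqVneq u v => //=.
  by rewrite (subsetP TW).
apply: eq_big => [v|v /andP[vS vW]].
  rewrite subUset sub1set subsetDl andbT !inE negb_and negbK.
  case: (boolP (v \in T)) => [vT|] /=; last by case: (v \in W).
  by rewrite (subsetP TW _ vT) (dG _ _ TG (subD1set _ _)) (subset_trans (subD1set _ _) TW).
have vT : v \in T.
  by move: vS vW; rewrite subUset sub1set !inE negb_and negbK => /orP[//|/negPf ->].
have TvG : T :\ v \in G := dG _ _ TG (subD1set _ _).
have TvW : T :\ v \subset W := subset_trans (subD1set _ _) TW.
have Tvc : #|T :\ v|.+1 = #|T| by rewrite [RHS](cardsD1 v) vT.
rewrite wsignE // (h _ TvG TvW Tvc) /kcoef -(key v vT) mset_sub.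
by rewrite setDDr setDv set0U (setIidPr TvW).
Qed.

Definition hrel (q : nat) (z : chains) (c : {ffun {set V} -> cochains}) : Prop :=
  forall W T, T \in G -> T \subset W -> #|W :\: T| = q -> c W T = kcoef z W T.

(** Exterior degree q corresponds to faces of cardinality k = #|W| - q. The additive form makes the
    condition void for q > #|W|, where truncated subtraction would give 0. *)
Definition hcyc (q : nat) (c : {ffun {set V} -> cochains}) : Prop :=
  forall W k, (k + q)%N = #|W| -> cocyc (wsign W) (restr G W) k (c W).

Definition hbd (q : nat) (c : {ffun {set V} -> cochains}) : Prop :=
  forall W k, (k + q)%N = #|W| -> cobd (wsign W) (restr G W) k (c W).

Notation inIG := (inI (sr_ideal G)).

Lemma inIG_P (w : 'rV[R]_1) : inIG w <-> forall u, suppm u \in G -> (w 0 0)@_u = 0.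
Proof. exact: sr_idealP. Qed.

Lemma cardWT W T k q : T \subset W -> (k + q)%N = #|W| -> #|T| = k -> #|W :\: T| = q.
Proof. by move=> TW kq Tk; rewrite cardsD (setIidPr TW) -kq Tk addKn. Qed.

Lemma hrel_lin q : linrel (mC V) idfun (hrel q).
Proof.
split=> [W T TG TW Wq|z y c d hz hy W T TG TW Wq|a z c hz W T TG TW Wq].
- by rewrite /kcoef !ffunE mxE mcoeff0.
- by rewrite /kcoef !ffunE mxE mcoeffD hz // hy.
- by rewrite /kcoef /= !ffunE mxE mcoeffCM hz.
Qed.

Lemma hrel_cyc q z : kcyc inIG q z -> exists c, hcyc q c /\ hrel q z c.
Proof.
move=> hz; exists [ffun W => [ffun T => kcoef z W T]]; split; last first.
  by move=> W T _ _ _; rewrite !ffunE.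
move=> W k kq T; rewrite inE => /andP[TG TW] Tk.
rewrite -(@kdel_delta z) // => [|T1 _ _ _]; last by rewrite !ffunE.
have /inIG_P -> // : inIG (kdel z (W :\: T)); last by rewrite suppm_mset.
apply: hz; have := cardsD W T; rewrite (setIidPr TW) -kq Tk => ->.
have := subset_leq_card TW; rewrite Tk -kq; lia.
Qed.

(** Reassembles a chain from its square-free multidegrees: the monomial T on the exterior generator
    S belongs to W = S :|: T. *)
Definition hchain (c : {ffun {set V} -> cochains}) : chains :=
  [ffun S : {set V} => \row_(b < 1) \sum_(T | (T \in G) && [disjoint T & S]) c (S :|: T) T *: 'X_[mset T]].

Lemma hchain_coef c S u : (hchain c S 0 0)@_u =
  if [&& u == mset (suppm u), suppm u \in G & [disjoint suppm u & S]]
  then c (S :|: suppm u) (suppm u) else 0.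
Proof.
rewrite ffunE mxE raddf_sum /=; case: and3P => [[/eqP uE uG ud]|no].
  rewrite (bigD1 (suppm u)) /=; last by rewrite uG ud.
  rewrite mcoeffZ mcoeffX -uE eqxx mulr1 big1 ?addr0 // => T /andP[_ Tu].
  rewrite mcoeffZ mcoeffX; case: eqP => [E|]; last by rewrite mulr0.
  by move: Tu; rewrite -E suppm_mset eqxx.
rewrite big1 // => T /andP[TG Td]; rewrite mcoeffZ mcoeffX; case: eqP => [E|]; last by rewrite mulr0.
by case: no; rewrite -E suppm_mset.
Qed.

Lemma hrel_hchain q c : hrel q (hchain c) c.
Proof.
move=> W T TG TW Wq; rewrite /kcoef hchain_coef suppm_mset eqxx TG /=.
have -> : [disjoint T & W :\: T] by rewrite disjoint_sym disjoints_subset setDE subsetIr.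
rewrite (_ : W :\: T :|: T = W) //; apply/setP => v; rewrite !inE.
by case: (boolP (v \in T)) => [/(subsetP TW) ->|]; rewrite ?orbT ?orbF.
Qed.

Lemma hchain_cyc q c : hcyc q c -> kcyc inIG q (hchain c).
Proof.
move=> hc S Sq; apply/inIG_P => u uG.
case: (boolP ((u == mset (suppm u)) && [disjoint suppm u & S])) => [/andP[/eqP uE ud]|no].
  pose W := S :|: suppm u.
  have TW : suppm u \subset W by apply: subsetUr.
  have WT : W :\: suppm u = S.
    rewrite setDUl setDv setU0; apply/setDidPl; by rewrite disjoint_sym.
  rewrite -[S]WT (_ : (_)@_u = (kdel (hchain c) (W :\: suppm u) 0 0)@_(mset (suppm u))); last by rewrite -uE.
  rewrite (@kdel_delta _ (c W)) //; last first.
    move=> T1 T1G T1W T1q; apply: (@hrel_hchain q) => //.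
    apply: (cardWT (k := #|T1|)) => //.
    have := cardsD W (suppm u); rewrite WT (setIidPr TW).
    have := subset_leq_card TW; lia.
  have [T0|T0] := posnP #|suppm u|; first by rewrite delta_card0.
  apply: (hc W #|suppm u|.-1); rewrite ?inE ?uG ?TW ?prednK //.
  have := cardsD W (suppm u); rewrite WT (setIidPr TW).
  have := subset_leq_card TW; move: T0 Sq; lia.
(* Here w is not square-free. All values of [hchain] are concentrated in square-free multidegrees,
   so a nonzero term of the differential would force u to be square-free and disjoint from S. *)
set w := (u + mset S)%MM.
have Sw : S \subset suppm w by rewrite -mset_le /w lem_addl.
have -> : u = (w - mset S)%MM by rewrite /w addmK.
rewrite kdel_coef // big1 // => v /andP[vS vw].
rewrite hchain_coef; set x := (w - mset (v |: S))%MM.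
case: and3P => [[/eqP xE xG xd]|]; last by rewrite mulr0.
have vx : v \notin suppm x by rewrite (disjointFl xd) // setU11.
have uE : u = mset (v |: suppm x).
  apply: mnmVP => y; rewrite msetE.
  have := congr1 (fun m : 'X_{1..n} => m (enum_rank y)) xE.
  rewrite msetE /x /w mnmBE mnmDE !msetE -/w -/x !in_setU1.
  have [-> _|yv /=] := eqVneq y v.
    have := vx; rewrite !inE /x /w mnmBE mnmDE !msetE in_setU1 eqxx (negPf vS) negbK addn0 /=.
    have := subsetP vw v (setU11 v S); rewrite inE /w mnmDE msetE (negPf vS) addn0.
    by move: (u (enum_rank v)) => k; lia.
  case: (boolP (y \in S)) => yS; last by rewrite addn0 subn0.
  by rewrite addnK.
have su : suppm u = v |: suppm x := etrans (congr1 (@suppm V) uE) (suppm_mset _).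
case/negP: no; rewrite su -uE eqxx /=.
rewrite disjoint_setU1 vS; apply: disjointWr xd; exact: subsetUr.
Qed.

Lemma hrel_bd q z c : hrel q z c -> kbd inIG q z -> hbd q c.
Proof.
move=> L [y hy] W k kq; exists [ffun T => kcoef y W T] => T; rewrite inE => /andP[TG TW] Tk.
have Wq := cardWT TW kq Tk.
rewrite -(@kdel_delta y) // => [|T1 _ _ _]; last by rewrite ffunE.
rewrite (L W T) // /kcoef; have /inIG_P/(_ (mset T)) := hy _ Wq.
by rewrite suppm_mset !mxE mcoeffB => /(_ TG)/eqP; rewrite subr_eq0 => /eqP.
Qed.

Lemma hrel_kbd q z c : hrel q z c -> kcyc inIG q z -> hbd q c -> kbd inIG q z.
Proof.
move=> L hz hc; have [_ dG] := hG.
suff [y hy] : exists y, forall S u, #|S| = q -> suppm u \in G ->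
    (z S 0 0)@_u = (tdel (@kos V) y S)@_u.
  exists [ffun S => \row_(b < 1) y S] => S Sq; apply/inIG_P => u uG.
  rewrite !mxE mcoeffB hy // kdel_entry; apply/eqP; rewrite subr_eq0; apply/eqP.
  by congr (_@_ _); apply: eq_bigr => v _; rewrite ffunE mxE.
apply: (@tdel_lift _ _ _ q (fun S => z S 0 0) (fun u => suppm u \in G)) => w.
case: (pickP (fun b => 1 < w (enum_rank b))%N) => [b b1|no].
  (* [X] indexes a basis of multidegree w of the Koszul complex of the Stanley-Reisner ring. As b
     has exponent at least 2, it stays in the support of [w - mset S] whether or not it belongs to
     S, so it can be toggled. *)
  pose X := [set S : {set V} | (S \subset suppm w) && (suppm (w - mset S)%MM \in G)].
  have tog (S : {set V}) : b \notin S -> (S \in X) = (b |: S \in X).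
    move=> bS; rewrite !inE subUset sub1set.
    have -> : b \in suppm w by rewrite inE -lt0n; apply: ltn_trans b1.
    congr (_ && (_ \in G)); apply/setP => v; rewrite !inE !mnmBE !msetE in_setU1.
    by have [->|//] := eqVneq v b; rewrite (negPf bS) /= -!lt0n !subn_gt0 b1 (ltn_trans _ b1).
  have XU s (S : {set V}) : S \in X -> (s |: S \in X) = (s |: S \subset suppm w).
    rewrite !inE => /andP[_ h]; rewrite andb_idr // => _; apply: dG h _.
    apply/subsetP => v; rewrite !inE !mnmBE !msetE; apply: contraNneq => h.
    by rewrite -leqn0 -h leq_sub2l // in_setU1; case: (v \in S); rewrite ?orbT.
  have [S SX Sq|y hy] := chain_contract (ksignP V) tog (k := q)
      (z := fun S => (z S 0 0)@_(w - mset S)).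
    have := SX; rewrite inE => /andP[Sw SG].
    have /inIG_P/(_ _ SG) := hz S Sq; rewrite kdel_coef // => E; rewrite -[RHS]E.
    by apply: eq_bigl => s; rewrite XU.
  exists y => S; rewrite tsupp_kos => Sw Sq SG.
  have SX : S \in X by rewrite inE Sw.
  by rewrite hy //; apply: eq_bigl => s; rewrite tsupp_kos XU.
(* All exponents are now at most 1, and a primitive of the cochain [c W], read on complements,
   solves the equation. *)
have wE : w = mset (suppm w).
  apply: mnmVP => v; have := no v; rewrite msetE inE; move: (w _) => k; lia.
move: (suppm w) wE => W ->.
have [qW|Wq] := leqP q #|W|; last first.
  exists (fun=> 0) => S; rewrite tsupp_kos => /subset_leq_card SW Sq.
  by move: Wq; rewrite -Sq ltnNge SW.
have [e he] := hc W (#|W| - q)%N (subnK qW).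
exists (fun S => e (W :\: S)) => S; rewrite tsupp_kos => SW Sq.
rewrite mset_sub suppm_mset => WSG.
have WW : W :\: (W :\: S) = S by rewrite setDDr setDv set0U (setIidPr SW).
have card : #|W :\: S| = (#|W| - q)%N by rewrite cardsD (setIidPr SW) Sq.
transitivity (c W (W :\: S)).
  by rewrite (L W (W :\: S)) // /kcoef ?WW // subsetDl.
rewrite he ?inE ?WSG ?subsetDl //.
have E (v : V) : (W :\: S) :\ v = W :\: (v |: S) by apply/setP => x; rewrite !inE negb_or andbA.
apply: eq_big => [v|v /andP[vWS _]].
  rewrite tsupp_kos subUset sub1set SW andbT !inE -andbA; congr (_ && _).
  by rewrite andb_idr // => _; rewrite (dG _ _ WSG (subD1set _ _)) (subset_trans (subD1set _ _)) ?subsetDl.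
by rewrite -wsignE ?subsetDl // WW E.
Qed.

Lemma hoch_iso q :
  subq_iso (mC V) idfun (hrel q) (kcyc inIG q) (kbd inIG q) (hcyc q) (hbd q).
Proof.
split.
- exact: hrel_lin.
- exact: hrel_cyc.
- by move=> c hc; exists (hchain c); split; [exact: hchain_cyc|exact: hrel_hchain].
- by move=> z c hz hc L; split; [exact: hrel_bd|exact: hrel_kbd].
Qed.

Lemma sr_ideal_mproj c e (p : R) : sr_ideal G p -> sr_ideal G (mproj c e p).
Proof.
move=> /(sr_idealP hG) hp; apply/(sr_idealP hG) => u uG.
by rewrite mcoeff_mproj hp // if_same.
Qed.

Definition hproj (e : nat) (c : {ffun {set V} -> cochains}) : {ffun {set V} -> cochains} :=
  [ffun W : {set V} => if (2 * #|W|)%N == e then c W else 0].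

Lemma hproj_lin e a c d : hproj e (a *: c + d) = a *: hproj e c + hproj e d.
Proof.
by apply/ffunP => W; rewrite !ffunE; case: (_ == e); rewrite ?scaler0 ?addr0.
Qed.

Lemma hproj0 e : hproj e 0 = 0.
Proof. by apply/ffunP => W; rewrite !ffunE if_same. Qed.

Lemma hprojE e c W : hproj e c W = if (2 * #|W|)%N == e then c W else 0.
Proof. by rewrite ffunE. Qed.

Lemma subsp_hproj (P : {set V} -> cochains -> Prop) e :
  (forall W, subsp idfun (P W)) ->
  forall W, subsp idfun (fun x => P W (if (2 * #|W|)%N == e then x else 0)).
Proof.
move=> h W; have [P0 PD PZ] := h W; case: (_ == e); first exact: h.
by split=> // x y _ _.
Qed.

Lemma hoch_dim q e :
  qdim (mC V) (fun z => kcyc inIG q (kproj (fun=> 0%N) e z))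
    (fun z => kbd inIG q (kproj (fun=> 0%N) e z))
    (\sum_(W : {set V}) (if ((2 * #|W|)%N == e) && (q <= #|W|)%N
       then cohom_dim (restr G W) (#|W| - q) else 0%N)).
Proof.
pose P (W : {set V}) (x : cochains) := forall k, (k + q)%N = #|W| -> cocyc (wsign W) (restr G W) k x.
pose Q (W : {set V}) (x : cochains) := forall k, (k + q)%N = #|W| -> cobd (wsign W) (restr G W) k x.
have sP W : subsp idfun (P W).
  split=> [k|x y hx hy k kW|a x hx k kW]; case: (subsp_cocyc (wsign W) (restr G W) k) => H0 HD HZ //.
    by apply: HD; [apply: hx|apply: hy].
  by apply: HZ; apply: hx.
have sQ W : subsp idfun (Q W).
  split=> [k|x y hx hy k kW|a x hx k kW]; case: (subsp_cobd (wsign W) (restr G W) k) => H0 HD HZ //.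
    by apply: HD; [apply: hx|apply: hy].
  by apply: HZ; apply: hx.
have restrG W : simplicial_complex (restr G W).
  have [G0 dG] := hG; split=> [|s t]; rewrite !inE; first by rewrite G0 sub0set.
  by move=> /andP[sG sW] ts; rewrite (dG _ _ sG ts) (subset_trans ts sW).
have HW W : qdim idfun (fun x => P W (if (2 * #|W|)%N == e then x else 0))
   (fun x => Q W (if (2 * #|W|)%N == e then x else 0))
   (if ((2 * #|W|)%N == e) && (q <= #|W|)%N
       then cohom_dim (restr G W) (#|W| - q) else 0%N).
  case: (_ == e) => /=; last by apply: qdim0 => x _; case: (sQ W).
  case: leqP => [qW|Wq]; last first.
    by apply: qdim0 => x _ k kq; move: Wq; rewrite -kq ltnNge leq_addl.
  (* [cohom_dim] is defined with the signs [ksign], whereas the Koszul complex in multidegree W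
     produces [wsign W]. *)
  have h := hcoh_signs (ksignP V) (wsignP W) (cohom_dimP (simplicial_convex (restrG W)) (#|W| - q)).
  apply: qdim_ext h => x; split=> [h k kW|]; rewrite /P /Q.
  - by rewrite (_ : k = #|W| - q)%N // -kW addnK.
  - by apply; rewrite subnK.
  - by rewrite (_ : k = #|W| - q)%N // -kW addnK.
  - by apply; rewrite subnK.
have HS := qdim_sum (subsp_hproj e sP) (subsp_hproj e sQ) HW.
have hp_id c : hproj e (hproj e c) = hproj e c.
  by apply/ffunP => W; rewrite !hprojE; case: (_ == e).
have I0 := sr_ideal0 hG.
have ID := fun x y => @sr_idealD V G hG x y.
have IM := fun a x => @sr_idealM V G a x.
have rI : rsub inIG by apply: rsub_inI.
have [[L0 LD LZ] _ _ _] := hoch_iso q.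
have iso := subq_iso_graded (p := kproj (fun=> 0%N) e) (p' := hproj e) _ _ hp_id _ _ _ (hoch_iso q).
have HE : qdim idfun (fun c => hcyc q (hproj e c)) (fun c => hbd q (hproj e c))
    (\sum_(W : {set V}) (if ((2 * #|W|)%N == e) && (q <= #|W|)%N
       then cohom_dim (restr G W) (#|W| - q) else 0%N)).
  apply: qdim_ext HS => c; split=> h W k;
    by have := h W k; rewrite hprojE.
apply: (qdim_transport_sym _ _ (iso _ _ _ _ _)) HE.
- exact: subsp_kcyc.
- split=> [W k|x y hx hy W k kW|a x hx W k kW].
  + by rewrite hproj0 ffunE; case: (subsp_cocyc (wsign W) (restr G W) k).
  + rewrite -[x]scale1r hproj_lin scale1r ffunE.
    by case: (subsp_cocyc (wsign W) (restr G W) k) => _ HD _; apply: HD; [apply: hx|apply: hy].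
  + rewrite -[_ *: x]addr0 hproj_lin hproj0 addr0 ffunE.
    by case: (subsp_cocyc (wsign W) (restr G W) k) => _ _ HZ; apply: HZ; apply: hx.
- split=> [|x y x' y' hx hy|a x x' hx].
  + by rewrite kproj0 hproj0.
  + rewrite kprojD -[x']scale1r hproj_lin scale1r; exact: LD hx hy.
  + rewrite kprojZ -[_ *: x']addr0 hproj_lin hproj0 addr0; exact: LZ hx.
- exact: kproj_id.
- by move=> z hz S Sq; rewrite -rproj_kdel /inI mxE; apply/sr_ideal_mproj/hz.
- move=> c hc W k kW; rewrite hprojE; case: (_ == e); first exact: hc.
  by case: (subsp_cocyc (wsign W) (restr G W) k).
- move=> z c L W T TG TW Wq; rewrite hprojE /kcoef ffunE mxE mcoeff_mproj mdeg_mset addn0 -mulnDr.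
  rewrite cardsD (setIidPr TW) subnKC ?subset_leq_card //.
  by case: (_ == e); [exact: L|rewrite ffunE].
Qed.

Lemma tor_dim_hochster (F : graded_free_resolution (sr_ideal G)) q e :
  tor_dim F q e = (\sum_(W : {set V}) (if ((2 * #|W|)%N == e) && (q <= #|W|)%N
       then cohom_dim (restr G W) (#|W| - q) else 0%N))%N.
Proof.
have I0 := sr_ideal0 hG.
have ID := fun x y => @sr_idealD V G hG x y.
have IM := fun a x => @sr_idealM V G a x.
have rI : rsub inIG by apply: rsub_inI.
apply: qdim_uniq (hoch_dim q e); first exact: subsp_kbd.
apply: aug_graded (tor_dim_syz_all F q e) => //; exact: sr_ideal_mproj.
Qed.

Theorem hochster q j : bigraded_betti G q (2 * j) =
  (\sum_(W : {set V} | #|W| == j) reduced_betti (#|W|%:Z - q%:Z - 1) (restr G W))%N.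
Proof.
(* [epsilon_spec] needs some resolution to exist; the one it returns is unknown, but
   [tor_dim_hochster] applies to all. *)
have ex : exists b, exists F : graded_free_resolution (sr_ideal G), b = tor_dim F q (2 * j).
  by exists (tor_dim (taylor_resolution hG) q (2 * j)), (taylor_resolution hG).
rewrite /bigraded_betti; have [F ->] := epsilon_spec (inhabits 0%N) _ ex.
rewrite tor_dim_hochster [RHS]big_mkcond; apply: eq_bigr => W _.
rewrite eqn_mul2l /=; case: eqP => //= _.
by rewrite reduced_bettiE.
Qed.

End Hochster.

(** * Betti numbers of Bier spheres *)

Section BierBetti.
Variables (m : nat) (i : nat).
Notation T := ('I_m + 'I_m)%type.
Implicit Types (K : {set {set 'I_m}}) (I J S : {set 'I_m}).

Lemma bier_complex K : simplicial_complex K -> K <> powerset [set: 'I_m] ->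
  simplicial_complex (bier K).
Proof.
move=> hK hp; have E s : (s \in bier K) = (s \in bfam K setT setT).
  by rewrite in_bier inE !subsetT !andbT.
split=> [|s t]; rewrite !E; last exact: bfam_down.
rewrite inE; have -> : lft set0 = set0 :> {set 'I_m} by apply/setP => v; rewrite !inE.
have -> : rgt set0 = set0 :> {set 'I_m} by apply/setP => v; rewrite !inE.
rewrite !sub0set -setI_eq0 setI0 eqxx (proj1 hK) setC0 /= !andbT.
apply/negP => h; apply: hp; apply/setP => s; rewrite !inE subsetT.
by case: hK => _; apply; [exact: h|exact: subsetT].
Qed.

Lemma bfam_convex K I J : simplicial_complex K -> convex (bfam K I J).
Proof. by move=> hK; apply: down_convex; apply: bfam_down. Qed.

Lemma bfam_betti0 K I J (N : nat) : simplicial_complex K ->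
  (forall k, hcoh (@ksign T) (bfam K I J) k 0) ->
  reduced_betti (N%:Z - i%:Z - 1) (bfam K I J) = 0%N.
Proof.
move=> hK h; rewrite reduced_bettiE; case: ifP => // _.
by apply: cohom_dim_eq (h _); apply: bfam_convex.
Qed.

Lemma bfam_betti_link K I J : simplicial_complex K -> J \proper I ->
  reduced_betti ((#|I| + #|J|)%N%:Z - i%:Z - 1) (bfam K I J) =
  if J \in K then reduced_betti (#|I|%:Z - i%:Z - 1) (link J (restr K I)) else 0%N.
Proof.
move=> hK /properP[JI [a aI aJ]].
case: ifPn => JK; last by apply: bfam_betti0 => // k; apply: (bfam_link_notin hK (ksignP _) aI).
rewrite !reduced_bettiE; case: (leqP i #|I|) => [iI|Ii].
  rewrite (leq_trans iI (leq_addr _ _)); apply: cohom_dim_eq; first exact: bfam_convex.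
  rewrite addnC -addnBA //.
  apply/(bfam_link hK (ksignP _) JI aI aJ) => //; apply: cohom_dimP.
  by apply: down_convex; apply: link_restr_down.
case: ifP => // iN; apply: cohom_dim_eq; first exact: bfam_convex.
apply: (bfam_link_small hK (ksignP _) JI aI aJ) => //.
move: Ii iN; lia.
Qed.

Lemma bfam_betti_swap K I J (N : nat) : simplicial_complex K -> K <> powerset [set: 'I_m] ->
  reduced_betti (N%:Z - i%:Z - 1) (bfam K I J) =
  reduced_betti (N%:Z - i%:Z - 1) (bfam (alexander_dual K) J I).
Proof.
move=> hK hp; rewrite !reduced_bettiE; case: ifP => // _.
apply: cohom_dim_eq; first exact: bfam_convex.
apply/(hcoh_swap _ _ _ _ _ (ksignP _) (ksignP _))/cohom_dimP/bfam_convex.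
exact: alexander_dual_complex.
Qed.

(** The relevant degree is 2|S| - i. A cell of degree |S| gives i = |S|; in the dual case the degree
    is |S| - 1, so i = |S| + 1, the origin of the shift by 2 in the second Kronecker delta. *)
Lemma bfam_betti_diag K S : simplicial_complex K ->
  reduced_betti ((#|S| + #|S|)%N%:Z - i%:Z - 1) (bfam K S S) =
  (((S \in K) && (S \in alexander_dual K) && (i == #|S|))
   + ((S \notin K) && (S \notin alexander_dual K) && (i == #|S|.+1)))%N.
Proof.
move=> hK; rewrite [S \in alexander_dual K]inE negbK.
case: (boolP (S \in K)) => SK; case: (boolP (~: S \in K)) => SK' /=.
- by apply: bfam_betti0 => // k; apply: bfam_diag_both => //; exact: ksignP.
- rewrite addn0 reduced_bettiE; case: leqP => [iN|Ni]; last by case: eqP Ni => //; lia.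
  rewrite (cohom_dim_eq (@bfam_convex K S S hK) (bfam_diag_full hK (ksignP _) _ SK SK')).
  by congr nat_of_bool; apply/eqP/eqP; move: #|S| iN => s; lia.
(* The empty set is a face, so S is nonempty; this rules out i = |S| + 1 exceeding 2|S|. *)
- have S0 : (0 < #|S|)%N by rewrite card_gt0; apply: contraNneq SK => ->; case: hK.
  rewrite add0n reduced_bettiE; case: leqP => [iN|Ni].

    rewrite (cohom_dim_eq (@bfam_convex K S S hK) (bfam_diag_dual hK (ksignP _) _ SK SK')).
    by congr nat_of_bool; apply/eqP/eqP; move: #|S| iN S0 => s; lia.
  by move: #|S| Ni S0 => s; case: eqP => //; lia.
- by apply: bfam_betti0 => // k; apply: bfam_diag_none => //; exact: ksignP.
Qed.

Lemma diag_sum (j : nat) (A : pred {set 'I_m}) (f : {set 'I_m} -> nat) :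
  (\sum_(I : {set 'I_m}) \sum_(J : {set 'I_m} | #|I| + #|J| == j)
     (if (I == J) && A I then f I else 0) = \sum_(S : {set 'I_m} | (2 * #|S| == j) && A S) f S)%N.
Proof.
rewrite [RHS]big_mkcond; apply: eq_bigr => I _; rewrite big_mkcond (bigD1 I) //=.
rewrite big1 ?addn0; last by move=> J; rewrite eq_sym => /negPf ->; rewrite if_same.
by rewrite eqxx mul2n -addnn; case: (_ == j).
Qed.

(** The four conditions exclude each other, so the sum is a case distinction written in the form
    that splits into the four sums of the theorem. *)
Lemma bfam_betti K I J : simplicial_complex K -> K <> powerset [set: 'I_m] ->
  reduced_betti ((#|I| + #|J|)%N%:Z - i%:Z - 1) (bfam K I J) =
  ((if (I == J) && ((I \in K) && (I \in alexander_dual K)) then i == #|I| : nat else 0)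
   + (if (I == J) && ((I \notin K) && (I \notin alexander_dual K)) then i == #|I|.+1 : nat else 0)
   + (if (J \proper I) && (J \in K)
        then reduced_betti (#|I|%:Z - i%:Z - 1) (link J (restr K I)) else 0)
   + (if (I \proper J) && (I \in alexander_dual K)
        then reduced_betti (#|J|%:Z - i%:Z - 1) (link I (restr (alexander_dual K) J)) else 0))%N.
Proof.
move=> hK hp; have [<-|IJ] := eqVneq I J.
  rewrite bfam_betti_diag // properxx /= !addn0.
  by case: (I \in K); case: (I \in alexander_dual K).
rewrite /= !add0n; rewrite !properEneq [J == I]eq_sym (negPf IJ) /=.
case: (boolP (J \subset I)) => JI.
  have pJI : J \proper I by rewrite properEneq eq_sym IJ.
  rewrite bfam_betti_link // (_ : (I \subset J) = false) ?addn0 //.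
  by apply/negP => h; move: IJ; rewrite eqEsubset h JI.
case: (boolP (I \subset J)) => IsJ; last first.
  by apply: bfam_betti0 => // k; apply: bfam_incomparable => //; exact: ksignP.
have pIJ : I \proper J by rewrite properEneq IJ.
rewrite add0n bfam_betti_swap // addnC bfam_betti_link //.
exact: alexander_dual_complex.
Qed.

End BierBetti.

Theorem theorem1p2 (m : nat) (K : {set {set 'I_m}})
    (hK : simplicial_complex K) (hK_proper : K <> powerset [set: 'I_m])
    (i j : nat) :
  bigraded_betti (bier K) i (2 * j)%N =
    (kronecker (2 * i%:Z)%R j%:Z * #|Fplus K j|
     + kronecker (2 * i%:Z - 2)%R j%:Z * #|Fminus K j|
     + \sum_(I : {set 'I_m})
         \sum_(J : {set 'I_m} |
               [&& J \proper I, #|I| + #|J| == j & J \in K])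
           reduced_betti (#|I|%:Z - i%:Z - 1)%R (link J (restr K I))
     + \sum_(I : {set 'I_m})
         \sum_(J : {set 'I_m} |
               [&& I \proper J, #|I| + #|J| == j & I \in alexander_dual K])
           reduced_betti (#|J|%:Z - i%:Z - 1)%R
             (link I (restr (alexander_dual K) J)))%N.
Proof.
rewrite hochster; last exact: bier_complex.
have -> : (\sum_(W : {set 'I_m + 'I_m} | #|W| == j)
     reduced_betti (#|W|%:Z - i%:Z - 1) (restr (bier K) W))%N =
   (\sum_(I : {set 'I_m}) \sum_(J : {set 'I_m} | #|I| + #|J| == j)
     reduced_betti ((#|I| + #|J|)%N%:Z - i%:Z - 1) (bfam K I J))%N.
  rewrite pair_big_dep /=.
  rewrite (reindex (fun p : {set 'I_m} * {set 'I_m} => (inl @: p.1) :|: (inr @: p.2))) /=.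
    by apply: eq_big => [p|p _]; rewrite card_lr ?restr_bier lft_join rgt_join.
  exists (fun W => (lft W, rgt W)) => [[I J] _|W _] /=; last exact: joinK.
  by rewrite lft_join rgt_join.
under eq_bigr => I _ do under eq_bigr => J _ do rewrite bfam_betti //.
under eq_bigr => I _ do rewrite !big_split /=.
rewrite !big_split /=.
congr (_ + _ + _ + _)%N.
(* With j = 2|S| fixed, the summand [i == #|S|] is the same for all S, namely the Kronecker delta,
   and the sum becomes a multiple of a cardinality. *)
- rewrite diag_sum mulnC -sum_nat_const; apply: eq_big => [S|S /andP[/eqP jS _]].
    by rewrite [RHS]inE.
  by rewrite /kronecker -jS; congr nat_of_bool; apply/eqP/eqP; move: #|S| => s; lia.
- rewrite diag_sum mulnC -sum_nat_const; apply: eq_big => [S|S /andP[/eqP jS _]].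
    by rewrite [RHS]inE.
  by rewrite /kronecker -jS; congr nat_of_bool; apply/eqP/eqP; move: #|S| => s; lia.
- apply: eq_bigr => I _; rewrite -big_mkcondr; apply: eq_bigl => J.
  by rewrite andbCA andbA andbC andbA.
- apply: eq_bigr => I _; rewrite -big_mkcondr; apply: eq_bigl => J.
  by rewrite andbCA andbA andbC andbA.
Qed.
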